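(* Let $K=\widehat{k(t)^a}/k$ be an extension of algebraically closed analytic fields with $r=r_k(t)>0$, and assume that $|K^\times|\neq 1$ and $\mathrm{char}(\widetilde k)=p>0$. Then: (i) Let $\rho$ be any $(p^{\mathbb Z},\log|K^\times|)$-PL function on $[-\log r,\infty]$ satisfying the following condition: if $|K^\times|\neq|k^\times|$, then $\rho(-\log r)=-p^n b\log r-\log|a|$ for some $a\in k^\times$ and $b\in\mathbb Z\setminus p\mathbb Z$, where $p^n$ is the slope of $\rho$ at the endpoint $-\log r$. Then $\rho$ is of the form $\rho^{\log}_{t,t'}$ for an appropriate choice of a t.a. generator $t'$ of $K$ over $k$. (ii) The image of the map $$\Lambda_t\colon \mathrm{Aut}_k(K)\to\mathrm{Aut}(I_{K/k})\xrightarrow{\ \sim\ }\mathrm{Aut}([-\log r,\infty])$$ contains any $(p^{\mathbb Z},\log|k^\times|)$-PL function $\rho$ on $[-\log r,\infty]$ which is the identity in a neighborhood of the endpoint $-\log r$.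
   Context: An analytic field is a field complete with respect to a real-valued (rank at most one, possibly trivial) multiplicative non-archimedean absolute value $|\ |$; $\widetilde k$ denotes the residue field, and $|K^\times|\ne 1$ means that $K$ is non-trivially valued. An extension of analytic fields is a field extension in which the absolute value of the larger field restricts to that of the smaller one. $K^a$ denotes an algebraic closure with the extended absolute value, $\widehat{\ \cdot\ }$ denotes completion. An element $t\in K$ is a t.a. (topologically-algebraic) generator of $K$ over $k$ (with $k,K$ algebraically closed) if $K=\widehat{k(t)^a}$, where $\widehat{k(t)^a}$ is the closure in $K$ of the algebraic closure of $k(t)$. $\mathrm{Aut}_k(K)$ is the group of isometric $k$-automorphisms of $K$. $I_{K/k}$ is the set of complete algebraically closed intermediate fields $k\subseteq F\subseteq K$, ordered by inclusion. For $F\in I_{K/k}$ and $x\in K$ put $r_F(x)=\inf_{c\in F}|x-c|$. For a t.a. generator $t$, the map $\rho^{\log}_t\colon I_{K/k}\to[-\log r_k(t),\infty]$, $\rho^{\log}_t(F)=-\log r_F(t)$, is an order-preserving bijection. For two t.a. generators $t,t'$ with $r=r_k(t)$ and $r'=r_k(t')$, the transition function is $\rho^{\log}_{t,t'}=\rho^{\log}_{t'}\circ(\rho^{\log}_t)^{-1}\colon[-\log r,\infty]\to[-\log r',\infty]$. The map $\Lambda_t$ sends $\psi\in\mathrm{Aut}_k(K)$ to $\Lambda_t(\psi)=\rho^{\log}_{t,\psi(t)}$, i.e. to the automorphism (order-preserving bijection) of the interval obtained from the action of $\psi$ on $I_{K/k}$ via the identification $\rho^{\log}_t$. PL functions: let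 $\Gamma\subseteq\mathbb R$ be a divisible subgroup. A $(p^{\mathbb Z},\Gamma)$-PL function on an interval $I\subseteq\mathbb R$ is a continuous function $f\colon I\to\mathbb R$ which, outside of a discrete (in $I$) set of corner points, is locally of the form $f(s)=p^n s+\gamma$ with $n\in\mathbb Z$ and $\gamma\in\Gamma$. A $(p^{\mathbb Z},\Gamma)$-PL function on $[s_0,\infty]$ is an unbounded $(p^{\mathbb Z},\Gamma)$-PL function on the ray $[s_0,\infty)$ extended by $f(\infty)=\infty$; thus corners are discrete in $[s_0,\infty)$ but may accumulate at infinity. Here $\log|K^\times|=\{\log|c| : c\in K^\times\}$ and similarly for $k$. *)

(* Defs.v *)
From HB Require Import structures.
From mathcomp Require Import all_boot all_order all_algebra generic_quotient.
From mathcomp Require Import ring_quotient.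
From mathcomp Require Import all_classical all_reals all_analysis.

Set Implicit Arguments.
Unset Strict Implicit.
Unset Printing Implicit Defensive.

Import Order.TTheory GRing.Theory Num.Theory.
Import numFieldNormedType.Exports.

Local Open Scope classical_set_scope.
Local Open Scope ring_scope.

(* Possibly trivial; [v 1 = 1] follows from the axioms. *)
Record absval (R : realType) (K : fieldType) := AbsVal {
  absval_fun :> K -> R;
  absval_ge0 : forall x, 0 <= absval_fun x;
  absval_eq0 : forall x, absval_fun x = 0 <-> x = 0;
  absvalM : forall x y, absval_fun (x * y) = absval_fun x * absval_fun y;
  absval_ultra : forall x y,
    absval_fun (x + y) <= Num.max (absval_fun x) (absval_fun y) }.

Definition value_group (R : realType) (K : fieldType) (v : absval R K) :
    set R :=
  [set v x | x in [set x : K | x != 0]].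

Definition log_value_group (R : realType) (K : fieldType) (v : absval R K) :
    set R :=
  [set ln a | a in value_group v].

Definition complete_in (R : realType) (K : fieldType) (v : absval R K)
    (F : set K) : Prop :=
  forall u : nat -> K, (forall n, F (u n)) ->
    (forall e : R, 0 < e ->
      \forall m \near \oo & n \near \oo, v (u m - u n) < e) ->
    exists2 l, F l & (fun n => v (u n - l)) @ \oo --> (0 : R).

Lemma absval1 (R : realType) (K : fieldType) (v : absval R K) : v 1 = 1.
Proof.
have v1 : v 1 != 0 by apply/eqP => /absval_eq0/eqP; rewrite oner_eq0.
by apply: (mulfI v1); rewrite -absvalM !mulr1.
Qed.

Lemma absval0 (R : realType) (K : fieldType) (v : absval R K) : v 0 = 0.
Proof. exact/absval_eq0. Qed.

Lemma absvalN (R : realType) (K : fieldType) (v : absval R K) x :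
  v (- x) = v x.
Proof.
have vN1 : v (-1) = 1.
  apply/eqP; rewrite -(@pexpr_eq1 _ _ 2) ?absval_ge0 // expr2 -absvalM.
  by rewrite mulrNN mulr1 absval1.
by rewrite -mulN1r absvalM vN1 mul1r.
Qed.

Definition valuation_pred (R : realType) (K : fieldType) (v : absval R K) :
    {pred K} :=
  [pred x | v x <= 1].

Lemma valuation_pred_subring (R : realType) (K : fieldType) (v : absval R K) :
  subring_closed (valuation_pred v).
Proof.
split=> [|x y|x y]; rewrite !inE.
- by rewrite absval1.
- move=> vx vy; apply: le_trans (absval_ultra v x (- y)) _.
  by rewrite ge_max vx absvalN.
- by move=> vx vy; rewrite absvalM mulr_ile1 ?absval_ge0.
Qed.

HB.instance Definition _ (R : realType) (K : fieldType) (v : absval R K) :=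
  GRing.isSubringClosed.Build K (valuation_pred v) (valuation_pred_subring v).

Record valuation_ring (R : realType) (K : fieldType) (v : absval R K) :=
  ValuationRing {
    valuation_ring_val : K;
    valuation_ringP : valuation_ring_val \in valuation_pred v }.

HB.instance Definition _ (R : realType) (K : fieldType) (v : absval R K) :=
  [isSub for @valuation_ring_val R K v].
HB.instance Definition _ (R : realType) (K : fieldType) (v : absval R K) :=
  [Choice of valuation_ring v by <:].
HB.instance Definition _ (R : realType) (K : fieldType) (v : absval R K) :=
  [SubChoice_isSubComNzRing of valuation_ring v by <:].

Definition maximal_ideal (R : realType) (K : fieldType) (v : absval R K) :
    {pred valuation_ring v} :=
  [pred x | v (val x) < 1].
Arguments maximal_ideal {R K} v.

Lemma maximal_idealP (R : realType) (K : fieldType) (v : absval R K) :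
  idealr_closed (maximal_ideal v).
Proof.
split=> [||a x y]; rewrite !inE.
- by rewrite rmorph0 absval0 ltr01.
- by rewrite rmorph1 absval1 ltxx.
- move=> vx vy; rewrite rmorphD rmorphM.
  apply: le_lt_trans (absval_ultra v _ _) _.
  rewrite gt_max vy andbT absvalM.
  apply: le_lt_trans vx; rewrite -[leRHS]mul1r.
  by apply: ler_wpM2r; [exact: absval_ge0 | exact: (valP a)].
Qed.

HB.instance Definition _ (R : realType) (K : fieldType) (v : absval R K) :=
  isIdealr.Build (valuation_ring v) (maximal_ideal v) (maximal_idealP v).

(* Registered only as a ring, which is all that its characteristic requires. *)
Definition residue_field (R : realType) (K : fieldType) (v : absval R K) :
    comNzRingType :=
  {ideal_quot (maximal_ideal v)}.

Definition subfield (K : fieldType) (F : set K) : Prop :=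
  GRing.divring_closed [in F].

Definition alg_closed_in (K : fieldType) (F : set K) : Prop :=
  forall q : {poly K}, q \is a polyOver [in F] -> (1 < size q)%N ->
    exists2 x, F x & root q x.

Definition algebraic_over (K : fieldType) (F : set K) : set K :=
  [set x | exists q : {poly K}, [/\ q \is a polyOver [in F], q != 0 & root q x]].

(* k(t) inside K; a vanishing denominator yields the harmless value 0. *)
Definition adjoin (k K : fieldType) (iota : {rmorphism k -> K}) (t : K) :
    set K :=
  [set x | exists q1 q2 : {poly k},
     x = (map_poly iota q1).[t] / (map_poly iota q2).[t]].

(* The closure in K of the algebraic closure of k(t) in K is K itself. *)
Definition ta_generator (R : realType) (k K : fieldType) (vK : absval R K)
    (iota : {rmorphism k -> K}) (t : K) : Prop :=
  forall (x : K) (e : R), 0 < e ->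
    exists2 y, algebraic_over (adjoin iota t) y & vK (x - y) < e.

(* I_{K/k}: here F ranges over subsets of K and k is identified with its image. *)
Definition intermediate (R : realType) (k K : fieldType) (vK : absval R K)
    (iota : {rmorphism k -> K}) : set (set K) :=
  [set F | [/\ range iota `<=` F, subfield F, alg_closed_in F &
              complete_in vK F]].

Definition inf_dist (R : realType) (K : fieldType) (v : absval R K)
    (F : set K) (x : K) : R :=
  inf [set v (x - c) | c in F].

(* [lne 0 = -oo], so the value is [+oo] when [inf_dist v F t = 0]. *)
Definition rho_log (R : realType) (K : fieldType) (v : absval R K)
    (t : K) (F : set K) : \bar R :=
  (- lne (inf_dist v F t)%:E)%E.

(* rho_log t' \o (rho_log t)^-1; only meaningful on [- ln r_k(t), +oo], where
   rho_log t is invertible as a map from the intermediate fields. *)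
Definition transition (R : realType) (k K : fieldType) (vK : absval R K)
    (iota : {rmorphism k -> K}) (t t' : K) : \bar R -> \bar R :=
  rho_log vK t' \o
    'pinv_(fun=> [set: K]) (intermediate vK iota) (rho_log vK t).

Definition isometric_aut (R : realType) (k K : fieldType) (vK : absval R K)
    (iota : {rmorphism k -> K}) (psi : {rmorphism K -> K}) : Prop :=
  [/\ bijective psi, forall c, psi (iota c) = iota c &
      forall x, vK (psi x) = vK x].

Definition Lambda (R : realType) (k K : fieldType) (vK : absval R K)
    (iota : {rmorphism k -> K}) (t : K) (psi : {rmorphism K -> K}) :
    \bar R -> \bar R :=
  transition vK iota t (psi t).

(* Discreteness of the set of corners C in I means that C has no accumulation
   point in I. *)
Definition PL_fun (R : realType) (p : nat) (Gamma : set R) (I : set R)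
    (f : R -> R) : Prop :=
  {within I, continuous f} /\
  exists C : set R,
    [/\ C `<=` I,
        forall s, I s -> \forall s' \near s, C s' -> s' = s &
        forall s, I s -> ~ C s ->
          exists (n : int) (g : R), Gamma g /\
            \forall s' \near s, I s' -> f s' = (p%:R : R) ^ n * s' + g].

Definition PL_fun_ext (R : realType) (p : nat) (Gamma : set R) (s0 : R)
    (f : \bar R -> \bar R) : Prop :=
  f +oo%E = +oo%E /\
  exists g : R -> R,
    [/\ PL_fun p Gamma `[s0, +oo[ g,
        ~ [bounded g s | s in `[s0, +oo[] &
        forall s, s0 <= s -> f s%:E = (g s)%:E].

Definition endpoint_slope (R : realType) (s0 : R) (f : \bar R -> \bar R)
    (m : R) : Prop :=
  exists g : R, \forall s \near s0, s0 <= s -> f s%:E = (m * s + g)%:E.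

(* Main.v *)
(** An intermediate field [F] is known from [s = - ln dist(F, t)], and [t'] has
    transition function [g] as soon as [dist(F, t) = exp(- s)] implies
    [dist(F, t') = exp(- g s)] for every intermediate [F].

    An isometric endomorphism fixing [F] and sending [t] to [t'] exists whenever
    [|t' - t| < dist(F, t)]: it extends from [F(t)] to a maximal subfield, which is
    complete and algebraically closed.  Hence the intermediate fields form a
    chain.  If [psi_i] moves [t] by [a_i], where [|a_i|] decreases to [e], then the
    elements on which [psi_i] converges along an ultrafilter form an intermediate
    field at distance [e] from [t].

    Slopes come from the identity
    [dist(F, w^p - b w) = max(dist(F, w)^p, |b| dist(F, w))], valid when [b] is in
    [F] and [|p| |w|^(p-1) < |b|].  Writing an element as [c + w^p - b' w] with [c]
    and [b'] in an intermediate field and replacing [b'] by [b] multiplies a slope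
    by [p] or [1/p] on a segment whose ends have prescribed values in [ln|K^*|],
    and leaves the profile unchanged to its left.  Starting from an element with
    the right germ at [s0] (a scaled iterate of [w |-> w^p - b w], or a power of
    [t - c] when [|K| <> |k|]), these moves correct the profile from left to right;
    the corrections tend to 0 and the limit is [t'].  If [g] is the identity near
    [s0], then [|t' - t| < dist(k, t)], so that [t |-> t'] extends to an
    automorphism. *)
Require Import Defs.
From HB Require Import structures.
From mathcomp Require Import all_boot all_order all_algebra.
From mathcomp Require Import generic_quotient ring_quotient.
From mathcomp Require Import all_classical all_reals all_analysis.
From mathcomp Require Import lra ring zify.

Set Implicit Arguments.
Unset Strict Implicit.
Unset Printing Implicit Defensive.

Import Order.TTheory GRing.Theory Num.Theory.
Import numFieldNormedType.Exports.

Local Open Scope classical_set_scope.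
Local Open Scope ring_scope.

(** * Absolute values and roots of polynomials *)

(** Two obstacles shape the argument. First, [|p|] may be positive, so that [w^p - b w] is additive
    only up to multiples of [p]. With [|p| <= exp(- L)], the side condition on [b] limits one
    correction to segments whose image, with the old and with the new slope, is shorter than [L].
    Long segments are therefore cut up, and the pieces are chained by an induction along the real
    line. Second, a move takes its constants from a field strictly closer to [t] than [k], where
    every absolute value of [K] occurs. To the left of the endpoint there is no such field, so the
    germ at [s0] has to be built from constants of [k] alone. For the existence of fields at every
    distance, the difficulty is that the isometries do not converge on [t] itself. A nearby element
    on which they do converge is found by the trick of [ultra_step]: a relative error below 1 in [w]
    becomes negligible in [w^(p^n)]. *)

Section AbsoluteValue.
Variables (R : realType) (K : fieldType) (v : absval R K).
Implicit Types (x y z : K) (e : R).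

Lemma absval_gt0 x : (0 < v x) = (x != 0).
Proof.
rewrite lt_def absval_ge0 andbT; congr (~~ _).
by apply/eqP/eqP => [/absval_eq0 //|->]; apply/absval_eq0.
Qed.

Lemma absvalV x : v x^-1 = (v x)^-1.
Proof.
have [->|x0] := eqVneq x 0; first by rewrite invr0 absval0 invr0.
have vx0 : v x != 0 by rewrite gt_eqF ?absval_gt0.
by apply: (mulfI vx0); rewrite -absvalM !divff // absval1.
Qed.

Lemma absvalX x n : v (x ^+ n) = v x ^+ n.
Proof. by elim: n => [|n IH]; rewrite ?absval1 // !exprS absvalM IH. Qed.

Lemma absvalXz x (n : int) : v (x ^ n) = v x ^ n.
Proof. by case: n => n; rewrite ?NegzE -?exprnN ?absvalV absvalX. Qed.

Lemma absvalBC x y : v (x - y) = v (y - x).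
Proof. by rewrite -absvalN opprB. Qed.

Lemma absvalD_le e x y : v x <= e -> v y <= e -> v (x + y) <= e.
Proof. by move=> xe ye; rewrite (le_trans (absval_ultra v x y)) // ge_max xe. Qed.

Lemma absvalD_lt e x y : v x < e -> v y < e -> v (x + y) < e.
Proof. by move=> xe ye; rewrite (le_lt_trans (absval_ultra v x y)) // gt_max xe. Qed.

Lemma absvalB_le e x y : v x <= e -> v y <= e -> v (x - y) <= e.
Proof. by move=> xe ye; apply: absvalD_le; rewrite ?absvalN. Qed.

Lemma absvalB_lt e x y : v x < e -> v y < e -> v (x - y) < e.
Proof. by move=> xe ye; apply: absvalD_lt; rewrite ?absvalN. Qed.

Lemma absval_tri_le e x y z : v (x - y) <= e -> v (y - z) <= e -> v (x - z) <= e.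
Proof. by move=> xy yz; rewrite -(subrKA y) absvalD_le. Qed.

Lemma absval_tri_lt e x y z : v (x - y) < e -> v (y - z) < e -> v (x - z) < e.
Proof. by move=> xy yz; rewrite -(subrKA y) absvalD_lt. Qed.

Lemma absvalDl x y : v y < v x -> v (x + y) = v x.
Proof.
move=> yx; apply/eqP; rewrite eq_le absvalD_le ?(ltW yx) //=.
rewrite leNgt; apply/negP => xyx.
by have := absvalB_lt xyx yx; rewrite addrK ltxx.
Qed.

Lemma absvalDr x y : v x < v y -> v (x + y) = v y.
Proof. by rewrite addrC; exact: absvalDl. Qed.

Lemma absval_eq_near x y : v (x - y) < v y -> v x = v y.
Proof. by move=> /absvalDl; rewrite addrC subrK. Qed.

Lemma absval_sum_le (I : Type) (r : seq I) (P : pred I) (F : I -> K) e :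
  0 <= e -> (forall i, P i -> v (F i) <= e) -> v (\sum_(i <- r | P i) F i) <= e.
Proof.
move=> e0 He; elim/big_ind: _ => //; first by rewrite absval0.
by move=> x y; apply: absvalD_le.
Qed.

Lemma absval_prod (I : Type) (r : seq I) (P : pred I) (F : I -> K) :
  v (\prod_(i <- r | P i) F i) = \prod_(i <- r | P i) v (F i).
Proof. by elim/big_rec2: _ => [|i a b _ <-]; rewrite ?absval1 ?absvalM. Qed.

Lemma absval_nat_le1 n : v n%:R <= 1.
Proof.
elim: n => [|n IH]; first by rewrite absval0.
by rewrite -natr1 absvalD_le ?absval1.
Qed.

Lemma absval_mulrn_le x n : v (x *+ n) <= v x.
Proof.
by rewrite -mulr_natl absvalM ler_piMl ?absval_ge0 ?absval_nat_le1.
Qed.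

End AbsoluteValue.

Section Roots.
Variables (R : realType) (K : closedFieldType) (v : absval R K).
Implicit Types (x y z : K) (e : R) (q : {poly K}).

Lemma closed_root q : (1 < size q)%N -> exists x, root q x.
Proof.
move=> sq; apply/closed_rootP; by case: (size q) sq => [|[|]].
Qed.

Lemma exists_nth_root x n : (0 < n)%N -> exists y, y ^+ n = x.
Proof.
move=> n0; have [y] : exists y, root ('X^n - x%:P) y.
  by apply: closed_root; rewrite size_XnsubC.
by rewrite /root !hornerE subr_eq0 => /eqP <-; exists y.
Qed.

Lemma poly_prod_roots q : exists rs : seq K,
  q = lead_coef q *: \prod_(z <- rs) ('X - z%:P).
Proof.
by have [rs E] := closed_field_poly_normal q; exists rs.
Qed.

(* Newton polygon: if all roots have absolute value at least [d], then
   [v q`_1 * d <= v q`_0]. *)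
Lemma small_root q d :
  v q`_0 < v q`_1 * d -> exists2 x, root q x & v x < d.
Proof.
move=> q01; have d0 : 0 < d.
  have := le_lt_trans (absval_ge0 v _) q01.
  by rewrite pmulr_rgt0 // lt_def absval_ge0 andbT; case: eqP q01 => // ->;
    rewrite mul0r ltNge absval_ge0.
apply: contrapT => nr.
have [rs qE] := poly_prod_roots q.
have lq0 : lead_coef q != 0.
  rewrite lead_coef_eq0; apply/eqP => q0; move: q01.
  by rewrite q0 !coef0 absval0 mul0r ltxx.
have rsd z : z \in rs -> d <= v z.
  move=> zrs; rewrite leNgt; apply/negP => zd; apply: nr; exists z => //.
  by rewrite qE rootZ // root_prod_XsubC.
suff : v (\prod_(z <- rs) ('X - z%:P))`_1 * d <= v (\prod_(z <- rs) ('X - z%:P))`_0.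
  move: q01; rewrite qE !coefZ !absvalM -mulrA ltr_pM2l ?absval_gt0 //.
  by rewrite ltNge => /negP.
elim: rs rsd {qE} => [|z rs IH] rsd.
  by rewrite big_nil !coef1 /= absval0 mul0r absval_ge0.
rewrite big_cons; set P := \prod_(_ <- _) _ in IH *.
have {}IH : v P`_1 * d <= v P`_0 by apply: IH => u urs; apply: rsd; rewrite inE urs orbT.
have zd : d <= v z by apply: rsd; rewrite inE eqxx.
rewrite mulrBl !coefB !coefXM !coefCM /= sub0r absvalN absvalM.
apply: le_trans (_ : Num.max (v P`_0) (v (z * P`_1)) * d <= _).
  by rewrite ler_wpM2r ?(ltW d0) // -(absvalN v (z * _)) absval_ultra.
rewrite maxr_pMl ?(ltW d0) // ge_max mulrC ler_wpM2r ?absval_ge0 //=.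
by rewrite absvalM -mulrA ler_wpM2l ?absval_ge0.
Qed.

(** The value [v q.[x]] is the product of the distances from [x] to all roots, hence at least a
    power of the smallest one. *)
Lemma near_root q x : q \is monic -> (1 < size q)%N ->
  exists2 y, root q y & v (x - y) ^+ (size q).-1 <= v q.[x].
Proof.
move=> qm sq; have [rs] := poly_prod_roots q.
rewrite (monicP qm) scale1r => qE.
have sE : (size q).-1 = size rs by rewrite qE size_prod_XsubC.
have vq : v q.[x] = \prod_(z <- rs) v (x - z).
  by rewrite qE horner_prod absval_prod; apply: eq_bigr => z _; rewrite hornerXsubC.
have rE z : root q z = (z \in rs) by rewrite qE root_prod_XsubC.
have rs0 : (0 < size rs)%N by rewrite -sE; case: (size q) sq => [|[|]].
have {rs0 sq} : exists2 y, y \in rs & forall z, z \in rs -> v (x - y) <= v (x - z).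
  elim: {qE sE vq rE} rs rs0 => // z [|z' rs] IH _.
    by exists z; rewrite ?inE // => u; rewrite inE => /eqP ->.
  have [//|y yrs ymin] := IH; case: (leP (v (x - z)) (v (x - y))) => zy.
    exists z; rewrite ?inE ?eqxx // => u; rewrite inE => /predU1P[->//|/ymin].
    exact: le_trans.
  exists y; first by rewrite inE yrs orbT.
  by move=> u; rewrite inE => /predU1P[->|/ymin//]; exact: ltW.
move=> [y yrs ymin]; exists y; first by rewrite rE.
rewrite vq sE -[X in _ ^+ X]sum1_size -prodrXr.
rewrite big_seq [leRHS]big_seq; apply: ler_prod => z zrs.
by rewrite expr1 absval_ge0 ymin.
Qed.

End Roots.

(** * Subfields and distances *)

Section Subfields.
Variables (K : fieldType) (F : set K).
Hypothesis hF : subfield F.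

Lemma subfield1 : F 1.
Proof. by case: hF => /[!in_setE]. Qed.

Lemma subfieldB x y : F x -> F y -> F (x - y).
Proof. by case: hF => _ h _ xF yF; have := h x y; rewrite !in_setE; apply. Qed.

Lemma subfield0 : F 0.
Proof. by rewrite -(subrr 1); apply: subfieldB; exact: subfield1. Qed.

Lemma subfieldN x : F x -> F (- x).
Proof. by move=> xF; rewrite -sub0r; apply: subfieldB => //; exact: subfield0. Qed.

Lemma subfieldD x y : F x -> F y -> F (x + y).
Proof. by move=> xF yF; rewrite -[y]opprK; apply: subfieldB => //; exact: subfieldN. Qed.

Lemma subfieldV x : F x -> F x^-1.
Proof.
case: hF => _ _ h xF; have := h 1 x; rewrite !in_setE div1r; apply=> //.
exact: subfield1.
Qed.

Lemma subfieldM x y : F x -> F y -> F (x * y).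
Proof.
case: hF => _ _ h xF yF; have := h x y^-1; rewrite !in_setE invrK; apply=> //.
exact: subfieldV.
Qed.

Lemma subfieldX x n : F x -> F (x ^+ n).
Proof.
by move=> xF; elim: n => [|n IH]; rewrite ?exprS;
  [exact: subfield1 | exact: subfieldM].
Qed.

Lemma subfield_nat n : F n%:R.
Proof.
elim: n => [|n IH]; first exact: subfield0.
by rewrite -natr1; apply: subfieldD => //; exact: subfield1.
Qed.

Lemma subfield_sum (I : Type) (r : seq I) (P : pred I) (f : I -> K) :
  (forall i, P i -> F (f i)) -> F (\sum_(i <- r | P i) f i).
Proof.
by move=> h; elim/big_ind: _ => //; [exact: subfield0 | exact: subfieldD].
Qed.

Lemma subfield_poly (q : {poly K}) : (forall i, F q`_i) <-> q \is a polyOver [in F].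
Proof.
rewrite qualifE /=; split=> [h|/allP h i].
  by apply/(all_nthP 0) => i _; rewrite in_setE.
have [si|si] := leqP (size q) i; first by rewrite nth_default //; exact: subfield0.
by have := h _ (mem_nth 0 si); rewrite in_setE.
Qed.

End Subfields.

Section ClosedSubfields.
Variables (K : closedFieldType) (F : set K).
Hypotheses (hF : subfield F) (aF : alg_closed_in F).

(** [alg_closed_in] supplies a single root in [F]; dividing it out catches all of them, so that
    roots found by approximation in [K] land in [F]. *)
Lemma alg_closed_roots (q : {poly K}) x :
  (forall i, F q`_i) -> q != 0 -> root q x -> F x.
Proof.
elim: {q}_.+1 {-2}q (ltnSn (size q)) => // n IH q qn Fq q0 qx.
have sq : (1 < size q)%N := root_size_gt1 q0 qx.
have [|z Fz qz] := aF _ sq; first exact/subfield_poly.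
have [->//|xz] := eqVneq x z.
have [u uE] := factor_theorem q z qz.
have u0 : u != 0 by apply: contraNneq q0 => u0; rewrite uE u0 mul0r.
have su : size q = (size u).+1.
  by rewrite uE size_Mmonic ?monicXsubC // size_XsubC addn2.
apply: (IH u) => //; first by rewrite su in qn.
- (* Horner division by [X - z]: coefficients come from the top. *)
  have uc i : u`_i = q`_i.+1 + z * u`_i.+1.
    by rewrite uE mulrBr coefB coefMX coefMC /= mulrC subrK.
  suff H m i : (size u <= i + m)%N -> F u`_i.
    by move=> i; apply: (H (size u)); rewrite leq_addl.
  elim: m i => [|m IHm] i; first by rewrite addn0 => /leq_sizeP -> //; exact: subfield0.
  move=> sm; rewrite uc; apply: subfieldD => //; apply: subfieldM => //.
  by apply: IHm; rewrite addSnnS.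
- by move: qx; rewrite uE rootM root_XsubC (negPf xz) orbF.
Qed.

Lemma alg_closed_prod_roots (q : {poly K}) :
  (forall i, F q`_i) -> q != 0 -> exists2 rs : seq K,
  (forall z, z \in rs -> F z) & q = lead_coef q *: \prod_(z <- rs) ('X - z%:P).
Proof.
move=> Fq q0; have [rs qE] := poly_prod_roots q; exists rs => // z zrs.
apply: (alg_closed_roots Fq q0).
by rewrite qE rootZ ?root_prod_XsubC // lead_coef_eq0.
Qed.

End ClosedSubfields.

Section Distance.
Variables (R : realType) (K : fieldType) (v : absval R K).
Implicit Types (F G : set K) (x y c : K) (e : R).
Local Notation dist := (inf_dist v).

Lemma inf_dist_has_lbound F x : has_lbound [set v (x - c) | c in F].
Proof. by exists 0 => _ [c _ <-]; exact: absval_ge0. Qed.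

Lemma inf_dist_ge0 F x : 0 <= dist F x.
Proof.
have [->|/set0P [c Fc]] := eqVneq F set0; first by rewrite /inf_dist image_set0 inf0.
by apply: lb_le_inf => [|_ [d _ <-]]; [exists (v (x - c)), c | exact: absval_ge0].
Qed.

Lemma inf_dist_le F x c : F c -> dist F x <= v (x - c).
Proof. by move=> Fc; apply: ge_inf; [exact: inf_dist_has_lbound | exists c]. Qed.

Lemma le_inf_dist F x e : F !=set0 -> (forall c, F c -> e <= v (x - c)) -> e <= dist F x.
Proof.
move=> [c Fc] h; apply: lb_le_inf => [|_ [d Fd <-]]; last exact: h.
by exists (v (x - c)), c.
Qed.

Lemma inf_dist_lt F x e : F !=set0 -> dist F x < e -> exists2 c, F c & v (x - c) < e.
Proof.
move=> F0 xe; apply: contrapT => h.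
suff : e <= dist F x by rewrite leNgt xe.
apply: le_inf_dist => // c Fc; rewrite leNgt; apply/negP => ce; apply: h.
by exists c.
Qed.

Lemma inf_dist_subset F G x : F !=set0 -> F `<=` G -> dist G x <= dist F x.
Proof. by move=> F0 FG; apply: le_inf_dist => // c /FG; exact: inf_dist_le. Qed.

Lemma inf_dist_near F x y : F !=set0 -> v (x - y) < dist F x -> dist F y = dist F x.
Proof.
move=> F0 xy.
have E c : F c -> v (y - c) = v (x - c).
  move=> Fc; apply: absval_eq_near.
  have -> : y - c - (x - c) = y - x by ring.
  by rewrite absvalBC (lt_le_trans xy) ?inf_dist_le.
apply/eqP; rewrite eq_le; apply/andP; split; apply: le_inf_dist => // c Fc.
  by rewrite -E ?inf_dist_le.
by rewrite E ?inf_dist_le.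
Qed.

Lemma inf_dist_shift F x c : subfield F -> F c -> dist F (x - c) = dist F x.
Proof.
move=> hF Fc; have F0 : F !=set0 by exists c.
apply/eqP; rewrite eq_le; apply/andP; split; apply: le_inf_dist => // d Fd.
  have -> : x - d = x - c - (d - c) by ring.
  by apply: inf_dist_le; exact: subfieldB.
have -> : x - c - d = x - (c + d) by ring.
by apply: inf_dist_le; exact: subfieldD.
Qed.

Lemma inf_dist_scale F x a : subfield F -> F a -> a != 0 ->
  dist F (a * x) = v a * dist F x.
Proof.
move=> hF Fa a0; have F0 : F !=set0 by exists a.
have va0 : 0 < v a by rewrite absval_gt0.
apply/eqP; rewrite eq_le; apply/andP; split.
  rewrite -ler_pdivrMl //; apply: le_inf_dist => // d Fd.
  rewrite ler_pdivrMl // -absvalM mulrBr.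
  by apply: inf_dist_le; exact: subfieldM.
apply: le_inf_dist => // d Fd.
have -> : a * x - d = a * (x - a^-1 * d) by rewrite mulrBr mulVKf.
rewrite absvalM ler_pM2l //; apply: inf_dist_le.
by apply: subfieldM => //; exact: subfieldV.
Qed.

Lemma inf_dist_le_absval F x : subfield F -> dist F x <= v x.
Proof. by move=> hF; rewrite -{2}(subr0 x); apply: inf_dist_le; exact: subfield0. Qed.

Lemma inf_dist_mem F x : F x -> dist F x = 0.
Proof.
move=> Fx; apply/eqP; rewrite eq_le inf_dist_ge0 andbT.
by rewrite -(absval0 v) -(subrr x) inf_dist_le.
Qed.

Lemma complete_inP F : complete_in v F <->
  forall u : nat -> K, (forall n, F (u n)) ->
    (forall e, 0 < e -> exists N, forall m n, (N <= m)%N -> (N <= n)%N ->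
      v (u m - u n) < e) ->
    exists2 l, F l & forall e, 0 < e -> exists N, forall n, (N <= n)%N -> v (u n - l) < e.
Proof.
split=> h u Fu uc.
  have [e e0|l Fl ul] := h u Fu.
    have [N NP] := uc e e0.
    exists ([set n | (N <= n)%N], [set n | (N <= n)%N]).
      by split; exists N.
    by move=> [m n] [/= mN nN]; exact: NP.
  exists l => // e e0; have /cvgrPdist_lt /(_ e e0) [N _ NP] := ul.
  by exists N => n /NP /=; rewrite sub0r normrN ger0_norm ?absval_ge0.
have [e e0|l Fl ul] := h u Fu.
  have [[A B] [[N1 _ A1] [N2 _ B2]] AB] := uc e e0.
  exists (maxn N1 N2) => m n; rewrite !geq_max => /andP[m1 m2] /andP[n1 n2].
  by apply: (AB (m, n)); split => /=; [exact: A1 | exact: B2].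
exists l => //; apply/cvgrPdist_lt => e e0; have [N NP] := ul e e0.
by exists N => // n /= /NP; rewrite sub0r normrN ger0_norm ?absval_ge0.
Qed.

Lemma exists_inv_nat_lt e : 0 < e -> exists N, forall n, (N <= n)%N -> n.+1%:R^-1 < e.
Proof.
by move=> e0; have [N _ NP] := near_infty_natSinv_lt (PosNum e0); exists N.
Qed.

Lemma absval_small_eq0 x : (forall e, 0 < e -> v x <= e) -> x = 0.
Proof.
move=> h; apply/(absval_eq0 v)/eqP; rewrite eq_le absval_ge0 andbT.
by apply/ler_addgt0Pr => e e0; rewrite add0r h.
Qed.

Lemma complete_inf_dist0 F x : F !=set0 -> complete_in v F -> dist F x = 0 -> F x.
Proof.
move=> F0 /complete_inP cF x0.
have /choice [u uP] : forall n : nat, exists c, F c /\ v (x - c) < n.+1%:R^-1.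
  move=> n; have [|c Fc xc] := @inf_dist_lt F x (n.+1%:R^-1) F0.
    by rewrite x0 invr_gt0.
  by exists c.
have small e : 0 < e -> exists N, forall n, (N <= n)%N -> v (x - u n) < e.
  move=> /exists_inv_nat_lt[N NP]; exists N => n /NP; apply: lt_trans.
  exact: (uP n).2.
have [||l Fl ul] := cF u.
- by move=> n; have [] := uP n.
- move=> e /small[N NP]; exists N => m n mN nN.
  by apply: (@absval_tri_lt _ _ _ _ _ x); rewrite ?NP // absvalBC NP.
suff -> : x = l by [].
apply/eqP; rewrite -subr_eq0; apply/eqP/absval_small_eq0 => e e0.
have [N NP] := small e e0; have [M MP] := ul e e0.
apply/ltW/(@absval_tri_lt _ _ _ _ _ (u (maxn N M))).
  by rewrite NP ?leq_maxl.
by rewrite MP ?leq_maxr.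
Qed.

End Distance.

(** * Distances under [w |-> w^p - b w] *)

Lemma exists_root_pow (R : realType) (y : R) n : (0 < n)%N -> 0 <= y ->
  exists2 z, 0 <= z & z ^+ n = y.
Proof.
move=> n0 y0; exists (y `^ n%:R^-1); first exact: powR_ge0.
by rewrite -powR_mulrn ?powR_ge0 // -powRrM mulVf ?powRr1 // pnatr_eq0 -lt0n.
Qed.

Section Trinomial.
Variables (K : fieldType) (n : nat) (b d : K).
Hypothesis n1 : (1 < n)%N.

Lemma size_trinomial : size ('X^n - b *: 'X - d%:P) = n.+1.
Proof.
rewrite -addrA size_polyDl size_polyXn // -opprD size_polyN.
rewrite (leq_ltn_trans (size_polyD _ _)) // gtn_max ltnS.
rewrite (leq_trans (size_scale_leq _ _)) ?size_polyX //=.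
by rewrite (leq_ltn_trans (size_polyC_leq1 _)) // ltnW.
Qed.

Lemma trinomial_monic : 'X^n - b *: 'X - d%:P \is monic.
Proof.
rewrite monicE lead_coefE size_trinomial /= !coefB coefXn eqxx coefZ coefX coefC.
by rewrite gtn_eqF // gtn_eqF ?(ltnW n1) // mulr0 !subr0.
Qed.

Lemma deriv_trinomial w :
  ('X^n - b *: 'X - d%:P)^`().[w] = n%:R * w ^+ n.-1 - b.
Proof.
rewrite !derivB derivXn derivZ derivX derivC !hornerE ?subr0 ?mulr1.
by rewrite hornerMn hornerXn mulr_natl.
Qed.

End Trinomial.

Lemma exists_trinomial_root (K : closedFieldType) n (b x : K) : (1 < n)%N ->
  exists w, w ^+ n - b * w = x.
Proof.
move=> n1; have [w] : exists w, root ('X^n - b *: 'X - x%:P) w.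
  by apply: closed_root; rewrite size_trinomial // ltnW.
by rewrite /root !hornerE subr_eq0 => /eqP <-; exists w.
Qed.

(** Newton polygon of [X^q - b X - x]: the bound on [v b] keeps the linear term off the polygon, so
    every root has the same absolute value as a [q]-th root of [x]. *)
Lemma absval_trinomial_root (R : realType) (K : fieldType) (v : absval R K) q b w x :
  (1 < q)%N -> w ^+ q = x + b * w -> v b ^+ q < v x ^+ q.-1 -> v w ^+ q = v x.
Proof.
move=> q1 wx bx; have qE : q = q.-1.+1 by rewrite prednK // ltnW.
suff Bz : v b * v w < v x by rewrite -absvalX wx absvalDl ?absvalM.
rewrite ltNge; apply/negP => xBz.
have x_gt0 : 0 < v x.
  rewrite lt_def absval_ge0 andbT; apply: contraTneq bx => ->.
  by rewrite -leNgt expr0n -subn1 subn_eq0 leqNgt q1 exprn_ge0 ?absval_ge0.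
have z_gt0 : 0 < v w.
  rewrite lt_def absval_ge0 andbT; apply: contraTneq xBz => ->.
  by rewrite mulr0 -ltNge.
have zB : v w ^+ q.-1 <= v b.
  rewrite -(ler_pM2r z_gt0) -exprSr -qE -absvalX wx.
  by apply: absvalD_le => //; rewrite absvalM.
move: bx; rewrite ltNge => /negP; apply.
apply: le_trans (_ : (v b * v w) ^+ q.-1 <= _).
  by rewrite lerXn2r ?nnegrE ?mulr_ge0 ?absval_ge0.
by rewrite exprMn [in leRHS]qE exprSr ler_wpM2l ?exprn_ge0 ?absval_ge0.
Qed.

Section Shift.
Variables (R : realType) (K : closedFieldType) (v : absval R K).

Lemma small_root_at (q : {poly K}) (w : K) (d : R) :
  v q.[w] < v q^`().[w] * d -> exists2 y, root q y & v (y - w) < d.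
Proof.
pose Q := q \Po ('X + w%:P).
have Q0 : Q`_0 = q.[w] by rewrite -horner_coef0 horner_comp !hornerE.
have Q1 : Q`_1 = q^`().[w].
  have := coef_deriv Q 0; rewrite mulr1n => <-.
  by rewrite -horner_coef0 deriv_comp derivD derivX derivC addr0 mulr1
    horner_comp !hornerE.
rewrite -Q0 -Q1 => /small_root[x Qx xd]; exists (x + w); last by rewrite addrK.
by move: Qx; rewrite /root horner_comp !hornerE.
Qed.

(** The function [r |-> max (r^n, B r)] is continuous and nondecreasing, so a bound for all [c]
    passes to the infimum. Points with [v (w - c) > v w] do not affect it, since [c = 0] gives
    [v w]. *)
Lemma le_max_inf_dist (F : set K) (w : K) (n : nat) (B D : R) :
  subfield F -> (0 < n)%N -> 0 <= B -> 0 <= D ->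
  (forall c, F c -> v (w - c) <= v w ->
     D <= Num.max (v (w - c) ^+ n) (B * v (w - c))) ->
  D <= Num.max (inf_dist v F w ^+ n) (B * inf_dist v F w).
Proof.
move=> hF n0 B0 D0 h; set r := inf_dist v F w.
have r0 : 0 <= r by exact: inf_dist_ge0.
have F0 : F 0 by exact: subfield0.
have := inf_dist_le_absval v w hF; rewrite -/r le_eqVlt => /predU1P[rw|rw].
  by have := h 0 F0; rewrite subr0 -rw; apply.
rewrite leNgt; apply/negP; rewrite gt_max => /andP[rD BrD].
have [y y0 yD] := exists_root_pow n0 D0.
have ry : r < y by rewrite -(@ltr_pXn2r _ n) // ?nnegrE // yD.
have [z rz Bz] : exists2 z, r < z & B * z <= D.
  move: B0; rewrite le_eqVlt => /predU1P[<-|B0].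
    by exists (r + 1); rewrite ?mul0r // ltrDl.
  exists (D / B); first by rewrite ltr_pdivlMr // mulrC.
  by rewrite mulrC divfK ?gt_eqF.
have [||c Fc] := @inf_dist_lt _ _ v F w (Num.min y (Num.min z (v w))).
- by exists 0.
- by rewrite -/r !lt_min ry rz.
rewrite !lt_min => /and3P[cy cz cw]; have := h c Fc (ltW cw).
rewrite leNgt gt_max -{1}yD ltr_pXn2r ?nnegrE ?absval_ge0 // cy /= => /negP; apply.
move: B0; rewrite le_eqVlt => /predU1P[B0|B0].
  by rewrite -B0 mul0r; apply: le_lt_trans BrD; rewrite mulr_ge0 // -B0.
by apply: lt_le_trans Bz; rewrite ltr_pM2l.
Qed.

End Shift.

Section PrimePower.
Variables (R : realType) (K : closedFieldType) (v : absval R K) (p : nat).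
Hypothesis pr_p : prime p.

(** The inner binomial coefficients are divisible by [p]. *)
Lemma absval_expD_sub_le x z : v z <= v x ->
  v ((x + z) ^+ p - x ^+ p) <=
    Num.max (v z ^+ p) (v p%:R * v x ^+ p.-1 * v z).
Proof.
have p0 := prime_gt0 pr_p.
move=> zx; rewrite exprDn big_ord_recl subn0 bin0 expr0 mulr1 mulr1n.
rewrite addrC addKr.
apply: absval_sum_le => [|i _]; first by rewrite le_max exprn_ge0 ?absval_ge0.
rewrite /= /bump /= add1n le_max.
have := ltn_ord i; rewrite leq_eqVlt => /predU1P[ip|ip].
  by rewrite ip subnn expr0 mul1r binn mulr1n absvalX lexx.
apply/orP; right.
have /dvdnP[m ->] := @prime_dvd_bin i.+1 p pr_p ip.
rewrite mulrnA -[X in v X <= _]mulr_natl absvalM -mulrA ler_wpM2l ?absval_ge0 //.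
apply: le_trans (absval_mulrn_le _ _ _) _.
rewrite absvalM !absvalX exprSr mulrA ler_wpM2r ?absval_ge0 //.
have -> : p.-1 = ((p - i.+1) + i)%N by lia.
by rewrite exprD ler_wpM2l ?exprn_ge0 ?absval_ge0 // lerXn2r ?nnegrE ?absval_ge0.
Qed.

Lemma absval_expB_le x c : v (x - c) <= v x ->
  v (x ^+ p - c ^+ p) <= Num.max (v (x - c) ^+ p) (v p%:R * v x ^+ p.-1 * v (x - c)).
Proof.
rewrite (absvalBC v x c) (absvalBC v (x ^+ p)) => xc.
by have := absval_expD_sub_le xc; rewrite (addrC x) subrK.
Qed.

Lemma inf_dist_expp_ge (F : set K) w : subfield F -> alg_closed_in F ->
  inf_dist v F w ^+ p <= inf_dist v F (w ^+ p).
Proof.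
move=> hF aF; apply: le_inf_dist => [|d Fd]; first by exists 0; exact: subfield0.
have p0 := prime_gt0 pr_p.
pose q := 'X^p - d%:P.
have [||y qy yd] := @near_root _ _ v q w.
- exact: monicXnsubC.
- by rewrite size_XnsubC.
have Fy : F y.
  apply: (alg_closed_roots hF aF _ _ qy); last by rewrite -size_poly_gt0 size_XnsubC.
  move=> i; rewrite coefB coefXn coefC.
  apply: subfieldB => //; case: (_ == _) => //; first exact: subfield1.
  - exact: subfield0.
  - exact: subfield0.
move: yd; rewrite size_XnsubC //= !hornerE; apply: le_trans.
by rewrite lerXn2r ?nnegrE ?inf_dist_ge0 ?absval_ge0 ?inf_dist_le.
Qed.

Lemma inf_dist_expp_le (F : set K) w : subfield F ->
  inf_dist v F (w ^+ p) <=
    Num.max (inf_dist v F w ^+ p) (v p%:R * v w ^+ p.-1 * inf_dist v F w).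
Proof.
move=> hF; apply: le_max_inf_dist => //; first exact: prime_gt0.
- by rewrite mulr_ge0 ?exprn_ge0 ?absval_ge0.
- exact: inf_dist_ge0.
move=> c Fc wc; apply: le_trans (_ : v (w ^+ p - c ^+ p) <= _).
  by apply: inf_dist_le; exact: subfieldX.
exact: absval_expB_le.
Qed.

Section ArtinSchreier.
Variables (F : set K) (w b : K).
Hypotheses (hF : subfield F) (aF : alg_closed_in F) (Fb : F b).
Hypothesis pwb : v p%:R * v w ^+ p.-1 < v b.

(** Upper bound: compare with [c^p - b c] for [c] in [F]. Lower bound: for [d] in [F] the roots of
    [X^p - b X - d] lie in [F]. The nearest one gives the term in [r^p], and a Newton step gives the
    term in [|b| r], because the derivative [p w^(p-1) - b] has absolute value [|b|]. *)
Lemma inf_dist_artin_schreier :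
  inf_dist v F (w ^+ p - b * w) =
    Num.max (inf_dist v F w ^+ p) (v b * inf_dist v F w).
Proof.
have p0 := prime_gt0 pr_p; have p1 := prime_gt1 pr_p.
have F0 : F !=set0 by exists b.
have b0 : 0 < v b by apply: le_lt_trans pwb; rewrite mulr_ge0 ?exprn_ge0 ?absval_ge0.
apply/eqP; rewrite eq_le; apply/andP; split.
  apply: le_max_inf_dist => //; first exact: ltW.
    exact: inf_dist_ge0.
  move=> c Fc wc.
  apply: le_trans (_ : v (w ^+ p - b * w - (c ^+ p - b * c)) <= _).
    by apply: inf_dist_le; apply: subfieldB; [|exact: subfieldX|exact: subfieldM].
  have -> : w ^+ p - b * w - (c ^+ p - b * c) = w ^+ p - c ^+ p - b * (w - c) by ring.
  apply: absvalB_le; last by rewrite absvalM le_max lexx orbT.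
  apply: le_trans (absval_expB_le wc) _.
  rewrite ge_max !le_max lexx /= ler_wpM2r ?orbT ?absval_ge0 //.
  exact: ltW.
apply: le_inf_dist => // d Fd.
pose q := 'X^p - b *: 'X - d%:P.
have sq : size q = p.+1 by exact: size_trinomial.
have mq : q \is monic by exact: trinomial_monic.
have Fq i : F q`_i.
  rewrite !coefB coefZ coefXn coefX coefC.
  have F0' := subfield0 hF; have F1' := subfield1 hF.
  apply: subfieldB => //; last by case: (_ == _).
  apply: subfieldB => //; first exact: subfield_nat.
  by apply: subfieldM => //; exact: subfield_nat.
have Froot y : root q y -> inf_dist v F w <= v (w - y).
  move=> qy; apply: inf_dist_le; apply: (alg_closed_roots hF aF Fq _ qy).
  by rewrite monic_neq0.
have qw : q.[w] = w ^+ p - b * w - d by rewrite !hornerE.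
rewrite -qw ge_max; apply/andP; split.
  have [|y qy] := @near_root _ _ v q w mq; first by rewrite sq.
  rewrite sq /=; apply: le_trans.
  by rewrite lerXn2r ?nnegrE ?inf_dist_ge0 ?absval_ge0 ?Froot.
rewrite leNgt; apply/negP => h.
have [|y qy] := @small_root_at _ _ v q w (inf_dist v F w).
  apply: lt_le_trans h _; rewrite ler_wpM2r ?inf_dist_ge0 //.
  rewrite /q deriv_trinomial.
  rewrite absvalBC absvalDl ?absvalN ?absvalM ?absvalX //.
by rewrite ltNge absvalBC Froot.
Qed.

End ArtinSchreier.
End PrimePower.

(** * Uniqueness of the extended absolute value *)

Lemma exists_expr_lt (R : realType) (z e : R) : 0 <= z -> z < 1 -> 0 < e ->
  exists N, forall n, (N <= n)%N -> z ^+ n < e.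
Proof.
move=> z0 z1 e0; have : `|z| < 1 by rewrite ger0_norm.
move=> /cvg_expr/cvgrPdist_lt/(_ e e0)[N _ NP]; exists N => n /NP /=.
by rewrite sub0r normrN ger0_norm // exprn_ge0.
Qed.

Lemma le_of_pow_le (R : realType) (C x y : R) : 0 <= x -> 0 <= y ->
  (forall n, x ^+ n <= C * y ^+ n) -> x <= y.
Proof.
move=> x0 y0 h; rewrite leNgt; apply/negP => yx.
have xp : 0 < x by exact: le_lt_trans yx.
have C0 : 0 < C.
  by have := h 0%N; rewrite !expr0 mulr1; apply: lt_le_trans.
have [||N] := @exists_expr_lt R (y / x) C^-1 (divr_ge0 y0 x0).
- by rewrite ltr_pdivrMr // mul1r.
- by rewrite invr_gt0.
move=> /(_ N (leqnn N)); rewrite expr_div_n ltr_pdivrMr ?exprn_gt0 // mulrC ltr_pdivlMr // mulrC.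
by rewrite ltNge h.
Qed.

(* On [L(alpha)] the coordinates are bounded by the absolute value, so that two
   multiplicative norms are comparable up to a constant, hence equal. *)
Section UniqueExtension.
Variables (R : realType) (L : fieldType) (K : closedFieldType) (v : absval R K).
Variables (i j : {rmorphism L -> K}).
Hypothesis ij : forall x, v (i x) = v (j x).
Hypothesis complete_i : complete_in v (range i).
Variable alpha : K.
Local Notation "q ^i" := (map_poly i q) (at level 2, format "q ^i").
Local Notation "q ^j" := (map_poly j q) (at level 2, format "q ^j").

Lemma absval_horner_le (f : {rmorphism L -> K}) (b : K) (q : {poly L}) n (M : R) :
  0 <= M -> (size q <= n)%N -> (forall k, v (f q`_k) <= M) ->
  v (map_poly f q).[b] <= M * Num.max 1 (v b) ^+ n.
Proof.
move=> M0 qn h; rewrite horner_coef size_map_poly.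
have m1 : 1 <= Num.max 1 (v b) by rewrite le_max lexx.
have m0 : 0 <= Num.max 1 (v b) by exact: le_trans m1.
apply: absval_sum_le => [|k _]; first by rewrite mulr_ge0 ?exprn_ge0.
rewrite coef_map absvalM absvalX; apply: ler_pM; rewrite ?exprn_ge0 ?absval_ge0 ?h //.
apply: le_trans (_ : Num.max 1 (v b) ^+ k <= _).
  by rewrite lerXn2r ?nnegrE ?absval_ge0 // le_max lexx orbT.
by apply: ler_weXn2l => //; apply: leq_trans qn; exact: ltnW.
Qed.

(** By induction the lower powers span a complete, hence closed, set [V], so [alpha^n] is at a
    positive distance [d] from it. This bounds the top coordinate; removing the top term leaves the
    induction hypothesis. *)
Lemma bounded_coordinates n :
  (forall q : {poly L}, (size q <= n)%N -> root q^i alpha -> q = 0) ->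
  exists2 C : R, 0 < C & forall q : {poly L}, (size q <= n)%N ->
    forall k, v (i q`_k) <= C * v (q^i).[alpha].
Proof.
elim: n => [|n IH] h.
  exists 1 => // q; rewrite leqn0 size_poly_eq0 => /eqP -> k.
  by rewrite coef0 rmorph0 absval0 mul1r absval_ge0.
have [|C C0 CP] := IH; first by move=> q qn; apply: h; exact: leqW.
pose V := [set (q^i).[alpha] | q in [set q : {poly L} | (size q <= n)%N]].
have V0 : V !=set0.
  by exists 0, 0; rewrite /= ?size_poly0 // rmorph0 horner0.
set m := Num.max 1 (v alpha).
have m1 : 1 <= m by rewrite le_max lexx.
have m0 : 0 < m by exact: lt_le_trans m1.
have cV : complete_in v V.
  apply/complete_inP => u Vu uc.
  have /choice [q qP] : forall k, exists q : {poly L}, (size q <= n)%N /\ (q^i).[alpha] = u k.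
    by move=> k; have [q] := Vu k; exists q.
  have /choice [l lP] : forall k, exists l : L, forall e, 0 < e ->
      exists N, forall s, (N <= s)%N -> v (i (q s)`_k - i l) < e.
    move=> k; move/complete_inP: complete_i => /(_ (fun s => i (q s)`_k)) [].
    - by move=> s; exists (q s)`_k.
    - move=> e e0; have [N NP] := uc (e / C) (divr_gt0 e0 C0).
      exists N => s s' sN s'N; rewrite -rmorphB -coefB.
      apply: le_lt_trans (CP _ _ _) _.
        rewrite (leq_trans (size_polyD _ _)) // size_polyN geq_max.
        by rewrite (qP s).1 (qP s').1.
      rewrite rmorphB hornerD hornerN (qP s).2 (qP s').2.
      by rewrite mulrC -ltr_pdivlMr // NP.
    - by move=> _ [l _ <-] lP; exists l.
  pose Q := \poly_(k < n) l k.
  exists (Q^i).[alpha].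
    by exists Q => //=; exact: size_poly.
  move=> e e0.
  have /choice [N NP] : forall k, exists N, forall s, (N <= s)%N ->
      v (i (q s)`_k - i (l k)) < e / (2 * m ^+ n).
    by move=> k; apply: lP; rewrite divr_gt0 // mulr_gt0 // exprn_gt0.
  exists (\max_(k < n) N k)%N => s sN.
  rewrite -(qP s).2 -hornerN -hornerD -rmorphB.
  apply: le_lt_trans (absval_horner_le (M := e / (2 * m ^+ n)) (n := n) _ _ _ _) _.
  - by rewrite divr_ge0 ?ltW // mulr_gt0 // exprn_gt0.
  - rewrite (leq_trans (size_polyD _ _)) // size_polyN geq_max.
    by rewrite (qP s).1 size_poly.
  - move=> k; rewrite coefB coef_poly; case: ltnP => kn.
      rewrite rmorphB; apply/ltW/NP/(leq_trans _ sN).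
      exact: (leq_bigmax (Ordinal kn)).
    rewrite nth_default ?(leq_trans (qP s).1) // subrr rmorph0 absval0.
    by rewrite divr_ge0 ?ltW // mulr_gt0 // exprn_gt0.
  rewrite invfM mulrA mulfVK ?gt_eqF ?exprn_gt0 //.
  by rewrite ltr_pdivrMr // ltr_pMr // ltr1n.
set d := inf_dist v V (alpha ^+ n).
have d0 : 0 < d.
  rewrite lt_def inf_dist_ge0 andbT; apply/eqP => /(complete_inf_dist0 V0 cV).
  move=> [q qn qE].
  have : 'X^n - q = 0.
    apply: h.
      rewrite (leq_trans (size_polyD _ _)) // size_polyN size_polyXn geq_max leqnn /=.
      exact: leqW.
    by rewrite /root rmorphB /= map_polyXn hornerD hornerN qE hornerXn subrr.
  move=> /(congr1 (fun P : {poly L} => P`_n)); rewrite coefB coefXn eqxx coef0.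
  by rewrite nth_default // subr0 => /eqP; rewrite oner_eq0.
exists (d^-1 + C * (1 + d^-1 * v alpha ^+ n)).
  rewrite addr_gt0 ?invr_gt0 // mulr_gt0 // ltr_wpDr // mulr_ge0 ?invr_ge0 ?(ltW d0) //.
  by rewrite exprn_ge0 ?absval_ge0.
move=> q qn; set a := q`_n; set q' := take_poly n q.
have qE : q = q' + a *: 'X^n.
  apply/polyP => k; rewrite coefD coefZ coef_take_poly coefXn.
  case: ltngtP => kn; rewrite ?mulr0 ?addr0 ?mulr1 ?add0r // ?kn //.
  by rewrite nth_default // (leq_trans qn).
have va : v (i a) <= d^-1 * v (q^i).[alpha].
  have [->|a0] := eqVneq a 0.
    by rewrite rmorph0 absval0 mulr_ge0 ?absval_ge0 // invr_ge0 ltW.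
  have ia0 : i a != 0 by rewrite fmorph_eq0.
  rewrite ler_pdivlMl // mulrC.
  have -> : (q^i).[alpha] = i a * (alpha ^+ n - ((- a^-1 *: q')^i).[alpha]).
    rewrite {1}qE rmorphD /= !map_polyZ map_polyXn !hornerE ?hornerXn rmorphN fmorphV.
    by rewrite mulrDr mulNr opprK mulVKf // addrC.
  rewrite absvalM ler_wpM2l ?absval_ge0 //; apply: inf_dist_le.
  exists (- a^-1 *: q') => //=; rewrite (leq_trans (size_scale_leq _ _)) //.
  exact: size_take_poly.
move=> k; have vq0 : 0 <= v (q^i).[alpha] by exact: absval_ge0.
rewrite mulrDl; have [kn|kn|->] := ltngtP k n; last first.
- apply: le_trans va _; rewrite lerDl mulr_ge0 //.
  rewrite mulr_ge0 ?(ltW C0) // addr_ge0 // mulr_ge0 ?invr_ge0 ?(ltW d0) //.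
  by rewrite exprn_ge0 ?absval_ge0.
- rewrite nth_default ?(leq_trans qn) // rmorph0 absval0 addr_ge0 //.
    by rewrite mulr_ge0 // invr_ge0 ltW.
  rewrite mulr_ge0 // mulr_ge0 ?(ltW C0) // addr_ge0 // mulr_ge0 ?invr_ge0 ?(ltW d0) //.
  by rewrite exprn_ge0 ?absval_ge0.
have -> : q`_k = q'`_k by rewrite coef_take_poly kn.
apply: le_trans (CP q' (size_take_poly _ _) k) _.
apply: ler_wpDl; first by rewrite mulr_ge0 // invr_ge0 ltW.
rewrite -mulrA ler_pM2l //.
have -> : q' = q - a *: 'X^n by rewrite {1}qE addrK.
rewrite rmorphB hornerD hornerN; apply: absvalB_le.
  rewrite mulrDl mul1r lerDl mulr_ge0 // mulr_ge0 ?invr_ge0 ?(ltW d0) //.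
  by rewrite exprn_ge0 ?absval_ge0.
rewrite /= map_polyZ map_polyXn !hornerE ?hornerXn absvalM absvalX mulrDl mul1r.
apply: ler_wpDl => //; rewrite mulrAC ler_wpM2r ?exprn_ge0 ?absval_ge0 //.
Qed.

(** [beta] is a root of the transported minimal polynomial [m]. The powers [q^k], reduced modulo
    [m], satisfy the inequality up to a constant independent of [k], which disappears on taking
    [k]-th roots. *)
Lemma unique_extension : algebraicOver i alpha ->
  exists beta, forall q : {poly L}, v (q^i).[alpha] = v (q^j).[beta].
Proof.
move=> [q0 q00 q0r].
have ex : exists n, `[< exists q : {poly L}, [/\ q != 0, root q^i alpha & size q = n] >].
  by exists (size q0); apply/asboolP; exists q0.
case: (ex_minnP ex) => n /asboolP[m [m0 mr sm]] min.
have sm1 : (1 < size m)%N.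
  by rewrite -(size_map_poly i); apply: root_size_gt1 mr; rewrite map_poly_eq0.
have [beta br] : exists beta, root m^j beta.
  by apply: closed_root; rewrite size_map_poly.
exists beta.
have small (q : {poly L}) : (size q < n)%N -> root q^i alpha -> q = 0.
  move=> qn qr; apply/eqP/negPn/negP => q_neq0.
  suff : (n <= size q)%N by rewrite leqNgt qn.
  by apply: min; apply/asboolP; exists q.
have modE (f : {rmorphism L -> K}) b (q : {poly L}) :
    root (map_poly f m) b -> (map_poly f q).[b] = (map_poly f (q %% m)).[b].
  move=> /rootP mb; rewrite {1}(divp_eq q m) rmorphD rmorphM /= hornerD hornerM.
  by rewrite mb mulr0 add0r.
have modn (q : {poly L}) : (size (q %% m)%R <= n.-1)%N.
  by have := ltn_modpN0 q m0; rewrite sm; case: (n).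
have [|C C0 CP] := @bounded_coordinates n.-1.
  by move=> q qn; apply: small; move: sm1; rewrite sm; lia.
have le_ji (q : {poly L}) : v (q^j).[beta] <= v (q^i).[alpha].
  apply: (@le_of_pow_le _ (C * Num.max 1 (v beta) ^+ n.-1)); rewrite ?absval_ge0 // => k.
  rewrite -!absvalX -!horner_exp -!rmorphXn /=.
  rewrite (modE j _ (q ^+ k) br) (modE i _ (q ^+ k) mr).
  rewrite mulrAC; apply: absval_horner_le => //.
    by rewrite mulr_ge0 ?absval_ge0 ?(ltW C0).
  by move=> s; rewrite -ij; exact: CP.
move=> q; apply/eqP; rewrite eq_le le_ji andbT.
have [->|qa] := eqVneq (q^i).[alpha] 0; first by rewrite absval0 absval_ge0.
(* The reverse inequality is the one just proved, applied to an inverse [w] of [q] modulo [m]; it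
   exists by minimality of [m]. *)
have : coprimep m q.
  have [g1 g2] := (dvdp_gcdl m q, dvdp_gcdr m q).
  have g0 : gcdp m q != 0 by rewrite gcdp_eq0 negb_and m0.
  have mE := divpK g1; set h := m %/ gcdp m q in mE.
  have h0 : h != 0 by apply: contraNneq m0 => h0; rewrite -mE h0 mul0r.
  have : root h^i alpha || root (gcdp m q)^i alpha.
    by rewrite -rootM -rmorphM mE.
  case/orP => [hr|/rootP gr]; last first.
    by move: qa; rewrite -(divpK g2) rmorphM hornerM gr mulr0 eqxx.
  rewrite coprimep_def.
  have : (n <= size h)%N.
    by rewrite leqNgt; apply/negP => /small/(_ hr)/eqP; rewrite (negPf h0).
  have := size_mul h0 g0; rewrite mE sm => -> sh.
  move: g0 h0 sh; rewrite -!size_poly_gt0.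
  by move: (size (gcdp m q)) (size h) => a b; clear; lia.
move=> /Bezout_eq1_coprimepP[[u w] /= uw].
have inv (f : {rmorphism L -> K}) b : root (map_poly f m) b ->
    v (map_poly f w).[b] * v (map_poly f q).[b] = 1.
  move=> /rootP mb; have /(congr1 (fun P => (map_poly f P).[b])) := uw.
  rewrite rmorphD !rmorphM /= hornerD !hornerM mb mulr0 add0r -absvalM => ->.
  by rewrite rmorph1 hornerC absval1.
have := inv i _ mr; have := inv j _ br; have := le_ji w.
set a := v (q^i).[alpha]; set b := v (q^j).[beta].
set c := v (w^i).[alpha]; set d := v (w^j).[beta] => dc db ca.
have b0 : 0 < b.
  rewrite lt_def absval_ge0 andbT; apply/eqP => b0.
  by move: db; rewrite b0 mulr0 => /eqP; rewrite eq_sym oner_eq0.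
have a0 : 0 < a by rewrite absval_gt0.
have -> : b = d^-1 by apply: (mulfI (x := d)); rewrite ?db ?divff //;
  apply: contra_eq_neq db => ->; rewrite mul0r eq_sym oner_eq0.
have -> : a = c^-1 by apply: (mulfI (x := c)); rewrite ?ca ?divff //;
  apply: contra_eq_neq ca => ->; rewrite mul0r eq_sym oner_eq0.
rewrite lef_pV2 // posrE.
  by rewrite -(pmulr_lgt0 _ a0) ca.
by rewrite -(pmulr_lgt0 _ b0) db.
Qed.

End UniqueExtension.

(** * Extension of isometries *)

Section SubfieldType.
Variables (K : fieldType) (F : set K) (hF : subfield F).

(** The proof is an argument so that the closure instance below can be attached to the predicate. *)
Definition subfield_pred of subfield F : {pred K} := [in F].

HB.instance Definition _ :=
  GRing.isDivringClosed.Build K (subfield_pred hF) hF.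

Record subfield_type := SubfieldElt {
  subfield_val : K;
  subfield_valP : subfield_val \in subfield_pred hF }.

HB.instance Definition _ := [isSub for subfield_val].
HB.instance Definition _ := [Choice of subfield_type by <:].
HB.instance Definition _ := [SubChoice_isSubIntegralDomain of subfield_type by <:].
HB.instance Definition _ := [SubIntegralDomain_isSubField of subfield_type by <:].

Lemma subfield_type_surj x : F x -> exists y : subfield_type, val y = x.
Proof.
move=> Fx; have Fx' : x \in subfield_pred hF by rewrite unfold_in; exact/mem_set.
by exists (SubfieldElt Fx').
Qed.

Lemma subfield_type_mem (x : subfield_type) : F (val x).
Proof. by have := valP x; rewrite unfold_in => /set_mem. Qed.

Lemma subfield_type_poly (q : {poly K}) : (forall i, F q`_i) ->
  exists q' : {poly subfield_type}, q = map_poly val q'.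
Proof.
move=> Fq; have /choice [f fP] := fun i => subfield_type_surj (Fq i).
exists (\poly_(i < size q) f i); apply/polyP => i.
rewrite coef_map coef_poly; case: ltnP => [_|qi].
  exact/esym/fP.
by rewrite nth_default // rmorph0.
Qed.

End SubfieldType.

Lemma exists_rmorphism (A B : nzRingType) (f : A -> B) :
  (forall x y, f (x - y) = f x - f y) -> (forall x y, f (x * y) = f x * f y) ->
  f 1 = 1 -> exists g : {rmorphism A -> B}, g =1 f.
Proof.
move=> fB fM f1.
pose g : {rmorphism A -> B} := HB.pack f
  (GRing.isZmodMorphism.Build A B f fB)
  (GRing.isMonoidMorphism.Build A B f (f1, fM)).
by exists g.
Qed.

(* Isometries between subrings of [K] are handled as graphs, so that Zorn's lemma
   applies to unions of chains. *)
Section Isometries.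
Variables (R : realType) (K : closedFieldType) (v : absval R K).

Definition isometry_graph (G : set (K * K)) : Prop :=
  [/\ G (1, 1), forall a b, G a -> G b -> G (a - b),
      forall a b, G a -> G b -> G (a.1 * b.1, a.2 * b.2) &
      forall a, G a -> v a.1 = v a.2].

Lemma exists_maximal_isometry G0 : isometry_graph G0 ->
  exists G, [/\ isometry_graph G, G0 `<=` G &
    forall H, isometry_graph H -> G `<=` H -> H `<=` G].
Proof.
move=> iG0.
(* The condition bears on the union with [G0] because a chain may be empty, and the empty set is not
   an isometry graph. *)
have [|A [iA maxA]] := @Zorn_bigcup _ [set G | isometry_graph (G `|` G0)].
  move=> F Fi Ft /=.
  have two a b : (\bigcup_(X in F) X `|` G0) a -> (\bigcup_(X in F) X `|` G0) b ->
      exists G, [/\ isometry_graph G, G a, G b & G `<=` \bigcup_(X in F) X `|` G0].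
    have sub X : F X -> X `|` G0 `<=` \bigcup_(X in F) X `|` G0.
      by move=> FX x [Xx|]; [left; exists X|right].
    move=> [[X FX Xa]|Ga] [[Y FY Yb]|Gb].
    - have [XY|YX] := Ft _ _ FX FY.
        exists (Y `|` G0); split; [exact: Fi|by left; exact: XY|by left|exact: sub].
      exists (X `|` G0); split; [exact: Fi|by left|by left; exact: YX|exact: sub].
    - exists (X `|` G0); split; [exact: Fi|by left|by right|exact: sub].
    - exists (Y `|` G0); split; [exact: Fi|by right|by left|exact: sub].
    - by exists G0; split => // x; right.
  split.
  - by right; case: iG0.
  - by move=> a b /two h /h[G [[_ GB _ _] Ga Gb sG]]; apply: sG; exact: GB.
  - by move=> a b /two h /h[G [[_ _ GM _] Ga Gb sG]]; apply: sG; exact: GM.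
  - by move=> a Ha; have [G [[_ _ _ Gv] Ga _ _]] := two a a Ha Ha; exact: Gv.
exists (A `|` G0); split => //.
move=> H iH AH x Hx; apply: contrapT => Ax.
apply: (maxA (H `|` G0)); last first.
  rewrite /= (_ : H `|` G0 `|` G0 = H) //.
  by rewrite -setUA setUid; apply/setUidPl => y Gy; apply: AH; right.
split; first by move=> y Ay; left; apply: AH; left.
by move=> /(_ x (or_introl Hx)) Ax'; apply: Ax; left.
Qed.

Section Maximal.
Variable G : set (K * K).
Hypothesis iG : isometry_graph G.
Hypothesis maxG : forall H, isometry_graph H -> G `<=` H -> H `<=` G.

Lemma isometry1 : G (1, 1). Proof. by case: iG. Qed.

Lemma isometryB x y x' y' : G (x, x') -> G (y, y') -> G (x - y, x' - y').
Proof. by move=> Gx Gy; case: iG => _ /(_ _ _ Gx Gy). Qed.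

Lemma isometryM x y x' y' : G (x, x') -> G (y, y') -> G (x * y, x' * y').
Proof. by move=> Gx Gy; case: iG => _ _ /(_ _ _ Gx Gy). Qed.

Lemma isometry_absval x x' : G (x, x') -> v x = v x'.
Proof. by move=> Gx; case: iG => _ _ _ /(_ _ Gx). Qed.

Lemma isometry0 : G (0, 0).
Proof. by have := isometryB isometry1 isometry1; rewrite !subrr. Qed.

(** A graph closed under subtraction and preserving [v] is single-valued: two values of [x] differ
    by an element of absolute value [v 0]. *)
Lemma isometry_inj x x' y : G (x, x') -> G (x, y) -> x' = y.
Proof.
move=> Gx Gy; have := isometry_absval (isometryB Gx Gy).
by rewrite subrr absval0 => /esym/(absval_eq0 v)/eqP; rewrite subr_eq0 => /eqP.
Qed.

(** Fractions of pairs of [G] still form an isometry graph, which maximality absorbs. *)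
Lemma isometryV x x' : G (x, x') -> G (x^-1, x'^-1).
Proof.
move=> Gx; have [x0|x0] := eqVneq x 0.
  have := isometry_inj isometry0; rewrite x0 in Gx => /(_ _ Gx) <-.
  by rewrite x0 invr0; exact: isometry0.
have nz y y' : G (y, y') -> y != 0 -> y' != 0.
  by move=> /isometry_absval yy'; rewrite -!(absval_gt0 v) yy'.
pose H := [set a | exists b c, [/\ G b, G c, c.1 != 0 &
  a = (b.1 / c.1, b.2 / c.2)]].
apply: (maxG (H := H)); last 2 first.
- by move=> [y y'] Gy; exists (y, y'), (1, 1); rewrite /= !divr1 oner_eq0; split=> //;
    exact: isometry1.
- by exists (1, 1), (x, x'); rewrite /= !div1r; split=> //; exact: isometry1.
split.
- by exists (1, 1), (1, 1); rewrite /= !divr1 oner_eq0; split=> //; exact: isometry1.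
- move=> _ _ [[b b'] [[c c'] [/= Gb Gc c0 ->]]] [[d d'] [[e e'] [/= Gd Ge e0 ->]]].
  exists (b * e - d * c, b' * e' - d' * c'), (c * e, c' * e'); split => /=.
  + by apply: isometryB; exact: isometryM.
  + exact: isometryM.
  + by rewrite mulf_neq0.
  + have c'0 := nz _ _ Gc c0; have e'0 := nz _ _ Ge e0.
    by congr pair => /=; field; apply/andP.
- move=> _ _ [[b b'] [[c c'] [/= Gb Gc c0 ->]]] [[d d'] [[e e'] [/= Gd Ge e0 ->]]].
  exists (b * d, b' * d'), (c * e, c' * e'); split => /=.
  + exact: isometryM.
  + exact: isometryM.
  + by rewrite mulf_neq0.
  + have c'0 := nz _ _ Gc c0; have e'0 := nz _ _ Ge e0.
    by congr pair => /=; field; apply/andP.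
- move=> _ [[b b'] [[c c'] [/= Gb Gc c0 ->]]] /=.
  by rewrite !absvalM !absvalV (isometry_absval Gb) (isometry_absval Gc).
Qed.

Lemma isometry_closed x x' :
  (forall e : R, 0 < e -> exists y y', [/\ G (y, y'), v (x - y) < e & v (x' - y') < e]) ->
  G (x, x').
Proof.
move=> lim.
pose H := [set a | forall e : R, 0 < e -> exists y y',
  [/\ G (y, y'), v (a.1 - y) < e & v (a.2 - y') < e]].
apply: (maxG (H := H)); last 2 first.
- by move=> [y y'] Gy e e0; exists y, y'; rewrite !subrr absval0.
- exact: lim.
split.
- by move=> e e0; exists 1, 1; rewrite !subrr absval0; split=> //; exact: isometry1.
- move=> [a a'] [b b'] Ha Hb e e0.
  have [y [y' [Gy ya ya']]] := Ha e e0; have [z [z' [Gz zb zb']]] := Hb e e0.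
  exists (y - z), (y' - z'); split=> /=; first exact: isometryB.
  + have -> : a - b - (y - z) = a - y - (b - z) by ring.
    exact: absvalB_lt.
  + have -> : a' - b' - (y' - z') = a' - y' - (b' - z') by ring.
    exact: absvalB_lt.
- move=> [a a'] [b b'] Ha Hb e e0.
  pose M := v a + v a' + 1; have M0 : 0 < M by rewrite ltr_wpDl ?addr_ge0 ?absval_ge0.
  have [z [z' [Gz zb zb']]] := Hb (e / M) (divr_gt0 e0 M0).
  (* The error splits as [a (b - z) + z (a - y)], so the precision required of [y] depends on [z],
     which is chosen first. *)
  pose N := v z + v z' + 1; have N0 : 0 < N by rewrite ltr_wpDl ?addr_ge0 ?absval_ge0.
  have [y [y' [Gy ya ya']]] := Ha (e / N) (divr_gt0 e0 N0).
  have est s (t P : R) : 0 <= t -> s <= P -> 0 < P -> t < e / P -> s * t < e.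
    move=> t0 sP P0; rewrite ltr_pdivlMr // => tP; apply: le_lt_trans tP.
    by rewrite mulrC ler_wpM2l.
  have prod s t s' t' : v s * v (t - t') < e -> v t' * v (s - s') < e ->
      v (s * t - s' * t') < e.
    move=> h1 h2; have -> : s * t - s' * t' = s * (t - t') + t' * (s - s') by ring.
    by apply: absvalD_lt; rewrite absvalM.
  exists (y * z), (y' * z'); split => /=; first exact: isometryM.
  + apply: prod; [apply: est zb | apply: est ya]; rewrite ?absval_ge0 //= /M /N;
      by rewrite -?addrA ?lerDl ?addr_ge0 ?absval_ge0.
  + apply: prod; [apply: est zb' | apply: est ya']; rewrite ?absval_ge0 //= /M /N;
      by rewrite (addrC (v _)) -?addrA ?lerDl ?addr_ge0 ?absval_ge0.
have le a a' : H (a, a') -> v a <= v a'.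
  move=> Ha; rewrite leNgt; apply/negP => lt.
  have [y [y' [Gy /= ya ya']]] := Ha (v a) (le_lt_trans (absval_ge0 _ _) lt).
  have E : v y = v a by apply: absval_eq_near; rewrite absvalBC.
  have : v y' < v a by rewrite -(subKr a' y'); exact: absvalB_lt.
  by rewrite -(isometry_absval Gy) E ltxx.
move=> [a a'] Ha /=; apply/eqP; rewrite eq_le le //.
rewrite leNgt; apply/negP => lt.
have [y [y' [Gy /= ya ya']]] := Ha (v a') (le_lt_trans (absval_ge0 _ _) lt).
have E : v y' = v a' by apply: absval_eq_near; rewrite absvalBC.
have : v y < v a' by rewrite -(subKr a y); exact: absvalB_lt.
by rewrite (isometry_absval Gy) E ltxx.
Qed.

Definition isometry_domain : set K := [set x | exists x', G (x, x')].

Lemma isometry_domain_subfield : subfield isometry_domain.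
Proof.
split=> [|x y|x y]; rewrite !in_setE.
- by exists 1; exact: isometry1.
- by move=> [x' Gx] [y' Gy]; exists (x' - y'); exact: isometryB.
- by move=> [x' Gx] [y' Gy]; exists (x' / y'); apply: isometryM => //; exact: isometryV.
Qed.

Hypothesis cK : complete_in v [set: K].

Lemma isometry_domain_complete : complete_in v isometry_domain.
Proof.
apply/complete_inP => u Du uc.
have /choice [w wP] := Du.
have uw m n : v (u m - u n) = v (w m - w n).
  by apply: isometry_absval; exact: isometryB.
move/complete_inP: cK => cK'.
have [//|l _ lP] := cK' u _ uc.
have [//||l' _ l'P] := cK' w.
  by move=> e e0; have [N NP] := uc e e0; exists N => m n mN nN; rewrite -uw NP.
exists l => //; exists l'; apply: isometry_closed => e e0.
have [N NP] := lP e e0; have [N' N'P] := l'P e e0.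
exists (u (maxn N N')), (w (maxn N N')); split => //.
  by rewrite absvalBC NP ?leq_maxl.
by rewrite absvalBC N'P ?leq_maxr.
Qed.

(** If [x] is algebraic over the complete domain, uniqueness of the extended absolute value yields
    an isometry on the ring generated by [x]; maximality absorbs it. *)
Lemma isometry_domain_alg_closed : alg_closed_in isometry_domain.
Proof.
set D := isometry_domain; have hD : subfield D by exact: isometry_domain_subfield.
move=> q Dq sq; have [x qx] := closed_root sq; exists x => //.
pose L := subfield_type hD.
have /choice [f fP] : forall a : L, exists b, G (val a, b).
  by move=> a; have [b Gb] := subfield_type_mem a; exists b.
have [j jf] : exists j : {rmorphism L -> K}, j =1 f.
  apply: exists_rmorphism.
  - by move=> a b; apply: (isometry_inj (fP _)); exact: (isometryB (fP a) (fP b)).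
  - by move=> a b; apply: (isometry_inj (fP _)); exact: (isometryM (fP a) (fP b)).
  - by apply: (isometry_inj (fP _)); exact: isometry1.
pose i : {rmorphism L -> K} := val.
have ij a : v (i a) = v (j a) by rewrite jf; exact: (isometry_absval (fP a)).
have ri : range i = D.
  apply/seteqP; split=> [_ [a _ <-]|a Da]; first exact: subfield_type_mem.
  by have [b bE] := subfield_type_surj hD Da; exists b.
have [||beta bP] := @unique_extension R L K v i j ij _ x.
- by rewrite ri; exact: isometry_domain_complete.
- have [|q' qE] := @subfield_type_poly _ _ hD q; first exact/subfield_poly.
  exists q'; last by rewrite -qE.
  by move: sq; rewrite qE; apply: contraTneq => ->; rewrite rmorph0 size_poly0.
exists beta.
pose H := [set a | exists q : {poly L}, a = ((map_poly i q).[x], (map_poly j q).[beta])].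
apply: (maxG (H := H)); last 2 first.
- move=> [a a'] Ga; have [c cE] : exists c : L, val c = a.
    by apply: subfield_type_surj; exists a'.
  exists c%:P; rewrite !map_polyC !hornerC /= cE jf; congr pair.
  by apply: (isometry_inj Ga); rewrite -cE.
- by exists 'X; rewrite !map_polyX !hornerX.
split.
- by exists 1; rewrite !rmorph1 !hornerC.
- by move=> _ _ [b ->] [c ->]; exists (b - c); rewrite !rmorphB !hornerD !hornerN.
- by move=> _ _ [b ->] [c ->]; exists (b * c); rewrite !rmorphM !hornerM.
- by move=> _ [b ->] /=; exact: bP.
Qed.

End Maximal.
End Isometries.

(** * Isometric endomorphisms and the chain of intermediate fields *)

Section Extension.
Variables (R : realType) (k K : closedFieldType) (v : absval R K).
Variables (iota : {rmorphism k -> K}) (t : K).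
Hypotheses (cK : complete_in v [set: K]) (gt : ta_generator v iota t).
Local Notation I := (intermediate v iota).
Implicit Types (F : set K) (x y : K).

Lemma intermediate_subfield F : I F -> subfield F. Proof. by case. Qed.
Lemma intermediate_alg_closed F : I F -> alg_closed_in F. Proof. by case. Qed.
Lemma intermediate_complete F : I F -> complete_in v F. Proof. by case. Qed.
Lemma intermediate_iota F (c : k) : I F -> F (iota c).
Proof. by case=> h _ _ _; apply: h; exists c. Qed.
Lemma intermediate_nonempty F : I F -> F !=set0.
Proof. by move=> IF; exists 0; apply: subfield0; exact: intermediate_subfield. Qed.

Lemma subfield_adjoin F x : I F -> F x -> adjoin iota x `<=` F.
Proof.
move=> IF Fx _ [q1 [q2 ->]]; have hF := intermediate_subfield IF.
have Fq (q : {poly k}) : F (map_poly iota q).[x].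
  rewrite horner_coef; apply: (subfield_sum hF) => i _; apply: (subfieldM hF).
    by rewrite coef_map; exact: intermediate_iota.
  exact: subfieldX.
by apply: (subfieldM hF) => //; exact: subfieldV.
Qed.

Lemma generator_full F x : I F -> F t -> F x.
Proof.
move=> IF Ft; have F0 := intermediate_nonempty IF.
apply: (complete_inf_dist0 (v := v)) => //; first exact: intermediate_complete.
apply/eqP; rewrite eq_le inf_dist_ge0 andbT; apply/ler_addgt0Pr => e e0.
rewrite add0r; have [y [q [qF q0 qy]] xy] := gt x e0.
apply: le_trans (ltW xy); apply: inf_dist_le.
apply: (alg_closed_roots (intermediate_subfield IF) (intermediate_alg_closed IF) _ q0 qy).
apply/(subfield_poly (intermediate_subfield IF)).
move: qF; rewrite !qualifE /= => /allP qF; apply/allP => z /qF.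
by rewrite !in_setE; exact: subfield_adjoin.
Qed.

(** [q] splits over [F], and a factor [x - z] with [z] in [F] keeps its absolute value when [x]
    moves by less than its distance to [F]. *)
Lemma horner_absval_near F (q : {poly K}) x y : subfield F -> alg_closed_in F ->
  (forall i, F q`_i) -> v (y - x) < inf_dist v F x -> v q.[x] = v q.[y].
Proof.
move=> hF aF Fq yx; have [->|q0] := eqVneq q 0; first by rewrite !horner0.
have [rs Frs ->] := alg_closed_prod_roots hF aF Fq q0.
rewrite !hornerZ !absvalM !horner_prod !absval_prod; congr (_ * _).
apply: eq_big_seq => z /Frs Fz; rewrite !hornerXsubC; apply/esym/absval_eq_near.
have -> : y - z - (x - z) = y - x by ring.
exact: lt_le_trans yx (inf_dist_le _ _ Fz).
Qed.

Lemma extend_isometry F t' : I F -> v (t' - t) < inf_dist v F t ->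
  exists psi : {rmorphism K -> K}, [/\ forall x, v (psi x) = v x,
    forall c, F c -> psi c = c & psi t = t'].
Proof.
move=> IF tt'.
have [hF aF] := (intermediate_subfield IF, intermediate_alg_closed IF).
pose G0 := [set a | exists2 q : {poly K}, forall i, F q`_i & a = (q.[t], q.[t'])].
have [|G [iG G0G maxG]] := @exists_maximal_isometry R K v G0.
  split.
  - exists 1; last by rewrite !hornerC.
    by move=> i; rewrite coef1; exact: subfield_nat.
  - move=> _ _ [q Fq ->] [r Fr ->]; exists (q - r); last by rewrite !hornerD !hornerN.
    by move=> i; rewrite coefB; exact: subfieldB.
  - move=> _ _ [q Fq ->] [r Fr ->]; exists (q * r); last by rewrite !hornerM.
    move=> i; rewrite coefM; apply: (subfield_sum hF) => j _; exact: subfieldM.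
  - by move=> _ [q Fq ->] /=; exact: horner_absval_near tt'.
have GF c : F c -> G (c, c).
  move=> Fc; apply: G0G; exists c%:P; last by rewrite !hornerC.
  by move=> i; rewrite coefC; case: ifP => // _; exact: subfield0.
have Gt : G (t, t').
  apply: G0G; exists 'X; last by rewrite !hornerX.
  by move=> i; rewrite coefX; exact: subfield_nat.
have ID : I (isometry_domain G).
  split.
  - by move=> _ [c _ <-]; exists (iota c); apply: GF; exact: intermediate_iota.
  - exact: (isometry_domain_subfield iG maxG).
  - exact: (isometry_domain_alg_closed iG maxG cK).
  - exact: (isometry_domain_complete iG maxG cK).
have /choice [f fP] : forall x, exists y, G (x, y).
  by move=> x; apply: (generator_full x ID); exists t'.
have fE x y : G (x, y) -> f x = y by exact: (isometry_inj iG (fP x)).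
have [psi psif] : exists psi : {rmorphism K -> K}, psi =1 f.
  apply: exists_rmorphism.
  - by move=> x y; apply: fE; exact: (isometryB iG).
  - by move=> x y; apply: fE; exact: (isometryM iG).
  - by apply: fE; exact: (isometry1 iG).
exists psi; split=> [x|c Fc|]; rewrite psif; last exact: fE.
- exact/esym/(isometry_absval iG).
- by apply: fE; exact: GF.
Qed.

(** Applied when [psi t] lies in [F]: the preimage contains the generator [t], hence is [K], and so
    [psi] maps [K] into [F]. *)
Lemma intermediate_preim F (psi : {rmorphism K -> K}) : (forall x, v (psi x) = v x) ->
  (forall c, F (psi (iota c))) -> I F -> I [set x | F (psi x)].
Proof.
move=> vpsi psic IF; have hF := intermediate_subfield IF.
have aF := intermediate_alg_closed IF.
have hP : subfield [set x | F (psi x)].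
  split=> [|x y|x y]; rewrite !in_setE /=.
  - by rewrite rmorph1; exact: subfield1.
  - by rewrite rmorphB; exact: subfieldB.
  - by move=> Fx Fy; rewrite fmorph_div; apply: (subfieldM hF) => //; exact: subfieldV.
split => //.
- by move=> _ [c _ <-].
- move=> q /(subfield_poly hP) Fq sq; have [x qx] := closed_root sq.
  exists x => //; apply: (alg_closed_roots hF aF (q := map_poly psi q)).
  + by move=> i; rewrite coef_map; exact: Fq.
  + by rewrite map_poly_eq0 -size_poly_gt0 (leq_trans _ sq).
  + by rewrite fmorph_root.
- apply/complete_inP => u Fu uc.
  move/complete_inP: (intermediate_complete IF) => /(_ (psi \o u) Fu) [].
    move=> e /uc[N NP]; exists N => m n mN nN.
    by rewrite /= -rmorphB vpsi NP.
  move=> l' Fl' l'P; have [//|l _ lP] := (iffLR (complete_inP v _) cK) u _ uc.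
  exists l => //=; suff -> : psi l = l' by [].
  apply/eqP; rewrite -subr_eq0; apply/eqP/(@absval_small_eq0 _ _ v) => e e0.
  have [N NP] := lP e e0; have [N' N'P] := l'P e e0.
  apply/ltW/(@absval_tri_lt _ _ _ _ _ (psi (u (maxn N N')))).
    by rewrite -rmorphB vpsi absvalBC NP ?leq_maxl.
  by rewrite N'P ?leq_maxr.
Qed.

(** Some [c] in [F] is closer to [t] than [F0] is. The isometry fixing [F0] and sending [t] to [c]
    maps [K] into [F], and in particular its fixed points [F0]. *)
Lemma intermediate_chain F F0 : I F -> I F0 ->
  inf_dist v F t < inf_dist v F0 t -> F0 `<=` F.
Proof.
move=> IF IF0 lt; have [c Fc tc] := inf_dist_lt (intermediate_nonempty IF) lt.
have [|psi [vpsi psi0 psit]] := @extend_isometry F0 c IF0; first by rewrite absvalBC.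
have IP : I [set x | F (psi x)].
  apply: intermediate_preim => // a; rewrite psi0; exact: intermediate_iota.
by move=> x F0x; rewrite -(psi0 x) //; apply: (generator_full x IP); rewrite /= psit.
Qed.

(** The same device over [k] embeds [K] isometrically into [F], so [F] contains constants of every
    size that a move may require. *)
Lemma intermediate_value_group F : I F -> I (range iota) ->
  inf_dist v F t < inf_dist v (range iota) t ->
  forall x, exists2 y, F y & v y = v x.
Proof.
move=> IF I0 lt x; have [c Fc tc] := inf_dist_lt (intermediate_nonempty IF) lt.
have [|psi [vpsi psi0 psit]] := @extend_isometry (range iota) c I0.
  by rewrite absvalBC.
have IP : I [set x | F (psi x)].
  apply: intermediate_preim => // a; rewrite psi0; last by exists a.
  exact: intermediate_iota.
exists (psi x); last exact: vpsi.
by apply: (generator_full x IP); rewrite /= psit.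
Qed.

End Extension.

(** * Values of a generated field *)

Section DivisibleValues.
Variables (R : realType) (K : closedFieldType) (v : absval R K).

(** Terms with sum 0 cannot have a unique dominant one. *)
Lemma exists_two_terms (q : {poly K}) y : y != 0 -> q != 0 -> root q y ->
  exists i j : nat, [/\ (i < j)%N, q`_i != 0, q`_j != 0 &
    v q`_i * v y ^+ i = v q`_j * v y ^+ j].
Proof.
move=> y0 q0 /rootP qy.
have sq : (0 < size q)%N by rewrite size_poly_gt0.
pose T (i : 'I_(size q)) := q`_i * y ^+ i.
have [k _ kmax] := arg_maxP (fun i => v (T i)) (isT : predT (Ordinal sq)).
have Tk0 : T k != 0.
  apply/eqP => Tk0; move: q0; rewrite -lead_coef_eq0 lead_coefE => /negP; apply.
  have lt : ((size q).-1 < size q)%N by rewrite prednK.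
  have := kmax (Ordinal lt) isT; rewrite Tk0 absval0 /= => h.
  have /(absval_eq0 v)/eqP : v (T (Ordinal lt)) = 0.
    by apply/eqP; rewrite eq_le h absval_ge0.
  by rewrite mulf_eq0 expf_eq0 (negPf y0) andbF orbF.
have [j jk Tj] : exists2 j, j != k & v (T j) = v (T k).
  apply: contrapT => nj.
  have : q.[y] = T k + \sum_(i | i != k) T i by rewrite horner_coef (bigD1 k).
  rewrite qy => /esym/(congr1 v); rewrite absval0 absvalDl => [/(absval_eq0 v)/eqP|].
    by rewrite (negPf Tk0).
  have vT0 : 0 < v (T k) by rewrite absval_gt0.
  elim/big_ind: _ => [|x z|i ik]; first by rewrite absval0.
    exact: absvalD_lt.
  have /= := kmax i isT; rewrite lt_neqAle => ->; rewrite andbT; apply/eqP => Ti; apply: nj.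
  by exists i.
have Tj0 : T j != 0 by rewrite -(absval_gt0 v) Tj absval_gt0.
have nz i : T i != 0 -> q`_i != 0 by rewrite mulf_eq0 negb_or => /andP[].
move: Tj; rewrite /T !absvalM !absvalX => E.
have : (j : nat) != k by [].
rewrite neq_ltn => /orP[jk'|kj]; [exists j, k | exists k, j]; split => //; exact: nz.
Qed.

End DivisibleValues.

Section Values.
Variables (R : realType) (k K : closedFieldType) (v : absval R K).
Variables (iota : {rmorphism k -> K}) (t : K).
Hypothesis gt : ta_generator v iota t.

(** [P] plays the part of a group of values. Polynomials split over [k], so constants and
    differences [t - c] account for [k(t)]. An algebraic [y] close to [x] has the same value, and
    two terms of equal size in its equation express a power of it as a quotient. *)
Lemma generator_values (P : R -> Prop) :
  (forall a b, P a -> P b -> P (a * b)) -> (forall a b, P a -> P b -> P (a / b)) ->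
  (forall c : k, c != 0 -> P (v (iota c))) -> (forall c : k, P (v (t - iota c))) ->
  forall x, x != 0 -> exists n, (0 < n)%N /\ P (v x ^+ n).
Proof.
move=> PM PV Pk Pt x x0.
have P1 : P 1 by rewrite -(absval1 v) -(rmorph1 iota); apply: Pk; exact: oner_neq0.
have Ppoly (q : {poly k}) : (map_poly iota q).[t] != 0 -> P (v (map_poly iota q).[t]).
  have [->|q0] := eqVneq q 0; first by rewrite rmorph0 horner0 eqxx.
  move=> _; have [rs ->] := poly_prod_roots q.
  rewrite map_polyZ hornerZ absvalM; apply: (PM).
    by apply: Pk; rewrite lead_coef_eq0.
  elim: rs => [|z rs IH]; first by rewrite big_nil rmorph1 hornerC absval1.
  rewrite big_cons rmorphM hornerM absvalM; apply: (PM) => //.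
  by rewrite /= map_polyXsubC hornerXsubC.
have Padj h : adjoin iota t h -> h != 0 -> P (v h).
  move=> [q1 [q2 ->]]; rewrite mulf_eq0 invr_eq0 negb_or => /andP[h1 h2].
  by rewrite absvalM absvalV; apply: (PV); exact: Ppoly.
have [y [q [qF q0 qy]] xy] := gt x (e := v x) ltac:(by rewrite absval_gt0).
have vy : v y = v x by apply: absval_eq_near; rewrite absvalBC.
have y0 : y != 0 by rewrite -(absval_gt0 v) vy absval_gt0.
have Fq i : q`_i != 0 -> P (v q`_i).
  move=> qi; apply: Padj => //.
  have [sq|sq] := leqP (size q) i; first by rewrite nth_default ?eqxx in qi.
  by move: qF; rewrite qualifE /= => /allP /(_ _ (mem_nth 0 sq)); rewrite in_setE.
have [i [j [ij qi qj E]]] := exists_two_terms v y0 q0 qy.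
exists (j - i)%N; rewrite subn_gt0; split => //.
suff -> : v x ^+ (j - i) = v q`_i / v q`_j by apply: (PV); exact: Fq.
have vqj : v q`_j != 0 by rewrite gt_eqF ?absval_gt0.
have vyi : v y ^+ i != 0 by rewrite expf_neq0 // gt_eqF ?absval_gt0.
apply: (mulIf vqj); apply: (mulIf vyi).
rewrite divfK // E -vy mulrAC -exprD subnK 1?ltnW // mulrC //.
Qed.

(** The explicit form of [g] matters: isometries over [k] fix constants and move [t - c] exactly as
    they move [t]. *)
Lemma exists_nontrivial_value : 0 < inf_dist v (range iota) t ->
  value_group v <> [set 1] ->
  exists g, [/\ g != 0, v g != 1 & (exists c, g = iota c) \/ (exists c, g = t - iota c)].
Proof.
move=> r0 nt; apply: contrapT => no; apply: nt.
have triv g : g != 0 -> (exists c, g = iota c) \/ (exists c, g = t - iota c) -> v g = 1.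
  move=> g0 gE; apply: contrapT => /eqP g1; apply: no; exists g; split => //.
apply/seteqP; split=> [_ [x /= x0 <-]|_ ->]; last by exists 1; rewrite ?absval1 //= oner_neq0.
have [||c c0|c|n [n0]] := @generator_values (eq^~ 1) _ _ _ _ x x0.
- by move=> a b -> ->; rewrite mulr1.
- by move=> a b -> ->; rewrite divr1.
- by apply: triv; [rewrite fmorph_eq0|left; exists c].
- apply: triv; last by right; exists c.
  rewrite -(absval_gt0 v); apply: lt_le_trans r0 _; apply: inf_dist_le.
  by exists c.
by move/eqP; rewrite pexpr_eq1 ?absval_ge0 // => /eqP.
Qed.

End Values.

Section Density.
Variable R : realType.
Implicit Types (a b g z : R).

Lemma exists_exprz_between g a b : 0 < g -> g != 1 -> 0 < a -> a < b ->
  exists n (m : int), (0 < n)%N /\ a ^+ n < g ^ m < b ^+ n.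
Proof.
wlog g1 : g / 1 < g.
  move=> H g0; have [g1 _|g1 g1'|//] := ltgtP g 1.
    move=> a0 ab; have g1' : 1 < g^-1 by rewrite invf_gt1.
    have g0' : 0 < g^-1 by rewrite invr_gt0.
    have [n [m [n0 mP]]] := H _ g1' g0' (negbT (gt_eqF g1')) a0 ab.
    by exists n, (- m); split; rewrite // -exprz_inv.
  by apply: H => //; rewrite gt_eqF.
move=> g0 _ a0 ab; have b0 := lt_trans a0 ab.
have L0 : 0 < ln g by rewrite ln_gt0.
have D0 : 0 < ln b - ln a by rewrite subr_gt0 ltr_ln ?posrE.
(* [n] makes the interval from [n ln a] to [n ln b] longer than [ln g], and [m ln g] is the first
   multiple of [ln g] past its left end. *)
pose n := (Num.truncn (ln g / (ln b - ln a))).+1.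
pose m := Num.floor (n%:R * ln a / ln g) + 1.
have n1 : ln g < n%:R * (ln b - ln a).
  by rewrite -ltr_pdivrMr // truncnS_gt.
have m1 : n%:R * ln a < m%:~R * ln g by rewrite -ltr_pdivrMr // floorD1_gt.
have m2 : m%:~R * ln g <= n%:R * ln a + ln g.
  by rewrite intrD mulrDl mul1r lerD2r -ler_pdivlMr // ge_floor.
exists n, m; split => //.
have E' c j : 0 < c -> c ^+ j = expR (j%:R * ln c) :> R.
  by move=> c0; rewrite expRM_natl lnK.
have E c i : 0 < c -> c ^ i = expR (i%:~R * ln c) :> R.
  move=> c0; case: i => j; first by rewrite -E' // exprnP.
  by rewrite NegzE -exprnN E' // -expRN -mulNr mulrNz.
rewrite (E g) // !E' // !ltr_expR m1 /=.
by apply: le_lt_trans m2 _; rewrite -ltrBrDl -mulrBr.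
Qed.

End Density.

Lemma exists_absval_between (R : realType) (K : closedFieldType) (v : absval R K)
    (g : K) (lo hi : R) : g != 0 -> v g != 1 -> 0 < lo -> lo < hi ->
  exists x, lo < v x < hi.
Proof.
move=> g0 g1 lo0 lohi; have vg0 : 0 < v g by rewrite absval_gt0.
have [n [m [n0 /andP[m1 m2]]]] := exists_exprz_between vg0 g1 lo0 lohi.
have [b bn] := exists_nth_root (g ^ m) n0.
have vbn : v b ^+ n = v g ^ m by rewrite -absvalX bn absvalXz.
exists b; rewrite -vbn in m1 m2.
by rewrite -(@ltr_pXn2r _ n) ?m1 -?(@ltr_pXn2r _ n _ (v b)) ?m2 ?nnegrE ?absval_ge0 ?ltW //
  (lt_trans lo0).
Qed.

(** * Intermediate fields at a prescribed distance *)

Section NearbyRoots.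
Variables (R : realType) (K : closedFieldType) (v : absval R K).

(** The original polynomial vanishes at [x], so the perturbed one is small there and [near_root]
    applies. *)
Lemma near_root_perturb (n : nat) (c d : nat -> K) (x : K) (e : R) :
  (0 < n)%N -> 0 <= e -> (forall i, (i < n)%N -> v (c i - d i) <= e) ->
  root ('X^n + \poly_(i < n) c i) x ->
  exists2 y, root ('X^n + \poly_(i < n) d i) y &
    v (x - y) ^+ n <= e * Num.max 1 (v x) ^+ n.
Proof.
move=> n0 e0 cd qx.
set Q := 'X^n + _.
have sn : (size (\poly_(i < n) d i) < size ('X^n : {poly K}))%N.
  by rewrite size_polyXn ltnS size_poly.
have sQ : size Q = n.+1 by rewrite size_polyDl // size_polyXn.
have mQ : Q \is monic by rewrite monicE lead_coefDl // lead_coefXn.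
have [|y Qy xy] := near_root v x mQ; first by rewrite sQ.
exists y => //; move: xy; rewrite sQ /=; move=> /le_trans; apply.
have -> : Q.[x] = (\poly_(i < n) (d i - c i)).[x].
  move: qx => /rootP; rewrite /Q !hornerD => /eqP; rewrite addr_eq0 => /eqP ->.
  rewrite addrC !horner_poly -sumrB; apply: eq_bigr => i _.
  by rewrite mulrBl.
have m1 : 1 <= Num.max 1 (v x) by rewrite le_max lexx.
have m0 : 0 <= Num.max 1 (v x) by exact: le_trans m1.
rewrite horner_poly; apply: absval_sum_le => [|i _]; first by rewrite mulr_ge0 ?exprn_ge0.
rewrite absvalM absvalX; apply: ler_pM; rewrite ?exprn_ge0 ?absval_ge0 //.
  by rewrite absvalBC cd.
apply: le_trans (_ : Num.max 1 (v x) ^+ i <= _).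
  by rewrite lerXn2r ?nnegrE ?absval_ge0 // le_max lexx orbT.
by apply: ler_weXn2l => //; exact: ltnW.
Qed.

Lemma monic_poly_shape (q : {poly K}) : q \is monic ->
  q = 'X^((size q).-1) + \poly_(i < (size q).-1) q`_i.
Proof.
move=> qm; apply/polyP => i; rewrite coefD coefXn coef_poly.
have s0 : (0 < size q)%N by rewrite size_poly_gt0 monic_neq0.
have [ii|ii|->] := ltngtP i (size q).-1; rewrite ?add0r //.
  by rewrite nth_default // -(prednK s0).
by rewrite addr0 -lead_coefE (monicP qm).
Qed.

Lemma alg_closed_of_monic (G : set K) : subfield G ->
  (forall (n : nat) (c : nat -> K) (x : K), (0 < n)%N -> (forall i, G (c i)) ->
     root ('X^n + \poly_(i < n) c i) x -> G x) ->
  alg_closed_in G.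
Proof.
move=> hG h q /(subfield_poly hG) Gq sq; have [x qx] := closed_root sq.
exists x => //; set n := (size q).-1.
have q0 : q != 0 by rewrite -size_poly_gt0 (leq_trans _ sq).
have lq0 : lead_coef q != 0 by rewrite lead_coef_eq0.
pose r := (lead_coef q)^-1 *: q.
have rm : r \is monic by rewrite monicE lead_coefZ mulVf.
have sr : size r = size q by rewrite size_scale // invr_eq0.
apply: (h n (fun i => r`_i)).
- by rewrite /n; case: (size q) sq => [|[|]].
- move=> i; rewrite coefZ; apply: (subfieldM hG) => //; apply: (subfieldV hG).
  by rewrite lead_coefE.
- by rewrite /n -sr -monic_poly_shape // rootZ ?invr_eq0.
Qed.

End NearbyRoots.

Section PowerContraction.
Variables (R : realType) (K : closedFieldType) (v : absval R K) (p : nat).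
Hypothesis pr_p : prime p.

(** Each [p]-th power multiplies the relative error by at most [max (c^(p-1), |p|)], which is below
    1 as soon as [c] and [|p|] are. *)
Lemma absval_expXp_sub_le w u (c : R) n : 0 <= c -> c <= 1 -> v p%:R <= 1 ->
  v u <= c * v w ->
  v ((w + u) ^+ (p ^ n) - w ^+ (p ^ n)) <=
    v w ^+ (p ^ n) * (c * Num.max (c ^+ p.-1) (v p%:R) ^+ n).
Proof.
move=> c0 c1 p1 uw; set m := Num.max _ _.
have m0 : 0 <= m by rewrite le_max exprn_ge0.
have m1 : m <= 1 by rewrite ge_max exprn_ile1.
elim: n => [|n IH].
  by rewrite expn0 !expr1 expr0 mulr1 addrC addKr mulrC.
rewrite expnSr !exprM.
move: IH; set x := (w + u) ^+ _; set y := w ^+ _; rewrite -absvalX -/y => IH.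
have cm : c * m ^+ n <= c by rewrite ler_piMr // exprn_ile1.
have yc : v (x - y) <= v y * c by apply: le_trans IH _; rewrite ler_wpM2l ?absval_ge0.
have xy : v (x - y) <= v y by apply: le_trans yc _; rewrite ler_piMr ?absval_ge0.
have := absval_expD_sub_le pr_p xy; rewrite (addrC y) subrK.
have pE : p = p.-1.+1 by rewrite prednK // prime_gt0.
have -> : v y ^+ p * (c * m ^+ n.+1) = v y * (c * m ^+ n) * (v y ^+ p.-1 * m).
  by rewrite [in LHS]pE !exprS; ring.
have Y0 : 0 <= v y ^+ p.-1 by rewrite exprn_ge0 ?absval_ge0.
move=> /le_trans; apply; rewrite ge_max; apply/andP; split.
  rewrite [X in _ ^+ X <= _]pE exprS; apply: ler_pM; rewrite ?exprn_ge0 ?absval_ge0 //.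
  apply: le_trans (_ : (v y * c) ^+ p.-1 <= _).
    by rewrite lerXn2r ?nnegrE ?absval_ge0 // mulr_ge0 ?absval_ge0.
  by rewrite exprMn ler_wpM2l // le_max lexx.
rewrite mulrC; apply: ler_pM; rewrite ?absval_ge0 ?mulr_ge0 ?absval_ge0 //.
by rewrite mulrC ler_wpM2l // le_max lexx orbT.
Qed.

End PowerContraction.

(* The elements on which a sequence of isometric endomorphisms converges along
   an ultrafilter form an algebraically closed complete subfield. *)
Section UltraLimit.
Variables (R : realType) (k K : closedFieldType) (v : absval R K).
Variables (iota : {rmorphism k -> K}).
Hypothesis cK : complete_in v [set: K].
Variables (W : set K) (U : set_system nat) (psi : nat -> {rmorphism K -> K}).
Hypotheses (hW : subfield W) (aW : alg_closed_in W) (iW : range iota `<=` W).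
Hypothesis UU : UltraFilter U.
Hypothesis vpsi : forall i x, v (psi i x) = v x.
Hypothesis psic : forall i c, psi i (iota c) = iota c.

(** Convergence in Cauchy form, which avoids naming limits; [W] is the set from which the
    approximate limits are taken. *)
Definition ultra_close (x : K) (d : R) : Prop :=
  exists2 w, W w & U [set i | v (psi i x - w) <= d].

Definition ultra_limits : set K := [set x | forall d, 0 < d -> ultra_close x d].

(** This is where an ultrafilter is essential: among finitely many roots, chosen differently for
    each [i], one serves for almost all [i]. *)
Lemma ultra_exists_in (rs : seq K) (P : K -> nat -> Prop) :
  U [set i | exists2 z, z \in rs & P z i] -> exists2 z, z \in rs & U [set i | P z i].
Proof.
elim: rs => [|z rs IH] h.
  have [i [z]] : [set i | exists2 z, z \in [::] & P z i] !=set0 by exact: filter_ex h.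
  by rewrite in_nil.
have [Uz|Uz] := in_ultra_setVsetC [set i | P z i] UU.
  by exists z; rewrite ?inE ?eqxx.
have [|y yrs Uy] := IH; last by exists y; rewrite ?inE ?yrs ?orbT.
apply: filterS2 h Uz => i [y]; rewrite inE => /predU1P[-> //|yrs Py _].
by exists y.
Qed.

Lemma ultra_forall_lt (n : nat) (P : nat -> nat -> Prop) :
  (forall j, (j < n)%N -> U [set i | P j i]) ->
  U [set i | forall j, (j < n)%N -> P j i].
Proof.
elim: n => [|n IH] h; first by apply: filterS filterT => i _ j.
have := IH (fun j jn => h j (ltnW jn)).
move=> /(filterS2 _) /(_ (h n (ltnSn n))); apply=> i Pi Pn j.
by rewrite ltnS leq_eqVlt => /predU1P[->|/Pi].
Qed.

Lemma ultra_close_roots (q : {poly K}) (x : K) (d : R) : (forall i, W q`_i) -> q != 0 ->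
  U [set i | exists2 y, root q y & v (psi i x - y) <= d] -> ultra_close x d.
Proof.
move=> Wq q0 h; have [rs Wrs qE] := alg_closed_prod_roots hW aW Wq q0.
have [|y yrs Uy] := @ultra_exists_in rs (fun y i => v (psi i x - y) <= d).
  apply: filterS h => i [y qy xy]; exists y => //.
  by move: qy; rewrite qE rootZ ?lead_coef_eq0 // root_prod_XsubC.
by exists y => //; exact: Wrs.
Qed.

Lemma ultra_close_le x d e : d <= e -> ultra_close x d -> ultra_close x e.
Proof. by move=> de [w Ww Uw]; exists w => //; apply: filterS Uw => i /= /le_trans; apply. Qed.

Lemma ultra_closeB x y d : ultra_close x d -> ultra_close y d -> ultra_close (x - y) d.
Proof.
move=> [w Ww Uw] [z Wz Uz]; exists (w - z); first exact: subfieldB.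
apply: filterS2 Uw Uz => i /= xw yz.
rewrite rmorphB.
have -> : psi i x - psi i y - (w - z) = psi i x - w - (psi i y - z) by ring.
exact: absvalB_le.
Qed.

Lemma ultra_limitsM x y : ultra_limits x -> ultra_limits y -> ultra_limits (x * y).
Proof.
move=> Gx Gy e e0.
pose M := v x + v y + 1; have M0 : 0 < M by rewrite ltr_wpDl ?addr_ge0 ?absval_ge0.
pose d := Num.min 1 (e / M); have d0 : 0 < d by rewrite lt_min ltr01 divr_gt0.
have [w Ww Uw] := Gx _ d0; have [z Wz Uz] := Gy _ d0.
exists (w * z); first exact: subfieldM.
apply: filterS2 Uw Uz => i /= xw yz.
have dM : d * M <= e by rewrite -ler_pdivlMr // ge_min lexx orbT.
have vz : v z <= v y + 1.
  rewrite -(vpsi i y); have -> : z = psi i y - (psi i y - z) by ring.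
  apply: absvalB_le; first by rewrite lerDl.
  apply: le_trans yz _; apply: le_trans (_ : 1 <= _); first by rewrite ge_min lexx.
  by rewrite lerDr absval_ge0.
rewrite rmorphM.
have -> : psi i x * psi i y - w * z = psi i x * (psi i y - z) + z * (psi i x - w) by ring.
apply: absvalD_le; rewrite absvalM; apply: le_trans dM; rewrite [leRHS]mulrC.
  apply: ler_pM; rewrite ?absval_ge0 ?vpsi // /M.
  by rewrite -addrA lerDl addr_ge0 ?absval_ge0.
apply: ler_pM; rewrite ?absval_ge0 //; apply: le_trans vz _.
by rewrite /M -addrA lerDr absval_ge0.
Qed.

Lemma ultra_limitsV x : ultra_limits x -> ultra_limits x^-1.
Proof.
move=> Gx e e0; have [x0|x0] := eqVneq x 0.
  exists 0; first exact: subfield0.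
  by apply: filterS filterT => i _ /=; rewrite x0 invr0 rmorph0 subrr absval0 ltW.
have vx0 : 0 < v x by rewrite absval_gt0.
pose d := Num.min (v x / 2) (e * v x ^+ 2).
have d0 : 0 < d by rewrite lt_min divr_gt0 // mulr_gt0 ?exprn_gt0.
have [w Ww Uw] := Gx _ d0; exists w^-1; first exact: subfieldV.
apply: filterS Uw => i /= xw.
have wx : v w = v x.
  rewrite -(vpsi i x); apply: absval_eq_near; rewrite absvalBC vpsi.
  apply: le_lt_trans xw _; rewrite gt_min ltr_pdivrMr // ltr_pMr // ltr1n //.
have w0 : w != 0 by rewrite -(absval_gt0 v) wx.
have px0 : psi i x != 0 by rewrite fmorph_eq0.
rewrite fmorphV.
have -> : (psi i x)^-1 - w^-1 = (w - psi i x) * ((psi i x)^-1 * w^-1).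
  by field; rewrite px0 w0.
rewrite !absvalM !absvalV vpsi wx absvalBC -invfM -expr2.
rewrite ler_pdivrMr ?exprn_gt0 //; apply: le_trans xw _.
by rewrite ge_min lexx orbT.
Qed.

Lemma ultra_limits_iota c : ultra_limits (iota c).
Proof.
move=> d d0; exists (iota c); first by apply: iW; exists c.
apply: filterS filterT => i _ /=.
by rewrite psic subrr absval0 ltW.
Qed.

Lemma ultra_limits_subfield : subfield ultra_limits.
Proof.
split=> [|x y|x y]; rewrite !in_setE.
- by rewrite -(rmorph1 iota); exact: ultra_limits_iota.
- by move=> Gx Gy d d0; apply: ultra_closeB; [exact: Gx|exact: Gy].
- by move=> Gx Gy; apply: ultra_limitsM => //; exact: ultra_limitsV.
Qed.

Lemma ultra_close_near x y d : v (x - y) <= d -> ultra_close x d -> ultra_close y d.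
Proof.
move=> xy [w Ww Uw]; exists w => //; apply: filterS Uw => i /= xw.
apply: (@absval_tri_le _ _ _ _ _ (psi i x)) => //.
by rewrite -rmorphB vpsi absvalBC.
Qed.

Lemma ultra_limits_complete : complete_in v ultra_limits.
Proof.
apply/complete_inP => u Gu uc; have [//|l _ lP] := (iffLR (complete_inP v _) cK) u _ uc.
exists l => // d d0; have [N NP] := lP d d0.
by apply: (@ultra_close_near (u N)); [exact/ltW/NP | exact: Gu].
Qed.

Lemma ultra_limits_alg_closed : alg_closed_in ultra_limits.
Proof.
apply: (alg_closed_of_monic ultra_limits_subfield) => n c x n0 Gc qx e e0.
set M := Num.max 1 (v x).
have M0 : 0 < M by rewrite lt_max ltr01.
(* Chosen so that [d * M ^+ n], the bound of [near_root_perturb], equals [e ^+ n]. *)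
pose d := e ^+ n / M ^+ n; have d0 : 0 < d by rewrite divr_gt0 ?exprn_gt0.
have /choice [w wP] : forall j, exists w, W w /\ U [set i | v (psi i (c j) - w) <= d].
  by move=> j; have [w Ww Uw] := Gc j d d0; exists w.
pose Q : {poly K} := 'X^n + \poly_(j < n) w j.
have Q0 : Q != 0.
  rewrite -lead_coef_eq0 lead_coefDl ?lead_coefXn ?oner_neq0 //.
  by rewrite size_polyXn ltnS size_poly.
apply: (@ultra_close_roots Q) => //.
  move=> i; rewrite coefD coefXn coef_poly; apply: (subfieldD hW).
    exact: subfield_nat.
  by case: ifP => _; [have [] := wP i|exact: subfield0].
apply: filterS (ultra_forall_lt (n := n) (fun j _ => (wP j).2)) => i /= cw.
have [|y Qy xy] := @near_root_perturb _ _ v n (fun j => psi i (c j)) w (psi i x) d n0 (ltW d0) cw.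
  move: qx; rewrite -(fmorph_root (psi i)) rmorphD /= map_polyXn.
  rewrite (_ : map_poly _ (\poly_(j < n) c j) = \poly_(j < n) psi i (c j)) //.
  apply/polyP => j; rewrite coef_map !coef_poly; case: ifP => // _; exact: rmorph0.
exists y => //; move: xy; rewrite vpsi -/M divfK ?gt_eqF ?exprn_gt0 //.
by rewrite ler_pXn2r // ?nnegrE ?absval_ge0 ?ltW.
Qed.

Lemma ultra_limits_intermediate : intermediate v iota ultra_limits.
Proof.
split; [|exact: ultra_limits_subfield|exact: ultra_limits_alg_closed|
  exact: ultra_limits_complete].
by move=> _ [c _ <-]; exact: ultra_limits_iota.
Qed.

End UltraLimit.

(** The [q]-th roots of a fixed [T] tend to 1; in [ultra_step] this makes the correction [b w] about
    as large as [b]. *)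
Lemma exists_root_near1 (R : realType) (T c d : R) : 0 < T -> 0 < c -> c < 1 -> 1 < d ->
  exists N, forall q z, (N <= q)%N -> 0 <= z -> z ^+ q = T -> c < z < d.
Proof.
move=> T0 c0 c1 d1; have d0 : 0 < d by exact: lt_trans d1.
have [N1 N1P] := exists_expr_lt (ltW c0) c1 T0.
have [|||N2 N2P] := @exists_expr_lt _ d^-1 T^-1; rewrite ?invf_lt1 ?invr_gt0 //.
  by rewrite invr_ge0 ltW.
exists (maxn N1 N2) => q z; rewrite geq_max => /andP[/N1P q1 /N2P q2] z0 zT.
have Td : T < d ^+ q by move: q2; rewrite exprVn ltf_pV2 // posrE exprn_gt0.
apply/andP; split; rewrite ltNge; apply/negP => h.
  by move: q1; rewrite ltNge -zT lerXn2r // nnegrE ltW.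
by move: Td; rewrite ltNge -zT lerXn2r // nnegrE ltW.
Qed.

Lemma absval_exprzB_le (R : realType) (K : fieldType) (v : absval R K) x y (l : R) (m : int) :
  l < 1 -> y != 0 -> v (x - y) <= l * v y -> v (x ^ m - y ^ m) <= l * v (y ^ m).
Proof.
move=> l1 y0 xy.
have vy0 : 0 < v y by rewrite absval_gt0.
have vxy : v x = v y.
  by apply: absval_eq_near; apply: le_lt_trans xy _; rewrite -[ltRHS]mul1r ltr_pM2r.
have x0 : x != 0 by rewrite -(absval_gt0 v) vxy.
have nat_case n : v (x ^+ n - y ^+ n) <= l * v (y ^+ n).
  elim: n => [|n IH].
    rewrite !expr0 subrr absval0 absval1 mulr1.
    by rewrite -(ler_pM2r vy0) mul0r; apply: le_trans xy; exact: absval_ge0.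
  have -> : x ^+ n.+1 - y ^+ n.+1 = x * (x ^+ n - y ^+ n) + (x - y) * y ^+ n.
    by rewrite !exprS; ring.
  apply: absvalD_le; rewrite !absvalM.
    by rewrite exprS absvalM vxy mulrCA ler_pM2l.
  by rewrite exprS absvalM mulrA ler_wpM2r ?absval_ge0.
case: m => n; first exact: nat_case.
rewrite NegzE -!exprnN; set X := x ^+ _; set Y := y ^+ _.
have X0 : X != 0 by rewrite expf_neq0.
have Y0 : Y != 0 by rewrite expf_neq0.
have -> : X^-1 - Y^-1 = (Y - X) * (X^-1 * Y^-1) by field; rewrite X0 Y0.
have vXY : v X = v Y by rewrite /X /Y !absvalX vxy.
rewrite !absvalM !absvalV vXY absvalBC mulrA ler_pM2r ?invr_gt0 ?absval_gt0 //.
by rewrite ler_pdivrMr ?absval_gt0 // nat_case.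
Qed.

Lemma complete_steps (R : realType) (K : fieldType) (v : absval R K) (u : nat -> K)
    (e : nat -> R) :
  complete_in v [set: K] -> (forall n, v (u n.+1 - u n) <= e n) ->
  (forall n, e n.+1 <= e n) -> (forall d, 0 < d -> exists N, e N < d) ->
  exists l, forall n, v (u n - l) <= e n.
Proof.
move=> /complete_inP cK ue edec esmall.
have e0 n : 0 <= e n by apply: le_trans (ue n); exact: absval_ge0.
have le_e m n : (m <= n)%N -> e n <= e m.
  elim: n => [|n IH]; first by rewrite leqn0 => /eqP ->.
  rewrite leq_eqVlt => /predU1P[->//|]; rewrite ltnS => /IH; exact: le_trans.
have ule m n : (m <= n)%N -> v (u n - u m) <= e m.
  elim: n => [|n IH]; first by rewrite leqn0 => /eqP ->; rewrite subrr absval0.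
  rewrite leq_eqVlt => /predU1P[<-|]; first by rewrite subrr absval0.
  rewrite ltnS => mn; apply: (@absval_tri_le _ _ _ _ _ (u n)); last exact: IH.
  exact: le_trans (ue n) (le_e _ _ mn).
have [//|d d0|l _ lP] := cK u.
  have [N NP] := esmall d d0; exists N => m n mN nN; apply: le_lt_trans NP.
  by apply: (@absval_tri_le _ _ _ _ _ (u N)); rewrite ?ule // absvalBC ule.
exists l => n; apply/ler_addgt0Pr => d d0; have [N NP] := lP d d0.
apply: (@absval_tri_le _ _ _ _ _ (u (maxn N n))).
  by rewrite absvalBC (le_trans (ule _ _ (leq_maxr _ _))) // lerDl ltW.
by rewrite (le_trans (ltW (NP _ (leq_maxl _ _)))) // lerDr.
Qed.

Lemma subfield_setT (K : fieldType) : subfield [set: K].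
Proof. by split=> [|x y _ _|x y _ _]; rewrite in_setE. Qed.

Lemma alg_closed_setT (K : closedFieldType) : alg_closed_in [set: K].
Proof. by move=> q _ /closed_root[x qx]; exists x. Qed.

(** * Elements near the generator on which the isometries converge *)

Section UltraStep.
Variables (R : realType) (k K : closedFieldType) (v : absval R K).
Variables (iota : {rmorphism k -> K}) (t : K) (p : nat).
Hypothesis cK : complete_in v [set: K].
Hypothesis gt : ta_generator v iota t.
Hypothesis pr_p : prime p.
Hypothesis vp : v p%:R < 1.
Hypothesis nt : value_group v <> [set 1].
Variables (U : set_system nat) (psi : nat -> {rmorphism K -> K}) (a : nat -> K) (e1 : R).
Hypothesis UU : UltraFilter U.
Hypothesis vpsi : forall i x, v (psi i x) = v x.
Hypothesis psic : forall i c, psi i (iota c) = iota c.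
Hypothesis psit : forall i, psi i t = t + a i.
Hypothesis ae1 : forall i, v (a i) <= e1.
Hypothesis e1r : e1 < inf_dist v (range iota) t.
Local Notation UC := (ultra_close v [set: K] U psi).
Local Notation r := (inf_dist v (range iota) t).

Let e10 : 0 <= e1. Proof. exact: le_trans (absval_ge0 _ _) (ae1 0%N). Qed.
Let r0 : 0 < r. Proof. exact: le_lt_trans e10 e1r. Qed.
Let rt : r <= v t.
Proof. by rewrite -{2}(subr0 t) -(rmorph0 iota); apply: inf_dist_le; exists 0. Qed.

(** [b] solves an equation [X^n = g^m]. Every [psi i] moves [g] with relative error at most
    [l0 = e1 / r < 1]. Taking [n]-th roots turns this into [l] with [l^n = l0], still below 1, and
    the approximate limit is one of finitely many roots. *)
Lemma exists_close_constant (lo hi : R) : 0 < lo -> lo < hi ->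
  exists b l, [/\ lo < v b < hi, 0 <= l, l < 1 & UC b (l * v b)].
Proof.
move=> lo0 lohi; have [g [g0 g1 gE]] := exists_nontrivial_value gt r0 nt.
pose l0 := e1 / r.
have l00 : 0 <= l0 by rewrite divr_ge0 ?inf_dist_ge0.
have l01 : l0 < 1 by rewrite ltr_pdivrMr // mul1r.
have psig i : v (psi i g - g) <= l0 * v g.
  case: gE => [[c gE]|[c gE]].
    by rewrite {1 2}gE psic subrr absval0 mulr_ge0 ?absval_ge0.
  rewrite {1 2}gE rmorphB psit psic (_ : _ - _ = a i); last by ring.
  apply: le_trans (ae1 i) _; rewrite /l0 mulrAC ler_pdivlMr // ler_wpM2l //.
  by rewrite gE; apply: inf_dist_le; exists c.
have vg0 : 0 < v g by rewrite absval_gt0.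
have [n [m [n0 /andP[m1 m2]]]] := exists_exprz_between vg0 g1 lo0 lohi.
have [b bn] := exists_nth_root (g ^ m) n0.
have vbn : v b ^+ n = v g ^ m by rewrite -absvalX bn absvalXz.
have [l l0' ln] := exists_root_pow n0 l00.
have l1 : l < 1.
  rewrite ltNge; apply/negP => l1; move: l01; rewrite -ln ltNge.
  by rewrite exprn_ege1.
exists b, l; split => //.
  rewrite -vbn in m1 m2.
  by rewrite -(@ltr_pXn2r _ n) ?m1 -?(@ltr_pXn2r _ n _ (v b)) ?m2 ?nnegrE ?absval_ge0 ?ltW //
    (lt_trans lo0).
apply: (@ultra_close_roots _ _ v _ U psi (@subfield_setT K) (@alg_closed_setT K) UU ('X^n - (g ^
  m)%:P)) => //.
  by rewrite -size_poly_gt0 size_XnsubC.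
apply: filterS filterT => i _ /=.
have [|y Qy yb] := near_root v (psi i b) (monicXnsubC (g ^ m) n0).
  by rewrite size_XnsubC.
exists y => //; move: yb; rewrite size_XnsubC //= !hornerE.
rewrite -rmorphXn /= bn fmorphXz => h.
rewrite -(@ler_pXn2r _ n) ?nnegrE ?mulr_ge0 ?absval_ge0 //.
rewrite exprMn ln vbn -absvalXz; apply: le_trans h _.
exact: absval_exprzB_le.
Qed.

(** Solve [w^q - b w = y] with [q = p^n] and put [y' = w^q]. The derivative of the trinomial has
    size [|b| > d], so for almost all [i] a Newton step finds a root of one fixed trinomial within
    relative error [c < 1] of [psi i w]. Raising to the power [p^n] makes this error as small as
    desired, and the fixed trinomial has only finitely many roots. *)
Lemma ultra_step (y : K) (d hi d' : R) : v y = v t -> 0 < d -> d < hi -> hi <= r ->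
  UC y d -> 0 < d' -> exists y', [/\ v (y' - y) < hi, v y' = v t & UC y' d'].
Proof.
move=> yt d0 dhi hir UCy d'0.
have [b [l [/andP[db bh] l0 l1 UCb]]] := exists_close_constant d0 dhi.
set T := v t in yt *; set B := v b in db bh UCb.
have T0 : 0 < T by exact: lt_le_trans rt.
have B0 : 0 < B by exact: lt_trans db.
have BT : B < T by apply: lt_le_trans bh _; exact: le_trans rt.
have dB : d / B < 1 by rewrite ltr_pdivrMr // mul1r.
have [c [lc dc c1]] : exists c : R, [/\ l < c, d / B < c & c < 1].
  have h : Num.max l (d / B) < 1 by rewrite gt_max l1.
  have := midf_lt h; set c := _ / 2 => [[mc c1]]; exists c; move: mc.
  by rewrite gt_max => /andP[].
have c0 : 0 < c by exact: le_lt_trans lc.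
pose m := Num.max (c ^+ p.-1) (v p%:R).
have m0 : 0 <= m by rewrite le_max exprn_ge0 ?(ltW c0).
have p1 := prime_gt1 pr_p.
have m1 : m < 1.
  rewrite gt_max vp andbT -(expr1n _ p.-1) ltr_pXn2r ?nnegrE ?(ltW c0) ?ler01 //.
  by case: (p) p1 => [|[]].
pose z0 := d / B / c.
have z00 : 0 < z0 by rewrite !divr_gt0.
(* [N1] makes [b] too small to affect [|w|]; [N2] ensures [d < c |b| |w|] and [|b| |w| < hi]; [N3]
   ensures [|q| |w|^(q-1) < |b|]; [N4] brings the final error below [d']. *)
have [N1 N1P] := @exists_expr_lt _ (B / T) T^-1 ltac:(by rewrite divr_ge0 ?ltW)
   ltac:(by rewrite ltr_pdivrMr // mul1r) ltac:(by rewrite invr_gt0).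
have [N2 N2P] := @exists_root_near1 _ T z0 (hi / B) T0 z00
   ltac:(by rewrite ltr_pdivrMr // mul1r) ltac:(by rewrite ltr_pdivlMr // mul1r).
have [N3 N3P] := @exists_expr_lt _ (v p%:R) (B * z0 / T) (absval_ge0 _ _) vp
   ltac:(by rewrite divr_gt0 // mulr_gt0).
have [N4 N4P] := @exists_expr_lt _ m (d' / T) m0 m1 ltac:(by rewrite divr_gt0).
pose n := (maxn (maxn N1 N2) (maxn N3 N4)).+1.
have nq : (n < p ^ n)%N by exact: ltn_expl.
set q := (p ^ n)%N in nq.
have q1 : (1 < q)%N by exact: leq_ltn_trans nq.
have [qN1 qN2] : (N1 <= q /\ N2 <= q)%N.
  by split; apply: leq_trans (ltnW nq); rewrite /n; clear; lia.
have [nN3 nN4] : (N3 <= n /\ N4 <= n)%N by rewrite /n; clear; lia.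
have [w wy] := exists_trinomial_root b y q1.
have wq : w ^+ q = y + b * w by rewrite -wy subrK.
have qE : q = q.-1.+1 by rewrite prednK // ltnW.
set z := v w.
have zT : z ^+ q = T.
  rewrite -yt; apply: absval_trinomial_root wq _ => //; rewrite yt.
  have := N1P q qN1; rewrite expr_div_n ltr_pdivrMr ?exprn_gt0 //.
  by rewrite [in T ^+ q]qE exprS mulKf ?gt_eqF.
have z_ge0 : 0 <= z by exact: absval_ge0.
have /andP[zz0 zhi] := N2P q z qN2 z_ge0 zT.
have z_gt0 : 0 < z by exact: lt_trans zz0.
exists (w ^+ q); split.
- by rewrite wq addrC addKr absvalM mulrC -ltr_pdivlMr.
- by rewrite absvalX zT.
have [wy' _ Uy] := UCy; have [wb _ Ub] := UCb.
have [i0 [Ui0 Ub0]] : [set i | v (psi i y - wy') <= d] `&`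
    [set i | v (psi i b - wb) <= l * B] !=set0.
  by apply: (@filter_ex _ U); exact: filterI.
pose b0 := psi i0 b; pose y0 := psi i0 y.
pose Q := 'X^q - b0 *: 'X - y0%:P.
suff : U [set i | exists2 Y, root Q Y & v (psi i (w ^+ q) - Y ^+ q) <= d'].
  have [rs QE] := poly_prod_roots Q => h.
  have [|Y _ UY] := @ultra_exists_in _ U UU rs (fun Y i => v (psi i (w ^+ q) - Y ^+ q) <= d').
    apply: filterS h => i [Y QY Yd]; exists Y => //; move: QY.
    by rewrite QE (monicP (trinomial_monic _ _ _)) // scale1r root_prod_XsubC.
  by exists (Y ^+ q).
apply: filterS2 Uy Ub => i /= Uy Ub; set W := psi i w.
have vW : v W = z by exact: vpsi.
have Wq : W ^+ q = psi i y + psi i b * W by rewrite -rmorphM -rmorphD -wq rmorphXn.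
have yy0 : v (psi i y - y0) <= d.
  by apply: absval_tri_le Uy _; rewrite absvalBC.
have bb0 : v (psi i b - b0) <= l * B.
  by apply: absval_tri_le Ub _; rewrite absvalBC.
have vb0 : v b0 = B by exact: vpsi.
have [|Y QY YW] := @small_root_at _ _ v Q W (c * z).
  rewrite deriv_trinomial.
  have -> : Q.[W] = (psi i y - y0) + (psi i b - b0) * W by rewrite !hornerE Wq; ring.
  have -> : v (q%:R * W ^+ q.-1 - b0) = B.
    rewrite absvalBC absvalDl ?vb0 // absvalN absvalM absvalX vW natrX absvalX.
    have := N3P n nN3; rewrite ltr_pdivlMr // -zT [in z ^+ q]qE exprS => h.
    rewrite -(ltr_pM2r z00); apply: le_lt_trans h.
    rewrite -mulrA ler_wpM2l ?exprn_ge0 ?absval_ge0 // mulrC ler_wpM2r ?exprn_ge0 //.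
    exact: ltW.
  apply: absvalD_lt.
    apply: le_lt_trans yy0 _; rewrite mulrA -ltr_pdivrMl ?mulr_gt0 // mulrC.
    by rewrite invfM mulrA.
  rewrite absvalM vW mulrA ltr_pM2r //; apply: le_lt_trans bb0 _.
  by rewrite mulrC ltr_pM2l.
exists Y => //.
have cz : v (Y - W) <= c * v W by rewrite vW ltW.
have := absval_expXp_sub_le pr_p n (ltW c0) (ltW c1) (ltW vp) cz.
rewrite (addrC W) subrK -/q vW zT rmorphXn /= -/W absvalBC => /le_trans; apply.
rewrite -/m mulrC -ler_pdivlMr //; apply: le_trans (ltW (N4P n nN4)).
by rewrite ler_piMl ?exprn_ge0 // ltW.
Qed.

(** Steps of size below [hi / 2^n] are repeated while the ultrafilter error shrinks at the same
    rate, so the elements converge to one on which the error is 0. *)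
Lemma ultra_limits_near (d hi : R) : 0 < d -> d < hi -> hi <= r -> UC t d ->
  exists2 y, ultra_limits v [set: K] U psi y & v (t - y) <= hi.
Proof.
move=> d0 dhi hir UCt; have hi0 := lt_trans d0 dhi.
pose h (n : nat) := hi / 2 ^+ n.
have h0 n : 0 < h n by rewrite divr_gt0 // exprn_gt0.
have hS n : h n.+1 < h n.
  by rewrite /h ltr_pM2l // ltf_pV2 ?posrE ?exprn_gt0 // exprS ltr_pMl ?exprn_gt0 // ltr1n.
have hhi n : h n <= hi.
  elim: n => [|n]; first by rewrite /h expr0 divr1.
  by apply: le_trans; exact: ltW.
have /choice [f fP] : forall ny : nat * K, exists y', v ny.2 = v t -> UC ny.2 (h ny.1.+1) ->
    [/\ v (y' - ny.2) < h ny.1, v y' = v t & UC y' (h ny.1.+2)].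
  move=> [n y] /=; have [[yt UCy]|no] := pselect (v y = v t /\ UC y (h n.+1)).
    have [y' [y1 y2 y3]] := ultra_step yt (h0 n.+1) (hS n) (le_trans (hhi n) hir) UCy (h0 n.+2).
    by exists y'.
  by exists 0 => yt UCy; case: no.
have [y1 [y1t vy1 UCy1]] := ultra_step (erefl _) d0 dhi hir UCt (h0 1%N).
pose u := fix u n := if n is m.+1 then f (m, u m) else y1.
have uP n : v (u n) = v t /\ UC (u n) (h n.+1).
  by elim: n => [//|n [IH1 IH2]] /=; have [_ ? ?] := fP (n, u n) IH1 IH2.
have uS n : v (u n.+1 - u n) <= h n.
  by have [H1 H2] := uP n; have [/= /ltW] := fP (n, u n) H1 H2.
have small e : 0 < e -> exists N, h N < e.
  move=> e0; have [|||N NP] := @exists_expr_lt _ (2^-1 : R) (e / hi).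
  - by rewrite invr_ge0.
  - by rewrite invf_lt1 // ltr1n.
  - exact: divr_gt0.
  by exists N; rewrite /h -exprVn mulrC -ltr_pdivlMr // NP.
have [|l lP] := complete_steps cK uS _ small; first by move=> n; exact/ltW.
exists l.
  move=> e e0; have [N NP] := small e e0.
  apply: (@ultra_close_near _ _ _ _ _ _ UU vpsi (u N)); first exact: le_trans (lP N) (ltW NP).
  apply: ultra_close_le (uP N).2; apply: le_trans (ltW NP); exact/ltW.
apply: (@absval_tri_le _ _ _ _ _ y1); first by rewrite absvalBC ltW.
by have := lP 0%N; move=> /le_trans; apply.
Qed.

End UltraStep.

Section Surjectivity.
Variables (R : realType) (k K : closedFieldType) (v : absval R K).
Variables (iota : {rmorphism k -> K}) (t : K) (p : nat).
Hypothesis cK : complete_in v [set: K].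
Hypothesis gt : ta_generator v iota t.
Hypothesis pr_p : prime p.
Hypothesis vp : v p%:R < 1.
Hypothesis nt : value_group v <> [set 1].
Hypothesis Ik : intermediate v iota (range iota).
Local Notation r := (inf_dist v (range iota) t).

Lemma exists_value_between (lo hi : R) : 0 < r -> 0 < lo -> lo < hi ->
  exists x, lo < v x < hi.
Proof.
move=> r0 lo0 lohi; have [g [g0 g1 _]] := exists_nontrivial_value gt r0 nt.
exact: exists_absval_between g0 g1 lo0 lohi.
Qed.

(** A limit element [c] with [|t - c| < e] is impossible: two isometries agreeing on [c] up to less
    than [e] would agree on [t] to the same precision, whereas [|a i - a j| = |a i| > e]. *)
Lemma intermediate_surj (e : R) : 0 < e -> e < r ->
  exists2 F, intermediate v iota F & inf_dist v F t = e.
Proof.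
move=> e0 er; have r0 := lt_trans e0 er.
(* [h] decreases to [e] from the midpoint of [e] and [r]; choosing [|a i|] between consecutive terms
   makes it strictly decreasing. *)
pose h (i : nat) := e + (r - e) / 2 / i.+1%:R.
have re0 : 0 < (r - e) / 2 by rewrite divr_gt0 // subr_gt0.
have hS i j : (i < j)%N -> h j < h i.
  by move=> ij; rewrite ltrD2l ltr_pM2l // ltf_pV2 ?posrE ?ltr0n // ltr_nat ltnS.
have h0 i : e < h i by rewrite ltrDl divr_gt0.
pose e1 := h 0%N.
have e1r : e1 < r by rewrite /e1 /h divr1; lra.
have /choice [a aP] : forall i, exists x, h i.+1 < v x < h i.
  by move=> i; apply: exists_value_between => //; [exact: lt_trans (h0 _)|exact: hS].
have ae i : e < v (a i) by have /andP[+ _] := aP i; apply: lt_trans.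
have adec i j : (i < j)%N -> v (a j) < v (a i).
  move=> ij; have /andP[ai _] := aP i; have /andP[_ aj] := aP j.
  apply: lt_trans aj (le_lt_trans _ ai).
  by move: ij; rewrite leq_eqVlt => /predU1P[<-//|/hS/ltW].
have ae1 i : v (a i) <= e1.
  have /andP[_ /ltW ai] := aP i; apply: le_trans ai _.
  by case: i => [//|i]; rewrite ltW ?hS.
have /choice [psi psiP] : forall i, exists psi : {rmorphism K -> K},
    [/\ forall x, v (psi x) = v x, forall c, range iota c -> psi c = c & psi t = t + a i].
  move=> i; apply: (extend_isometry cK gt Ik).
  by rewrite addrC addKr; apply: le_lt_trans (ae1 i) e1r.
have vpsi i x : v (psi i x) = v x by have [] := psiP i.
have psic i c : psi i (iota c) = iota c.
  by have [_ + _] := psiP i; apply; exists c.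
have psit i : psi i t = t + a i by have [] := psiP i.
have [U [UU Uoo]] := ultraFilterLemma eventually_filter.
exists (ultra_limits v [set: K] U psi); first by apply: ultra_limits_intermediate => //;
  [exact: subfield_setT | exact: alg_closed_setT].
have G0 : ultra_limits v [set: K] U psi !=set0 by exists (iota 0); apply: ultra_limits_iota.
apply/eqP; rewrite eq_le; apply/andP; split.
  apply/ler_addgt0Pr => s s0; pose hi := Num.min (e + s) r.
  have ehi : e < hi by rewrite lt_min ltrDl s0.
  have [d1 d2] := midf_lt ehi; set d := (e + hi) / 2 in d1 d2.
  have [||||y Gy ty] :=
    @ultra_limits_near _ _ _ _ _ t p cK gt pr_p vp nt U psi a e1 UU vpsi psic psit ae1 e1r d hi.
  - exact: lt_trans d1.
  - exact: d2.
  - by rewrite ge_min lexx orbT.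
  - exists t => //; apply: Uoo.
    have de : 0 < (d - e) / ((r - e) / 2) by rewrite divr_gt0 // subr_gt0.
    have [N NP] := exists_inv_nat_lt de; exists N => // i /= /NP Ni.
    rewrite psit addrC addKr; have /andP[_ /ltW ai] := aP i; apply: le_trans ai _.
    by rewrite /h -lerBrDl mulrC -ler_pdivlMr // ltW.
  apply: le_trans (inf_dist_le v t Gy) (le_trans ty _).
  by rewrite ge_min lexx.
apply: le_inf_dist => // c Gc; rewrite leNgt; apply/negP => tc.
have e20 : 0 < e / 2 by rewrite divr_gt0.
have [w _ Uw] := Gc _ e20.
have tail n : U [set i | (n < i)%N] by apply: Uoo; exists n.+1.
have [i /= iw] : [set i | v (psi i c - w) <= e / 2] !=set0 by exact: (@filter_ex _ U).
have [j [/= jw ij]] : [set j | v (psi j c - w) <= e / 2] `&` [set j | (i < j)%N] !=set0.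
  by apply: (@filter_ex _ U); exact: filterI.
have lt e' : e' <= e / 2 -> e' < e.
  by move=> h1; apply: le_lt_trans h1 _; rewrite ltr_pdivrMr // ltr_pMr // ltr1n.
have : v (a i - a j) < e.
  have -> : a i - a j = psi i (t - c) - psi j (t - c) + ((psi i c - w) - (psi j c - w)).
    by rewrite !rmorphB !psit; ring.
  apply: absvalD_lt; first by apply: absvalB_lt; rewrite vpsi.
  by apply: absvalB_lt; exact: lt.
by rewrite absvalDl ?absvalN ?adec // ltNge ltW.
Qed.

End Surjectivity.

(** * Bending profiles *)

Section Moves.
Variables (R : realType) (k K : closedFieldType) (v : absval R K).
Variables (iota : {rmorphism k -> K}) (p : nat).
Hypothesis pr_p : prime p.
Hypothesis vp : v p%:R < 1.
Local Notation I := (intermediate v iota).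
Local Notation dist := (inf_dist v).

(* With [u = c + w^p - b' w] and [c, b', b] in [F0], passing from [u] to
   [c + w^p - b w] is invisible to the fields that do not contain [F0]. *)
Lemma artin_schreier_move (F0 : set K) (u b b' : K) (r0 e e2 : R) :
  I F0 -> F0 b -> F0 b' -> 0 < e -> e < r0 -> 0 < e2 -> v p%:R * r0 < e2 ->
  v b ^+ p <= e ^+ p.-1 -> v b' ^+ p <= e ^+ p.-1 ->
  e2 ^+ p.-1 <= v b ^+ p -> e2 ^+ p.-1 <= v b' ^+ p ->
  dist F0 u = r0 -> (forall F, I F -> F0 `<=` F \/ r0 <= dist F u) ->
  exists2 u', v (u' - u) < r0 & forall F, I F -> exists rho, [/\ 0 <= rho,
    dist F u = Num.max (rho ^+ p) (v b' * rho) &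
    dist F u' = Num.max (rho ^+ p) (v b * rho)].
Proof.
move=> IF0 F0b F0b' e0 er e20 pr be be' e2b e2b' ur0 alt.
have p0 := prime_gt0 pr_p; have p1 := prime_gt1 pr_p.
have q0 : (0 < p.-1)%N by case: (p) p1 => [|[]].
have pE : p = p.-1.+1 by rewrite prednK.
have r00 := lt_trans e0 er.
have D1r : r0 < r0 ^+ p / e ^+ p.-1.
  rewrite ltr_pdivlMr ?exprn_gt0 // [in ltRHS]pE exprS ltr_pM2l //.
  by rewrite ltr_pXn2r // nnegrE ltW.
have [D2 D2r pD2] : exists2 D2, r0 < D2 & v p%:R * D2 <= e2.
  have : 0 <= v p%:R by exact: absval_ge0.
  rewrite le_eqVlt => /predU1P[<-|vp0].
    by exists (r0 + 1); rewrite ?mul0r ?ltW // ltrDl.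
  exists (e2 / v p%:R); first by rewrite ltr_pdivlMr // mulrC.
  by rewrite mulrC divfK // gt_eqF.
(* The first bound on [|u - c|] yields [|b w| < r0], which keeps the move invisible to far fields;
   the second yields [|p| |w|^(p-1) < |b|]. Both hold for [b'] as well. *)
have [|c F0c] := @inf_dist_lt _ _ v F0 u (Num.min (r0 ^+ p / e ^+ p.-1) D2)
  (intermediate_nonempty IF0).
  by rewrite ur0 lt_min D1r.
rewrite lt_min => /andP[uc1 uc2].
set x := u - c in uc1 uc2; set X := v x in uc1 uc2.
have rX : r0 <= X by rewrite -ur0; exact: inf_dist_le.
have [w wx] := exists_trinomial_root b' x p1.
have wp : w ^+ p = x + b' * w by rewrite -wx subrK.
set z := v w; have z_ge0 : 0 <= z by exact: absval_ge0.
have zX : z ^+ p = X.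
  apply: absval_trinomial_root wp _ => //; apply: le_lt_trans be' _.
  rewrite ltr_pXn2r ?nnegrE ?absval_ge0 ?(ltW e0) //; exact: lt_le_trans er rX.
have small B : 0 <= B -> B ^+ p <= e ^+ p.-1 -> B * z < r0.
  move=> B0 Be; rewrite -(@ltr_pXn2r _ p) ?nnegrE ?mulr_ge0 ?(ltW r00) //.
  rewrite exprMn zX; apply: (@le_lt_trans _ _ (e ^+ p.-1 * X)).
    by rewrite ler_wpM2r ?absval_ge0.
  by rewrite mulrC -ltr_pdivlMr ?exprn_gt0.
have pz B : 0 <= B -> e2 ^+ p.-1 <= B ^+ p -> v p%:R * z ^+ p.-1 < B.
  move=> B0 Be; rewrite -(@ltr_pXn2r _ p) ?nnegrE ?mulr_ge0 ?exprn_ge0 ?absval_ge0 //.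
  apply: lt_le_trans Be; rewrite exprMn exprAC zX.
  apply: (@le_lt_trans _ _ ((v p%:R * X) ^+ p.-1)).
    rewrite exprMn ler_wpM2r ?exprn_ge0 ?absval_ge0 //.
    have -> : v p%:R ^+ p = v p%:R * v p%:R ^+ p.-1 by rewrite -exprS -pE.
    by rewrite ler_piMl ?exprn_ge0 ?absval_ge0 ?(ltW vp).
  rewrite ltr_pXn2r ?nnegrE ?mulr_ge0 ?absval_ge0 ?(ltW e20) //.
  have [vp0|vp0] := eqVneq (v p%:R) 0; first by rewrite vp0 mul0r.
  apply: lt_le_trans pD2; rewrite ltr_pM2l // lt_def vp0 absval_ge0 //.
exists (c + (w ^+ p - b * w)).
  have -> : c + (w ^+ p - b * w) - u = b' * w - b * w.
    by rewrite wp /x; ring.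
  by apply: absvalB_lt; rewrite absvalM small ?absval_ge0.
move=> F IF; have [hF aF] := (intermediate_subfield IF, intermediate_alg_closed IF).
have uE : u = c + (w ^+ p - b' * w) by rewrite wx /x; ring.
have [sub|far] := alt F IF.
  exists (dist F w); rewrite inf_dist_ge0; split => //.
    rewrite uE -(inf_dist_shift v _ hF (sub _ F0c)) addrC addKr.
    by apply: inf_dist_artin_schreier => //; [exact: sub|rewrite pz ?absval_ge0].
  rewrite -(inf_dist_shift v _ hF (sub _ F0c)) addrC addKr.
  by apply: inf_dist_artin_schreier => //; [exact: sub|rewrite pz ?absval_ge0].
have -> : dist F (c + (w ^+ p - b * w)) = dist F u.
  apply: inf_dist_near; first exact: intermediate_nonempty IF.
  apply: lt_le_trans far; rewrite [in v _]uE.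
  have -> : c + (w ^+ p - b' * w) - (c + (w ^+ p - b * w)) = b * w - b' * w by ring.
  by apply: absvalB_lt; rewrite absvalM small ?absval_ge0.
(* For a far field [|b|] and [|b'|] are at most [rho^(p-1)], so both maxima are [rho^p]. *)
have [rho rho0 rhoE] := exists_root_pow p0 (inf_dist_ge0 v F u).
exists rho; rewrite rho0 -rhoE.
have rhoB B : 0 <= B -> B ^+ p <= e ^+ p.-1 -> B * rho <= rho ^+ p.
  move=> B0 Be; rewrite pE exprSr ler_wpM2r //.
  rewrite -(@ler_pXn2r _ p) ?nnegrE ?exprn_ge0 //; apply: le_trans Be _.
  rewrite exprAC rhoE lerXn2r ?nnegrE ?inf_dist_ge0 ?(ltW e0) //.
  exact: le_trans (ltW er) far.
by split => //; apply/esym/max_idPl; rewrite rhoB ?absval_ge0.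
Qed.

(** The same set as [log_value_group v]; since an exponential is never 0, no nonvanishing condition
    has to be carried. *)
Definition log_value : set R := [set x | exists z, v z = expR x].

Lemma log_valueD x y : log_value x -> log_value y -> log_value (x + y).
Proof. by move=> [a aE] [b bE]; exists (a * b); rewrite absvalM expRD aE bE. Qed.

Lemma log_valueN x : log_value x -> log_value (- x).
Proof. by move=> [a aE]; exists a^-1; rewrite absvalV expRN aE. Qed.

Lemma log_valueB x y : log_value x -> log_value y -> log_value (x - y).
Proof. by move=> xG yG; apply: log_valueD => //; exact: log_valueN. Qed.

Lemma log_valueMn x n : log_value x -> log_value (x * n%:R).
Proof. by move=> [a aE]; exists (a ^+ n); rewrite absvalX expRM_natr aE. Qed.

Lemma log_value_divn x n : (0 < n)%N -> log_value x -> log_value (x / n%:R).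
Proof.
move=> n0 [a aE]; have [b bn] := exists_nth_root a n0; exists b.
apply: (pexpIrn n0); rewrite ?nnegrE ?absval_ge0 ?expR_ge0 //.
by rewrite -absvalX bn aE -expRM_natr divfK // pnatr_eq0 -lt0n.
Qed.

Lemma log_valueMz x (d : int) : log_value x -> log_value (x * (p%:R : R) ^ d).
Proof.
have p0 := prime_gt0 pr_p.
move=> xG; case: d => n; first by rewrite -exprnP -natrX; exact: log_valueMn.
rewrite NegzE -exprnN -natrX; apply: log_value_divn => //.
by rewrite expn_gt0 p0.
Qed.

(* Slope 1, then slope [a] on [sigma, sigma + eps], then slope 1 again. *)
Definition bend (a sigma eps N : R) : R :=
  N + (a - 1) * Num.min (Num.max (N - sigma) 0) eps.

Lemma bend_left a sigma eps N : 0 <= eps -> N <= sigma -> bend a sigma eps N = N.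
Proof.
by move=> e0 Ns; rewrite /bend max_r ?subr_le0 // min_l // mulr0 addr0.
Qed.

Lemma bend_middle a sigma eps N : sigma <= N -> N <= sigma + eps ->
  bend a sigma eps N = sigma + a * (N - sigma).
Proof.
move=> sN Ne; rewrite /bend max_l ?subr_ge0 // min_l ?lerBlDl //; ring.
Qed.

Lemma bend_right a sigma eps N : 0 <= eps -> sigma + eps <= N ->
  bend a sigma eps N = N + (a - 1) * eps.
Proof.
move=> e0 sN; have : eps <= N - sigma by rewrite lerBrDl.
by move=> h; rewrite /bend max_l ?(le_trans e0) // min_r.
Qed.

Lemma bend_comp a c sigma eps N : 0 < a -> 0 <= eps ->
  bend c sigma (a * eps) (bend a sigma eps N) = bend (a * c) sigma eps N.
Proof.
move=> a0 e0; have ae0 : 0 <= a * eps by rewrite mulr_ge0 // ltW.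
have [Ns|/ltW sN] := leP N sigma; first by rewrite !(bend_left _ _ Ns).
have [Ne|/ltW eN] := leP N (sigma + eps).
  rewrite (bend_middle _ sN Ne) bend_middle.
  - by rewrite (bend_middle _ sN Ne); ring.
  - by rewrite lerDl mulr_ge0 ?subr_ge0 // ltW.
  - by rewrite lerD2l ler_pM2l // lerBlDl.
rewrite !(bend_right _ _ eN) // bend_right //; first by ring.
move: eN; rewrite mulrBl mul1r; lra.
Qed.

Lemma bend1 sigma eps N : bend 1 sigma eps N = N.
Proof. by rewrite /bend subrr mul0r addr0. Qed.

Let P : R := p%:R.
Let P2 : 2 <= P. Proof. by rewrite /P ler_nat prime_gt1. Qed.
Let P0 : 0 < P. Proof. by apply: lt_le_trans P2. Qed.

(* The function [r |-> max (r^p) (|b| r)] read off on a logarithmic scale, for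
   [|b| = exp (- (p - 1) kappa)]. *)
Definition log_profile (kappa y : R) : R := Num.min (P * y) (y + (P - 1) * kappa).

(** The slopes of the two profiles differ only for [y] between [k1] and [k2], where they are 1 and
    [p]. Read on the values, this segment starts at [P * k1] and has length [k2 - k1] for one
    profile and [P * (k2 - k1)] for the other. *)
Lemma log_profile_bend k1 k2 y : k1 <= k2 ->
  log_profile k2 y = bend P (P * k1) (k2 - k1) (log_profile k1 y) /\
  log_profile k1 y = bend P^-1 (P * k1) (P * (k2 - k1)) (log_profile k2 y).
Proof.
have P1 : 0 <= P - 1 by rewrite subr_ge0 (le_trans _ P2) // ler1n.
have lo kap : y <= kap -> log_profile kap y = P * y.
  move=> yk; rewrite /log_profile min_l //.
  by nra.
have hi kap : kap <= y -> log_profile kap y = y + (P - 1) * kap.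
  move=> yk; rewrite /log_profile min_r //.
  by nra.
have Pn0 : P != 0 by rewrite gt_eqF.
move=> k12; have [yk1|/ltW ky1] := leP y k1.
  have yk2 := le_trans yk1 k12; rewrite !lo //.
  by rewrite !bend_left ?subr_ge0 ?mulr_ge0 ?(ltW P0) ?subr_ge0 ?ler_pM2l.
have Pk : P * k1 <= P * y by rewrite ler_pM2l.
have [yk2|/ltW ky2] := leP y k2.
  rewrite (hi k1) // (lo k2) //; split.
    by rewrite bend_middle; [ring | nra | lra].
  by rewrite bend_middle //; [field | rewrite -mulrDr subrKC ler_pM2l].
rewrite (hi k1) // (hi k2) //; split.
  by rewrite bend_right; [ring | lra | nra].
by rewrite bend_right; [field | rewrite mulr_ge0 ?subr_ge0 ?(ltW P0) | nra].
Qed.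

Lemma max_expR_profile rho B kappa y : B = expR (- ((P - 1) * kappa)) -> rho = expR (- y) ->
  Num.max (rho ^+ p) (B * rho) = expR (- log_profile kappa y).
Proof.
move=> -> ->; rewrite -expRM_natr -expRD /log_profile.
have -> : - y * p%:R = - (P * y) by rewrite mulNr mulrC.
have -> : - ((P - 1) * kappa) - y = - (y + (P - 1) * kappa) by ring.
have [h|h] := leP (P * y) (y + (P - 1) * kappa).
  by rewrite max_l // ler_expR lerN2.
by rewrite max_r // ler_expR lerN2 ltW.
Qed.

End Moves.

Lemma expR_opp_ln (R : realType) (x : R) : 0 < x -> x = expR (- - ln x).
Proof. by move=> x0; rewrite opprK lnK. Qed.

Lemma exists_expR_bound (R : realType) (x : R) : 0 <= x -> x < 1 ->
  exists2 L, 0 < L & x <= expR (- L).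
Proof.
rewrite le_eqVlt => /predU1P[<- _|x0 x1]; first by exists 1; rewrite ?expR_ge0.
by exists (- ln x); [rewrite oppr_gt0 ln_lt0 // x0 | rewrite opprK lnK].
Qed.

Section BendMoves.
Variables (R : realType) (k K : closedFieldType) (v : absval R K).
Variables (iota : {rmorphism k -> K}) (p : nat).
Hypothesis pr_p : prime p.
Hypothesis vp : v p%:R < 1.
Local Notation I := (intermediate v iota).
Local Notation dist := (inf_dist v).
Let P : R := p%:R.
Let P2 : 2 <= P. Proof. by rewrite /P ler_nat prime_gt1. Qed.
Let P0 : 0 < P. Proof. by apply: lt_le_trans P2. Qed.

(** The parameter [up] tells which constant is the old one: raising the slope replaces the constant
    belonging to [k1] by the one belonging to [k2]. *)
Lemma bend_move (F0 : set K) (u : K) (N0 k1 k2 : R) (up : bool) :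
  I F0 -> (forall x, exists2 y, F0 y & v y = v x) ->
  k1 <= k2 -> log_value v k1 -> log_value v k2 ->
  N0 < P * k1 -> v p%:R * expR (- N0) < expR (- (P * k2)) ->
  dist F0 u = expR (- N0) ->
  (forall F, I F -> F0 `<=` F \/ expR (- N0) <= dist F u) ->
  exists2 u', v (u' - u) < expR (- N0) & forall F N, I F -> dist F u = expR (- N) ->
    dist F u' = expR (- if up then bend P (P * k1) (k2 - k1) N
                        else bend P^-1 (P * k1) (P * (k2 - k1)) N).
Proof.
move=> IF0 full k12 G1 G2 N0k pk uN0 alt.
have p0 := prime_gt0 pr_p.
have P1E : P - 1 = p.-1%:R by rewrite /P -[p in LHS](prednK p0) -natr1 addrK.
have const kap : log_value v kap -> exists2 b, F0 b & v b = expR (- ((P - 1) * kap)).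
  move=> Gk; have [z zE] : log_value v (- ((P - 1) * kap)).
    by apply: log_valueN; rewrite P1E mulrC; exact: log_valueMn.
  by have [b F0b bE] := full z; exists b; rewrite // bE zE.
have [b1 F0b1 b1E] := const _ G1; have [b2 F0b2 b2E] := const _ G2.
have powE kap : expR (- (P * kap)) ^+ p.-1 = expR (- ((P - 1) * kap)) ^+ p.
  rewrite -!expRM_natr -P1E; congr expR; rewrite -/P; ring.
have le1 kap : k1 <= kap -> expR (- ((P - 1) * kap)) ^+ p <= expR (- (P * k1)) ^+ p.-1.
  move=> kk; rewrite -powE lerXn2r ?nnegrE ?expR_ge0 // ler_expR lerN2.
  by rewrite ler_pM2l.
have le2 kap : kap <= k2 -> expR (- (P * k2)) ^+ p.-1 <= expR (- ((P - 1) * kap)) ^+ p.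
  move=> kk; rewrite -powE lerXn2r ?nnegrE ?expR_ge0 // ler_expR lerN2.
  by rewrite ler_pM2l.
pose b := if up then b2 else b1; pose b' := if up then b1 else b2.
pose kb := if up then k2 else k1; pose kb' := if up then k1 else k2.
have bE : v b = expR (- ((P - 1) * kb)) by rewrite /b /kb; case: (up).
have bE' : v b' = expR (- ((P - 1) * kb')) by rewrite /b' /kb'; case: (up).
have k1b : k1 <= kb /\ kb <= k2 by rewrite /kb; case: (up).
have k1b' : k1 <= kb' /\ kb' <= k2 by rewrite /kb'; case: (up).
have [u' uu' u'P] := @artin_schreier_move _ _ _ v iota p pr_p vp F0 u b b' (expR (- N0))
  (expR (- (P * k1))) (expR (- (P * k2))) IF0
  ltac:(by rewrite /b; case: (up)) ltac:(by rewrite /b'; case: (up)) (expR_gt0 _)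
  ltac:(by rewrite ltr_expR ltrN2) (expR_gt0 _) pk
  ltac:(by rewrite bE; apply: le1; case: k1b) ltac:(by rewrite bE'; apply: le1; case: k1b')
  ltac:(by rewrite bE; apply: le2; case: k1b) ltac:(by rewrite bE'; apply: le2; case: k1b')
  uN0 alt.
exists u' => // F N IF uN; have [rho [rho0 uE ->]] := u'P F IF.
have rho_gt0 : 0 < rho.
  rewrite lt_def rho0 andbT; apply/eqP => rho_eq0; move: uE.
  rewrite uN rho_eq0 mulr0 expr0n gtn_eqF //= maxxx => /eqP.
  by rewrite gt_eqF ?expR_gt0.
have yE := expR_opp_ln rho_gt0; set y := - ln rho in yE.
move: uE; rewrite uN (max_expR_profile bE' yE) (max_expR_profile bE yE).
move=> /expR_inj/oppr_inj ->; congr (expR (- _)).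
have [h1 h2] := log_profile_bend pr_p y k12.
by rewrite /kb /kb'; case: (up).
Qed.

(** One move changes the slope by a single factor [p], so as many as the absolute value of [d] are
    composed. The maximum of 1 and [P ^ d] covers the segment lengths met at all stages, whence a
    single hypothesis on [v p%:R]. *)
Lemma bend_moves (d : int) (F0 : set K) (u : K) (N0 s eps : R) :
  I F0 -> (forall x, exists2 y, F0 y & v y = v x) ->
  0 <= eps -> log_value v s -> log_value v eps -> N0 < s ->
  v p%:R * expR (- N0) < expR (- (s + eps * Num.max 1 (P ^ d))) ->
  dist F0 u = expR (- N0) ->
  (forall F, I F -> F0 `<=` F \/ expR (- N0) <= dist F u) ->
  exists2 u', v (u' - u) < expR (- N0) & forall F N, I F -> dist F u = expR (- N) ->
    dist F u' = expR (- bend (P ^ d) s eps N).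
Proof.
move=> IF0 full e0 Gs Ge N0s + uN0 alt.
have Pn0 : P != 0 by rewrite gt_eqF.
have P1 : 1 <= P by apply: le_trans P2; rewrite ler1n.
have pw (i : int) : 0 < P ^ i by rewrite exprz_gt0.
pose goal (i : int) := exists2 u', v (u' - u) < expR (- N0) &
  forall F N, I F -> dist F u = expR (- N) -> dist F u' = expR (- bend (P ^ i) s eps N).
have step (i : int) (up : bool) (B : R) :
    v p%:R * expR (- N0) < expR (- (s + eps * B)) ->
    (if up then P * P ^ i else P ^ i) <= B -> goal i ->
    goal (if up then i + 1 else i - 1).
  move=> pB iB [w wu wP].
  pose k1 := s / P; pose k2 := k1 + (if up then P ^ i * eps else P ^ i * eps / P).
  have Pk1 : P * k1 = s by rewrite /k1 mulrC divfK.
  have Pk2 : P * k2 = s + eps * (if up then P * P ^ i else P ^ i).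
    by rewrite mulrDr Pk1; case: (up); [ring|field].
  have k12 : k1 <= k2.
    rewrite lerDl; case: (up); rewrite ?divr_ge0 ?mulr_ge0 ?(ltW (pw i)) ?(ltW P0) //.
  have G1 : log_value v k1 by apply: log_value_divn => //; exact: prime_gt0.
  have G2 : log_value v k2.
    have Gi : log_value v (P ^ i * eps) by rewrite mulrC; exact: log_valueMz.
    apply: log_valueD => //; case: (up) => //.
    by apply: log_value_divn => //; exact: prime_gt0.
  have [||||w' ww' w'P] := @bend_move F0 w N0 k1 k2 up IF0 full k12 G1 G2.
  - by rewrite Pk1.
  - rewrite Pk2; apply: lt_le_trans pB _; rewrite ler_expR lerN2 lerD2l.
    by rewrite ler_wpM2l.
  - by rewrite (wP _ _ IF0 uN0) bend_left // ltW.
  - move=> F IF; have [sub|far] := alt F IF; [by left|right].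
    have uF0 : 0 < dist F u by apply: lt_le_trans far; exact: expR_gt0.
    have uE := expR_opp_ln uF0; rewrite (wP _ _ IF uE).
    have NN0 : - ln (dist F u) <= N0 by rewrite -lerN2 -ler_expR -uE.
    by rewrite bend_left ?(le_trans NN0 (ltW N0s)) // -uE.
  exists w'; first exact: absval_tri_lt ww' wu.
  move=> F N IF uN; rewrite (w'P _ _ IF (wP _ _ IF uN)); congr (expR (- _)).
  rewrite Pk1 /k2 (addrC k1) addrK.
  case: (up); first by rewrite bend_comp ?pw // expfzDr // expr1z.
  have -> : P * (P ^ i * eps / P) = P ^ i * eps by field.
  by rewrite bend_comp ?pw // expfzDr // exprN1.
have goal0 : goal 0.
  exists u; first by rewrite subrr absval0 expR_gt0.
  by move=> F N _ ->; rewrite expr0z bend1.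
case: d => n pB.
  suff H m : (m <= n)%N -> goal m by exact: H.
  elim: m => [//|m IH] mn; rewrite -addn1 PoszD.
  apply: (step _ true _ pB); last exact/IH/ltnW.
  rewrite le_max -!exprnP -exprS; apply/orP; right.
  by rewrite ler_weXn2l.
suff H m : (m <= n.+1)%N -> goal (- m%:Z) by rewrite NegzE; exact: H.
elim: m => [//|m IH] mn; rewrite -addn1 PoszD opprD.
apply: (step _ false _ pB); last exact/IH/ltnW.
by rewrite le_max -exprnN invf_le1 ?exprn_gt0 // exprn_ege1.
Qed.

End BendMoves.

(** * Straightening profiles *)

(** At the supremum of the points satisfying [Q] the local hypothesis carries [Q] further. This
    replaces a finite subcover when the size of the local steps depends on the point. *)
Lemma interval_induction (R : realType) (Q : R -> Prop) (a b : R) : a <= b ->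
  (forall x, a <= x -> x <= b -> exists2 eta, 0 < eta &
     forall y z, a <= y -> y <= z -> z <= b -> x - eta < y -> z < x + eta -> Q y -> Q z) ->
  Q a -> Q b.
Proof.
move=> ab loc Qa.
pose S := [set y | [/\ a <= y, y <= b & Q y]].
have S0 : S a by split.
have Sb : has_ubound S by exists b => y [].
have supS : has_sup S by split; [exists a|].
set c := sup S.
have ac : a <= c by apply: (ub_le_sup Sb).
have cb : c <= b by apply: (@sup_le_ub _ S b); [exists a | move=> y []].
have [eta eta0 etaP] := loc c ac cb.
have [y [ay yb Qy] cy] := sup_adherent eta0 supS; rewrite -/c in cy.
have yc : y <= c by apply: (ub_le_sup Sb).
have yce : y < c + eta by apply: le_lt_trans yc _; rewrite ltrDl.
have [bc|bc] := leP b (c + eta / 2).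
  apply: (etaP y b) => //; apply: le_lt_trans bc _.
  by rewrite ltrD2l ltr_pdivrMr // ltr_pMr // ltr1n.
have : S (c + eta / 2).
  have e20 : 0 <= eta / 2 by rewrite divr_ge0 // ltW.
  split; [by rewrite (le_trans ac) // lerDl | exact: ltW |].
  apply: (etaP y) => //.
  - by rewrite (le_trans yc) // lerDl.
  - exact: ltW.
  - by rewrite ltrD2l ltr_pdivrMr // ltr_pMr // ltr1n.
move=> /(ub_le_sup Sb); rewrite -/c gerDl leNgt divr_gt0 //.
Qed.

Section Realization.
Variables (R : realType) (k K : closedFieldType) (v : absval R K).
Variables (iota : {rmorphism k -> K}) (t : K) (p : nat).
Hypothesis cK : complete_in v [set: K].
Hypothesis gt : ta_generator v iota t.
Hypothesis pr_p : prime p.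
Hypothesis vp : v p%:R < 1.
Hypothesis nt : value_group v <> [set 1].
Hypothesis Ik : intermediate v iota (range iota).
Hypothesis r0 : 0 < inf_dist v (range iota) t.
Local Notation I := (intermediate v iota).
Local Notation dist := (inf_dist v).
Local Notation P := (p%:R : R).
Let s0 : R := - ln (dist (range iota) t).

Let P2 : 2 <= P. Proof. by rewrite ler_nat prime_gt1. Qed.
Let P0 : 0 < P. Proof. by apply: lt_le_trans P2. Qed.
Let Pz (m : int) : 0 < P ^ m. Proof. by rewrite exprz_gt0. Qed.

Definition realizes (u : K) (f : R -> R) : Prop := forall F s, I F ->
  dist F t = expR (- s) -> dist F u = expR (- f s).

(* [f] up to [s], continued with slope [p ^ j]. *)
Definition straighten (j : int) (s : R) (f : R -> R) (x : R) : R :=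
  f (Num.min x s) + P ^ j * Num.max (x - s) 0.

Lemma dist_iota_expR : dist (range iota) t = expR (- s0).
Proof. exact: expR_opp_ln. Qed.

Lemma intermediate_ge_s0 F s : I F -> dist F t = expR (- s) -> s0 <= s.
Proof.
move=> IF Fs; rewrite -lerN2 -ler_expR -Fs -dist_iota_expR.
apply: inf_dist_subset; first by exists (iota 0), 0.
by case: IF.
Qed.

Lemma intermediate_exists s : s0 <= s -> exists2 F, I F & dist F t = expR (- s).
Proof.
rewrite le_eqVlt => /predU1P[<-|s0s]; first by exists (range iota); rewrite ?dist_iota_expR.
apply: (intermediate_surj cK gt pr_p vp nt Ik); first exact: expR_gt0.
by rewrite dist_iota_expR ltr_expR ltrN2.
Qed.

Lemma exists_log_value_between lo hi : lo < hi -> exists2 x, log_value v x & lo < x < hi.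
Proof.
move=> lohi; have [z /andP[z1 z2]] :=
  exists_value_between gt nt r0 (expR_gt0 lo) (ltac:(by rewrite ltr_expR) : expR lo < expR hi).
have vz0 : 0 < v z by apply: lt_trans z1; exact: expR_gt0.
exists (ln (v z)); first by exists z; rewrite lnK.
by rewrite -ltr_expR -(ltr_expR (ln _)) lnK ?posrE // z1.
Qed.

Section Step.
Variables (g : R -> R) (j : int) (L : R).
Hypothesis pL : v p%:R <= expR (- L).
Hypothesis ginc : forall x y, s0 <= x -> x < y -> g x < g y.

(** The bend takes place on the values: it starts at [g s], has length [P ^ j * (s' - s)] and
    multiplies the slope by [P ^ (m - j)]. The field [F0] supplying the constants corresponds to a
    parameter [x0] slightly to the left of [s]. *)
Lemma straighten_step (m : int) (s s' M : R) (u : K) :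
  s0 < s -> s < s' -> log_value v s -> log_value v s' -> log_value v (g s) ->
  (forall eta, 0 < eta -> exists x, [/\ s0 < x, x < s & g s - eta < g x]) ->
  P ^ j * (s' - s) * Num.max 1 (P ^ (m - j)) < L ->
  (forall x, s <= x -> x <= s' -> g x = g s + P ^ m * (x - s)) ->
  M < g s -> realizes u (straighten j s g) ->
  exists2 u', v (u' - u) < expR (- M) & realizes u' (straighten j s' g).
Proof.
move=> s0s ss' Gs Gs' Ggs lc small lin Mg Ru.
have Pn0 : P != 0 by rewrite gt_eqF.
set eps := P ^ j * (s' - s) in small; set B := Num.max _ _ in small.
have eps0 : 0 <= eps by apply: mulr_ge0; [exact/ltW/Pz | rewrite subr_ge0 ltW].
(* The first margin serves the condition on [v p%:R], the second makes the correction smaller than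
   [exp (- M)]. *)
have [|x0 [s0x x0s gx0]] := lc (Num.min (L - eps * B) (g s - M)).
  by rewrite lt_min !subr_gt0 small.
have gl x : x <= s -> straighten j s g x = g x.
  by move=> xs; rewrite /straighten min_l // max_r ?subr_le0 // mulr0 addr0.
have [F0 IF0 F0t] := intermediate_exists (ltW s0x).
have full := intermediate_value_group cK gt IF0 Ik.
have {}full : forall x, exists2 y, F0 y & v y = v x.
  by apply: full; rewrite F0t dist_iota_expR ltr_expR ltrN2.
have F0u : dist F0 u = expR (- g x0) by rewrite (Ru _ _ IF0 F0t) gl // ltW.
have alt F : I F -> F0 `<=` F \/ expR (- g x0) <= dist F u.
  move=> IF; have [far|near] := leP (dist F0 t) (dist F t); last first.
    by left; exact: (intermediate_chain cK gt IF IF0).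
  right; have Ft0 : 0 < dist F t by apply: lt_le_trans far; rewrite F0t expR_gt0.
  have FE := expR_opp_ln Ft0; set x := - ln _ in FE.
  have xx0 : x <= x0 by rewrite -lerN2 -ler_expR -FE -F0t.
  rewrite (Ru _ _ IF FE) gl ?(le_trans xx0 (ltW x0s)) // ler_expR lerN2.
  move: xx0; rewrite le_eqVlt => /predU1P[->//|xx0].
  by apply/ltW/ginc => //; exact: intermediate_ge_s0 FE.
have [|||u' uu' u'P] := @bend_moves _ _ _ v iota p pr_p vp (m - j) F0 u (g x0) (g s) eps
  IF0 full eps0 Ggs _ _ _ F0u alt.
- by rewrite /eps mulrC; apply: log_valueMz => //; exact: log_valueB.
- by apply: ginc => //; exact: ltW.
- apply: (@le_lt_trans _ _ (expR (- L) * expR (- g x0))).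
    by rewrite ler_wpM2r ?expR_ge0.
  rewrite -expRD ltr_expR -/B; move: gx0.
  have : Num.min (L - eps * B) (g s - M) <= L - eps * B by rewrite ge_min lexx.
  lra.
exists u'.
  apply: lt_trans uu' _; rewrite ltr_expR ltrN2; move: gx0.
  have : Num.min (L - eps * B) (g s - M) <= g s - M by rewrite ge_min lexx orbT.
  lra.
move=> F x IF Fx; rewrite (u'P _ _ IF (Ru _ _ IF Fx)); congr (expR (- _)).
have s0x' := intermediate_ge_s0 IF Fx.
have [xs|sx] := leP x s.
  rewrite gl // bend_left //; last first.
    by move: xs; rewrite le_eqVlt => /predU1P[->//|xs]; exact/ltW/ginc.
  have xs' := le_trans xs (ltW ss').
  by rewrite /straighten min_l // max_r ?subr_le0 // mulr0 addr0.
have -> : straighten j s g x = g s + P ^ j * (x - s).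
  by rewrite /straighten min_r ?max_l ?subr_ge0 // ltW.
have PmE : P ^ m = P ^ (m - j) * P ^ j by rewrite -expfzDr // subrK.
have [xs'|s'x] := leP x s'.
  rewrite bend_middle; last first.
  - by rewrite lerD2l ler_pM2l ?Pz // lerD2r.
  - by rewrite lerDl mulr_ge0 ?subr_ge0 // ltW.
  rewrite /straighten min_l // max_r ?subr_le0 // mulr0 addr0 (lin x) ?(ltW sx) //.
  by rewrite PmE; ring.
rewrite bend_right //; last by rewrite lerD2l ler_pM2l ?Pz // lerD2r ltW.
rewrite /straighten min_r ?max_l ?subr_ge0 ?ltW // (lin s') ?lexx ?ltW //.
by rewrite PmE /eps; ring.
Qed.

Hypothesis L0 : 0 < L.
Hypothesis gloc : forall x, s0 < x -> exists eta m1 m2, [/\ 0 < eta,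
  forall y, x - eta < y -> y <= x -> g y = g x + P ^ m1 * (y - x),
  forall y, x <= y -> y < x + eta -> g y = g x + P ^ m2 * (y - x) &
  m1 = m2 \/ log_value v x].
Hypothesis gval : forall x, s0 < x -> log_value v x -> log_value v (g x).

Let gle x y : s0 <= x -> x <= y -> g x <= g y.
Proof. by move=> s0x; rewrite le_eqVlt => /predU1P[->//|/(ginc s0x)/ltW]. Qed.

Lemma straighten_left_limit s : s0 < s -> forall d, 0 < d ->
  exists x, [/\ s0 < x, x < s & g s - d < g x].
Proof.
move=> s0s d d0; have [eta [m1 [m2 [eta0 lin _ _]]]] := gloc s0s.
pose e := Num.min (Num.min eta (s - s0)) (d / P ^ m1) / 2.
have e0 : 0 < e by rewrite divr_gt0 // !lt_min eta0 subr_gt0 s0s divr_gt0.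
have eP z : Num.min (Num.min eta (s - s0)) (d / P ^ m1) <= z -> e < z.
  move=> ez; apply: lt_le_trans ez; rewrite ltr_pdivrMr // ltr_pMr ?ltr1n //.
  by rewrite !lt_min eta0 subr_gt0 s0s divr_gt0.
have e1 : e < eta by apply: eP; rewrite !ge_min lexx.
have e2 : e < s - s0 by apply: eP; rewrite !ge_min lexx orbT.
have e3 : P ^ m1 * e < d by rewrite mulrC -ltr_pdivlMr //; apply: eP; rewrite !ge_min lexx !orbT.
exists (s - e); split; [lra | lra |].
by rewrite (lin (s - e)); [lra | lra | lra].
Qed.

Lemma straighten_reach (a b M : R) (u : K) :
  s0 < a -> a <= b -> log_value v a -> M < g a -> realizes u (straighten j a g) ->
  exists s' u', [/\ b <= s', log_value v s', v (u' - u) < expR (- M) &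
    realizes u' (straighten j s' g)].
Proof.
move=> s0a ab Ga Mg Ru.
(* A segment can only end at a point of [ln|K^*|], so [Q y] asks for an endpoint [s'] at or beyond
   [y]. *)
pose Q y := exists s' u', [/\ y <= s' /\ a <= s', log_value v s', v (u' - u) < expR (- M) &
    realizes u' (straighten j s' g)].
suff : Q b by move=> [s' [u' [[? _] ? ? ?]]]; exists s', u'.
apply: (interval_induction ab); last first.
  by exists a, u; rewrite subrr absval0 expR_gt0.
move=> x ax xb; have s0x := lt_le_trans s0a ax.
have [eta0 [m1 [m2 [eta00 lin1 lin2 corner]]]] := gloc s0x.
(* With the resulting [eta], every segment inside the neighbourhood of [x] meets the length
   condition of [straighten_step] for both slopes. *)
pose B := P ^ j * (Num.max 1 (P ^ (m1 - j)) + Num.max 1 (P ^ (m2 - j))).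
have mx0 m : 0 < Num.max 1 (P ^ m) by rewrite lt_max ltr01.
have B0 : 0 < B by rewrite mulr_gt0 // addr_gt0.
pose eta := Num.min eta0 (L / B / 2).
have eta_gt0 : 0 < eta by rewrite lt_min eta00 !divr_gt0.
have eta_le : eta <= eta0 by rewrite ge_min lexx.
have etaB : 2 * eta * B <= L.
  rewrite -ler_pdivlMr // mulrC -ler_pdivlMr //.
  by rewrite ge_min lexx orbT.
exists eta => // y z ay yz zb xy zx [s1 [u1 [[ys1 as1] G1 uu1 R1]]].
have [zs1|s1z] := leP z s1; first by exists s1, u1.
have up q : q < x + eta -> q < x + eta0.
  by move=> h; apply: lt_le_trans h _; rewrite lerD2l.
have dn q : x - eta < q -> x - eta0 < q.
  by move=> h; apply: le_lt_trans h; rewrite lerD2l lerN2.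
have step s2 s3 m u2 : x - eta < s2 -> a <= s2 -> s2 < s3 -> s3 < x + eta ->
    m = m1 \/ m = m2 -> log_value v s2 -> log_value v s3 -> v (u2 - u) < expR (- M) ->
    (forall w, s2 <= w -> w <= s3 -> g w = g s2 + P ^ m * (w - s2)) ->
    realizes u2 (straighten j s2 g) ->
    exists2 u3, v (u3 - u) < expR (- M) & realizes u3 (straighten j s3 g).
  move=> xs2 as2 s23 s3x mE Gs2 Gs3 uu2 lin Ru2; have s0s2 := lt_le_trans s0a as2.
  have [||u3 u32 R3] := @straighten_step m s2 s3 M u2 s0s2 s23 Gs2 Gs3 (gval s0s2 Gs2)
    (straighten_left_limit s0s2) _ lin _ Ru2.
  - apply: lt_le_trans etaB.
    have h : P ^ j * (s3 - s2) < P ^ j * (2 * eta) by rewrite ltr_pM2l //; lra.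
    apply: (@lt_le_trans _ _ (P ^ j * (2 * eta) * Num.max 1 (P ^ (m - j)))).
      by rewrite ltr_pM2r.
    have -> : P ^ j * (2 * eta) * Num.max 1 (P ^ (m - j)) =
        2 * eta * (P ^ j * Num.max 1 (P ^ (m - j))) by ring.
    rewrite ler_pM2l ?mulr_gt0 // /B ler_pM2l //.
    by case: mE => ->; rewrite ?lerDl ?lerDr ltW.
  - by apply: lt_le_trans Mg _; apply: gle => //; exact: ltW.
  by exists u3; first exact: absval_tri_lt u32 uu2.
have right s2 u2 : x <= s2 -> a <= s2 -> s2 < z -> log_value v s2 ->
    v (u2 - u) < expR (- M) -> realizes u2 (straighten j s2 g) -> Q z.
  move=> xs2 as2 s2z Gs2 uu2 R2.
  have [s3 G3 /andP[zs3 s3x]] := exists_log_value_between zx.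
  have [||||u3 uu3 R3] := step s2 s3 m2 u2 _ as2 _ _ (or_intror erefl) Gs2 G3 uu2 _ R2.
  - lra.
  - lra.
  - lra.
  - move=> w s2w ws3; rewrite (lin2 w) ?(lin2 s2) ?(le_trans xs2 s2w) ?up //; first ring.
      exact: lt_trans s2z zx.
    exact: le_lt_trans ws3 s3x.
  by exists s3, u3; split => //; split; lra.
have [xs1|s1x] := leP x s1; first exact: (right s1 u1).
have xs1' : x - eta < s1 by exact: lt_le_trans ys1.
(* A corner is an admissible endpoint, and the step stops there to change slope. Without a corner,
   one segment passes over [x], which need not be admissible. *)
case: corner => [m12|Gx]; last first.
  have [|||u2 uu2 R2] := step s1 x m1 u1 _ as1 s1x _ (or_introl erefl) G1 Gx uu1 _ R1.
  - lra.
  - lra.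
  - move=> w s1w wx; rewrite (lin1 w) ?(lin1 s1) ?(ltW s1x) ?dn //; first ring.
    exact: lt_le_trans xs1' s1w.
  have [zx'|xz] := leP z x; first by exists x, u2.
  exact: (right x u2).
have [s3 G3 /andP[zs3 s3x]] := exists_log_value_between zx.
have lin w : x - eta < w -> w < x + eta -> g w = g x + P ^ m1 * (w - x).
  move=> h1 h2; have [wx|/ltW xw] := leP w x; first by apply: lin1 => //; lra.
  by rewrite m12; apply: lin2 => //; lra.
have [|||u3 uu3 R3] := step s1 s3 m1 u1 _ as1 _ s3x (or_introl erefl) G1 G3 uu1 _ R1.
- lra.
- lra.
- move=> w s1w ws3; rewrite (lin w) ?(lin s1) //; first ring.
  + exact: lt_trans s1z zx.
  + exact: lt_le_trans xs1' s1w.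
  + exact: le_lt_trans ws3 s3x.
by exists s3, u3; split => //; split; lra.
Qed.

Hypothesis gunb : forall A, exists2 x, s0 < x & A < g x.

Lemma straighten_limit (a M : R) (u : K) :
  s0 < a -> log_value v a -> M < g a -> realizes u (straighten j a g) ->
  exists2 t', v (t' - u) <= expR (- M) & realizes t' g.
Proof.
move=> s0a Ga Mg Ru.
(* With this [d] the correction made at [a] is below [exp (- M)]; the later ones, below
   [exp (- (g s - d))] at the current endpoint [s], tend to 0 because [g] is unbounded. *)
pose d := g a - M; have d0 : 0 < d by rewrite subr_gt0.
pose good (x : R * K) := [/\ s0 < x.1, log_value v x.1 & realizes x.2 (straighten j x.1 g)].
have /choice [f fP] : forall ny : nat * (R * K), exists y' : R * K, good ny.2 ->
    [/\ good y', ny.2.1 <= y'.1, ny.1%:R < g y'.1 &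
      v (y'.2 - ny.2.2) < expR (- (g ny.2.1 - d))].
  move=> [n [s w]] /=; have [[/= s0s Gs Rw]|no] := pselect (good (s, w)); last by exists (s, w).
  have [x s0x nx] := gunb n%:R.
  have [||s' [w' [bs' Gs' ww' R']]] := @straighten_reach s (Num.max s x) (g s - d) w s0s _ Gs _ Rw.
  - by rewrite le_max lexx.
  - by rewrite gtrBl.
  move: bs'; rewrite ge_max => /andP[ss' xs'].
  exists (s', w') => _; split => //=; first by split => //=; exact: lt_le_trans ss'.
  by apply: lt_le_trans nx _; apply: gle => //; exact: ltW.
pose x := fix x n := if n is m.+1 then f (m, x m) else (a, u).
have gx n : good (x n) by elim: n => [//|n IH] /=; have [] := fP (n, x n) IH.
have xS n : [/\ (x n).1 <= (x n.+1).1, n%:R < g (x n.+1).1 &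
    v ((x n.+1).2 - (x n).2) < expR (- (g (x n).1 - d))].
  by have [] := fP (n, x n) (gx n).
pose e n := expR (- (g (x n).1 - d)).
have [|||l lP] := @complete_steps _ _ v (fun n => (x n).2) e cK.
- by move=> n; have [_ _ /ltW] := xS n.
- move=> n; rewrite /e ler_expR lerN2 lerD2r; apply: gle; last by case: (xS n).
  by have [/ltW] := gx n.
- move=> h h0; pose n := (Num.truncn (- ln h + d)).+1.
  have nh : - ln h + d < n%:R by exact: truncnS_gt.
  exists n.+1; rewrite /e -[ltRHS]lnK // ltr_expR.
  have [_ ng _] := xS n; lra.
exists l.
  by rewrite absvalBC; have := lP 0%N; rewrite /e /= /d subKr.
move=> F s IF Fs; have s0s := intermediate_ge_s0 IF Fs.
(* From index [n.+1] on, the corrections are smaller than [exp (- g s)], the distance that they must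
   preserve. *)
pose n := (Num.truncn (g s + d)).+1.
have ns : g s + d < n%:R by exact: truncnS_gt.
have [_ ng _] := xS n.
have sx : s <= (x n.+1).1.
  rewrite leNgt; apply/negP => xs; have [/ltW h _ _] := gx n.+1.
  have := ginc h xs; lra.
have [_ _ Rx] := gx n.+1.
have uE : dist F (x n.+1).2 = expR (- g s).
  rewrite (Rx _ _ IF Fs) /straighten min_l // max_r ?subr_le0 //.
  by rewrite mulr0 addr0.
rewrite -uE; apply: inf_dist_near; first exact: intermediate_nonempty IF.
rewrite uE; apply: le_lt_trans (lP n.+1) _; rewrite /e ltr_expR ltrN2.
lra.
Qed.

End Step.
End Realization.

(** * Topologically algebraic generators *)

Section AlgebraicClosure.
Variables (K : closedFieldType) (F : set K) (hF : subfield F).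

Lemma algebraic_overP x :
  algebraic_over F x <-> algebraicOver (val : subfield_type hF -> K) x.
Proof.
split=> [[q [qF q0 qx]]|[q q0 qx]].
  have [q' qE] := subfield_type_poly hF (iffRL (subfield_poly hF q) qF).
  by exists q'; rewrite -?qE //; apply: contraNneq q0 => q'0; rewrite qE q'0 rmorph0.
exists (map_poly val q); split; rewrite ?map_poly_eq0 //.
by apply/(subfield_poly hF) => i; rewrite coef_map; exact: subfield_type_mem.
Qed.

Lemma subset_algebraic_over : F `<=` algebraic_over F.
Proof.
move=> x Fx; apply/algebraic_overP; have [y <-] := subfield_type_surj hF Fx.
exact: algebraic_id.
Qed.

Lemma algebraic_over_subfield : subfield (algebraic_over F).
Proof.
split=> [|x y|x y]; rewrite !in_setE.
- by apply: subset_algebraic_over; exact: subfield1.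
- by move=> /algebraic_overP ax /algebraic_overP ay; apply/algebraic_overP; exact: algebraic_sub.
- by move=> /algebraic_overP ax /algebraic_overP ay; apply/algebraic_overP; exact: algebraic_div.
Qed.

Lemma algebraic_over_alg_closed : alg_closed_in (algebraic_over F).
Proof.
move=> q qF sq; have [x qx] := closed_root sq; exists x => //.
apply/algebraic_overP/integral_algebraic.
have q0 : q != 0 by rewrite -size_poly_gt0 (leq_trans _ sq).
apply: (integral_root q0 qx).
move: qF; rewrite qualifE /= => /allP qF z /qF; rewrite in_setE => az.
by move/algebraic_overP/integral_algebraic: az.
Qed.

End AlgebraicClosure.

Section Generator.
Variables (R : realType) (k K : closedFieldType) (v : absval R K).
Variables (iota : {rmorphism k -> K}).
Hypothesis cK : complete_in v [set: K].
Local Notation I := (intermediate v iota).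

Lemma adjoin_subfield x : subfield (adjoin iota x).
Proof.
have ev (q1 q2 : {poly k}) : adjoin iota x ((map_poly iota q1).[x] / (map_poly iota q2).[x]).
  by exists q1, q2.
have evM (q1 q2 : {poly k}) : (map_poly iota (q1 * q2)).[x] =
    (map_poly iota q1).[x] * (map_poly iota q2).[x] by rewrite rmorphM hornerM.
have evB (q1 q2 : {poly k}) : (map_poly iota (q1 - q2)).[x] =
    (map_poly iota q1).[x] - (map_poly iota q2).[x] by rewrite rmorphB hornerD hornerN.
split=> [|y z|y z]; rewrite !in_setE.
- by have := ev 1 1; rewrite rmorph1 hornerC divr1.
- move=> [a [b ->]] [c [d ->]].
  have [b0|b0] := eqVneq (map_poly iota b).[x] 0.
    rewrite b0 invr0 mulr0 sub0r -mulNr -hornerN -rmorphN; exact: ev.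
  have [d0|d0] := eqVneq (map_poly iota d).[x] 0.
    rewrite d0 invr0 mulr0 subr0; exact: ev.
  have -> : (map_poly iota a).[x] / (map_poly iota b).[x] -
      (map_poly iota c).[x] / (map_poly iota d).[x] =
      (map_poly iota (a * d - c * b)).[x] / (map_poly iota (b * d)).[x].
    by rewrite evB !evM; field; rewrite b0 d0.
  exact: ev.
- move=> [a [b ->]] [c [d ->]]; have := ev (a * d) (b * c).
  by rewrite !evM !invfM invrK mulrACA (mulrC (map_poly iota d).[x]).
Qed.

Lemma adjoin_iota x c : adjoin iota x (iota c).
Proof. by exists c%:P, 1; rewrite map_polyC hornerC rmorph1 hornerC divr1. Qed.

Lemma adjoin_self x : adjoin iota x x.
Proof. by exists 'X, 1; rewrite map_polyX hornerX rmorph1 hornerC divr1. Qed.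

Definition ta_closure (x : K) : set K :=
  [set y | forall e, 0 < e -> exists2 z, algebraic_over (adjoin iota x) z & v (y - z) <= e].

(* The closure is the field of limits, along a trivial ultrafilter, of the
   constant sequence of isometries [id]. *)
Lemma ta_closure_intermediate x : I (ta_closure x).
Proof.
have hA := adjoin_subfield x.
have -> : ta_closure x = ultra_limits v (algebraic_over (adjoin iota x))
    (principal_filter 0%N) (fun=> idfun).
  by apply/seteqP; split=> y h e e0; have [z Az yz] := h e e0; exists z => //;
    move/principal_filterP: yz.
apply: ultra_limits_intermediate => //.
- exact: algebraic_over_subfield.
- exact: algebraic_over_alg_closed.
- by move=> _ [c _ <-]; apply: subset_algebraic_over => //; exact: adjoin_iota.
- exact: principal_filter_ultra.
Qed.

Lemma ta_closure_self x : ta_closure x x.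
Proof.
move=> e e0; exists x; last by rewrite subrr absval0 ltW.
apply: subset_algebraic_over; first exact: adjoin_subfield.
exact: adjoin_self.
Qed.

Lemma ta_generator_of_full x : (forall y, ta_closure x y) -> ta_generator v iota x.
Proof.
move=> full y e e0; have [|z Az yz] := full y (e / 2); first by rewrite divr_gt0.
exists z => //; apply: le_lt_trans yz _.
by rewrite ltr_pdivrMr // ltr_pMr // ltr1n.
Qed.

End Generator.

(** * Initial elements *)

Section Initial.
Variables (R : realType) (k K : closedFieldType) (vk : absval R k) (v : absval R K).
Variables (iota : {rmorphism k -> K}) (t : K) (p : nat).
Hypothesis iso : forall c, v (iota c) = vk c.
Hypothesis pr_p : prime p.
Hypothesis vp : v p%:R < 1.
Hypothesis Ik : intermediate v iota (range iota).
Hypothesis r0 : 0 < inf_dist v (range iota) t.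
Local Notation I := (intermediate v iota).
Local Notation dist := (inf_dist v).
Local Notation P := (p%:R : R).
Let s0 : R := - ln (dist (range iota) t).

Let P2 : 2 <= P. Proof. by rewrite ler_nat prime_gt1. Qed.
Let P0 : 0 < P. Proof. by apply: lt_le_trans P2. Qed.
Let Pz (m : int) : 0 < P ^ m. Proof. by rewrite exprz_gt0. Qed.
Let Pn0 : P != 0. Proof. by rewrite gt_eqF. Qed.
Let p0 := prime_gt0 pr_p.
Let p1 := prime_gt1 pr_p.
Let pE : p = p.-1.+1. Proof. by rewrite prednK. Qed.
Let P1E : p.-1%:R = P - 1. Proof. by rewrite [in RHS]pE -natr1 addrK. Qed.

Lemma log_profile_inj (kap : R) : injective (log_profile p kap).
Proof.
have lt a b : a < b -> log_profile p kap a < log_profile p kap b.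
  by move=> ab; rewrite /log_profile lt_min !gt_min ltr_pM2l // ab ltrD2r ab orbT.
move=> x y E; have [xy|yx|//] := ltgtP x y.
  by have := lt _ _ xy; rewrite E ltxx.
by have := lt _ _ yx; rewrite E ltxx.
Qed.

Lemma log_value_iota x : log_value vk x -> exists2 b, range iota b & v b = expR x.
Proof. by move=> [z zE]; exists (iota z); [exists z | rewrite iso]. Qed.

Lemma realizes_ext u (f f' : R -> R) : (forall s, s0 <= s -> f s = f' s) ->
  realizes v iota t u f -> realizes v iota t u f'.
Proof.
move=> ff' Ru F s IF Fs; rewrite -ff'; first exact: Ru.
exact: (intermediate_ge_s0 r0 IF Fs).
Qed.

Lemma realizes_scale u (f : R -> R) a : a != 0 -> realizes v iota t u f ->
  realizes v iota t (iota a * u) (fun s => f s - ln (vk a)).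
Proof.
move=> a0 Ru F s IF Fs.
have hF := intermediate_subfield IF; have Fa := intermediate_iota a IF.
rewrite (inf_dist_scale _ _ hF Fa) ?fmorph_eq0 // (Ru _ _ IF Fs) iso.
by rewrite opprB expRD lnK // posrE absval_gt0.
Qed.

Lemma inf_dist_profile F w b c : I F -> range iota b -> range iota c ->
  v p%:R * v (w - c) ^+ p.-1 < v b ->
  dist F ((w - c) ^+ p - b * (w - c)) = Num.max (dist F w ^+ p) (v b * dist F w).
Proof.
move=> IF [b' _ bE] [c' _ cE] h.
have [hF aF] := (intermediate_subfield IF, intermediate_alg_closed IF).
have Fb : F b by rewrite -bE; exact: (intermediate_iota _ IF).
have Fc : F c by rewrite -cE; exact: (intermediate_iota _ IF).
by rewrite -(inf_dist_shift v w hF Fc); exact: inf_dist_artin_schreier.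
Qed.

Section NontrivialBase.
Variables (c0 s1 : R).
Hypothesis s01 : s0 < s1.
Hypothesis Gs1 : log_value vk (s1 + c0).

(** The profile after [n] applications of [w |-> w^p - b w], or of its inverse if [n < 0]: slope
    [P ^ n] up to [s1], then 1. Letting the corner of [log_profile] follow the image of [s1] keeps a
    single corner, and [Gs1] provides the constants in [k]. *)
Definition start (n : int) (s : R) : R :=
  P ^ n * (Num.min s s1 + c0) + Num.max (s - s1) 0.

Lemma log_profile_start n s :
  log_profile p (P ^ n * (s1 + c0)) (start n s) = start (n + 1) s.
Proof.
have PS : P ^ (n + 1) = P * P ^ n by rewrite expfzDr // expr1z mulrC.
rewrite /start PS /log_profile; have [ss1|s1s] := leP s s1.
  rewrite max_r ?subr_le0 // !addr0.
  have h : P ^ n * (s + c0) <= P ^ n * (s1 + c0) by rewrite ler_pM2l // lerD2r.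
  rewrite min_l ?mulrA //.
  have : 0 <= (P - 1) * (P ^ n * (s1 + c0) - P ^ n * (s + c0)).
    by rewrite mulr_ge0 ?subr_ge0 // (le_trans _ P2) // ler1n.
  lra.
rewrite max_l ?subr_ge0 ?(ltW s1s) // min_r; first by ring.
have : 0 <= (P - 1) * (s - s1).
  by rewrite mulr_ge0 ?subr_ge0 ?(ltW s1s) // (le_trans _ P2) // ler1n.
lra.
Qed.

Variable L : R.
Hypothesis pL : v p%:R <= expR (- L).

Lemma start_s0 n : start n s0 = P ^ n * (s0 + c0).
Proof. by rewrite /start min_l ?(ltW s01) // max_r ?subr_le0 ?(ltW s01) // addr0. Qed.

Lemma near_constant w n eta : realizes v iota t w (start n) -> 0 < eta ->
  exists c, [/\ range iota c, v (w - c) < expR (- (P ^ n * (s0 + c0)) + eta) &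
    expR (- (P ^ n * (s0 + c0))) <= v (w - c)].
Proof.
move=> Rw eta0.
have wE : dist (range iota) w = expR (- (P ^ n * (s0 + c0))).
  by rewrite -start_s0; apply: Rw => //; exact: dist_iota_expR.
have [||c rc wc] := @inf_dist_lt _ _ v (range iota) w (expR (- (P ^ n * (s0 + c0)) + eta)).
- by exists (iota 0), 0.
- by rewrite wE ltr_expR ltrDl.
by exists c; split => //; rewrite -wE; exact: inf_dist_le.
Qed.

Lemma start_up w n : realizes v iota t w (start n) -> (P - 1) * (P ^ n * (s1 - s0)) < L ->
  exists w', realizes v iota t w' (start (n + 1)).
Proof.
move=> Rw small; pose kap := P ^ n * (s1 + c0).
have [b rb bE] : exists2 b, range iota b & v b = expR (- ((P - 1) * kap)).
  apply/log_value_iota/log_valueN; rewrite -P1E mulrC; apply: log_valueMn.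
  by rewrite /kap mulrC; exact: log_valueMz.
have P1 : 0 < P - 1 by have := P2; lra.
(* The distance from [w] to [k] need not be attained; [eta] spends half of the slack in [small] on
   approaching it. *)
pose eta := (L - (P - 1) * (P ^ n * (s1 - s0))) / (P - 1) / 2.
have eta0 : 0 < eta by rewrite !divr_gt0 // subr_gt0.
have [c [rc wc _]] := near_constant Rw eta0.
have etaE : (P - 1) * eta < L - (P - 1) * (P ^ n * (s1 - s0)).
  rewrite /eta mulrA (mulrC (P - 1)) divfK ?gt_eqF // ltr_pdivrMr // ltr_pMr ?ltr1n //.
  by rewrite subr_gt0.
have pb : v p%:R * v (w - c) ^+ p.-1 < v b.
  rewrite bE; apply: (@le_lt_trans _ _ (expR (- L) *
      expR (- (P ^ n * (s0 + c0)) + eta) ^+ p.-1)).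
    apply: ler_pM; rewrite ?exprn_ge0 ?absval_ge0 //.
    by rewrite lerXn2r ?nnegrE ?absval_ge0 ?expR_ge0 // ltW.
  rewrite -expRM_natr -expRD ltr_expR P1E /kap; lra.
exists ((w - c) ^+ p - b * (w - c)) => F s IF Fs.
rewrite inf_dist_profile // (Rw _ _ IF Fs).
by rewrite (max_expR_profile bE (erefl _)) log_profile_start.
Qed.

(** Here [w^p - b w = u - c] is solved for [w], whose profile is recovered from that of [u] because
    [log_profile] is injective. *)
Lemma start_down u n : realizes v iota t u (start (n + 1)) ->
  (P - 1) * (P ^ (n + 1) * (s1 - s0)) < L ->
  exists w, realizes v iota t w (start n).
Proof.
move=> Ru small; pose kap := P ^ n * (s1 + c0).
have [b rb bE] : exists2 b, range iota b & v b = expR (- ((P - 1) * kap)).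
  apply/log_value_iota/log_valueN; rewrite -P1E mulrC; apply: log_valueMn.
  by rewrite /kap mulrC; exact: log_valueMz.
have P1 : 0 < P - 1 by have := P2; lra.
have PS : P ^ (n + 1) = P * P ^ n by rewrite expfzDr // expr1z mulrC.
pose eta := (L - (P - 1) * (P ^ (n + 1) * (s1 - s0))) / (P - 1) / 2.
have eta0 : 0 < eta by rewrite !divr_gt0 // subr_gt0.
have [c [rc uc cu]] := near_constant Ru eta0.
have etaE : (P - 1) * eta < L - (P - 1) * (P ^ (n + 1) * (s1 - s0)).
  rewrite /eta mulrA (mulrC (P - 1)) divfK ?gt_eqF // ltr_pdivrMr // ltr_pMr ?ltr1n //.
  by rewrite subr_gt0.
set x := u - c in uc cu.
have [w wx] := exists_trinomial_root b x p1.
have wp : w ^+ p = x + b * w by rewrite -wx subrK.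
have bp : v b ^+ p = expR (- ((P - 1) * (P ^ (n + 1) * (s1 + c0)))).
  by rewrite bE -expRM_natr PS /kap; congr expR; ring.
have wX : v w ^+ p = v x.
  apply: absval_trinomial_root wp _ => //; rewrite bp.
  apply: (@lt_le_trans _ _ (expR (- (P ^ (n + 1) * (s0 + c0))) ^+ p.-1)).
    rewrite -expRM_natr ltr_expR P1E mulNr ltrN2 mulrC ltr_pM2l //.
    by rewrite ltr_pM2l // ltrD2r.
  by rewrite lerXn2r ?nnegrE ?expR_ge0 ?absval_ge0.
have pb : v p%:R * v w ^+ p.-1 < v b.
  rewrite -(@ltr_pXn2r _ p) ?nnegrE ?mulr_ge0 ?exprn_ge0 ?absval_ge0 //.
  rewrite exprMn exprAC wX bp.
  apply: (@le_lt_trans _ _ (expR (- L) * expR (- (P ^ (n + 1) * (s0 + c0)) + eta) ^+ p.-1)).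
    apply: ler_pM; rewrite ?exprn_ge0 ?absval_ge0 //.
      apply: le_trans pL; have -> : v p%:R ^+ p = v p%:R * v p%:R ^+ p.-1 by rewrite -exprS -pE.
      by rewrite ler_piMr ?absval_ge0 // exprn_ile1 ?absval_ge0 ?ltW.
    by rewrite lerXn2r ?nnegrE ?absval_ge0 ?expR_ge0 // ltW.
  rewrite -expRM_natr -expRD ltr_expR P1E; lra.
exists w => F s IF Fs.
have uE : dist F u = Num.max (dist F w ^+ p) (v b * dist F w).
  have := @inf_dist_profile F w b 0 IF rb; rewrite !subr0 wx => <- //; last by exists 0;
    rewrite ?rmorph0.
  rewrite inf_dist_shift //; first exact: intermediate_subfield IF.
  by case: rc => c' _ <-; exact: (intermediate_iota _ IF).
have rho0 : 0 < dist F w.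
  rewrite lt_def inf_dist_ge0 andbT; apply/eqP => rho0; move: uE.
  rewrite (Ru _ _ IF Fs) rho0 mulr0 expr0n gtn_eqF //= maxxx => /eqP.
  by rewrite gt_eqF ?expR_gt0.
have yE := expR_opp_ln rho0; rewrite yE; congr (expR (- _)).
apply: (@log_profile_inj kap); apply: oppr_inj; apply: expR_inj.
by rewrite -(max_expR_profile bE yE) -uE (Ru _ _ IF Fs) log_profile_start.
Qed.

Lemma start_exists u0 n : realizes v iota t u0 (fun s => s + c0) ->
  (P - 1) * (Num.max 1 (P ^ n) * (s1 - s0)) < L ->
  exists u, realizes v iota t u (start n).
Proof.
move=> R0 small.
have P1 : 0 < P - 1 by have := P2; lra.
have small' i : P ^ i <= Num.max 1 (P ^ n) -> (P - 1) * (P ^ i * (s1 - s0)) < L.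
  move=> iB; apply: le_lt_trans small; rewrite ler_pM2l // ler_pM2r ?subr_gt0 //.
have base : exists u, realizes v iota t u (start 0).
  exists u0; apply: realizes_ext R0 => s _; rewrite /start expr0z mul1r.
  by have [ss1|s1s] := leP s s1; [rewrite max_r ?subr_le0 // addr0
    | rewrite max_l ?subr_ge0 ?(ltW s1s) //; ring].
case: n small small' => n small small'.
  have H m : (m <= n)%N -> exists u, realizes v iota t u (start m).
    elim: m => [//|m IH] mn; have [|u Ru] := IH; first exact: ltnW.
    rewrite -addn1 PoszD; apply: start_up Ru _; apply: small'.
    rewrite le_max; apply/orP; right.
    by rewrite -!exprnP ler_weXn2l ?(ltnW mn) // (le_trans _ P2) // ler1n.
  exact: H.
have H m : (m <= n.+1)%N -> exists u, realizes v iota t u (start (- m%:Z)).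
  elim: m => [|m IH] mn; first by rewrite oppr0.
  have [|u Ru] := IH; first exact: ltnW.
  apply: (@start_down u); first by rewrite -addn1 PoszD opprD subrK.
  apply: small'; rewrite -addn1 PoszD opprD subrK le_max; apply/orP; left.
  by rewrite -exprnN invf_le1 ?exprn_gt0 // exprn_ege1 // (le_trans _ P2) // ler1n.
by rewrite NegzE; exact: H.
Qed.

End NontrivialBase.

Section TrivialBase.
Hypothesis p_eq0 : v p%:R = 0.

Lemma inf_dist_expp_char F x : I F -> dist F (x ^+ p) = dist F x ^+ p.
Proof.
move=> IF; have [hF aF] := (intermediate_subfield IF, intermediate_alg_closed IF).
apply/eqP; rewrite eq_le inf_dist_expp_ge // andbT.
apply: le_trans (inf_dist_expp_le _ pr_p _ hF) _.
by rewrite p_eq0 !mul0r max_l ?exprn_ge0 ?inf_dist_ge0.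
Qed.

Lemma realizes_frobenius u0 (f : R -> R) (n : int) : realizes v iota t u0 f ->
  exists u, realizes v iota t u (fun s => P ^ n * f s).
Proof.
move=> R0; case: n => n.
  exists (u0 ^+ (p ^ n)) => F s IF Fs; elim: n => [|n IH].
    by rewrite expn0 expr1 expr0z mul1r; exact: R0.
  rewrite expnSr exprM inf_dist_expp_char // IH -expRM_natr -!exprnP exprSr.
  by congr expR; ring.
elim: n => [|n [u Ru]].
  have [u uE] := exists_nth_root u0 p0; exists u => F s IF Fs.
  apply: (pexpIrn p0); rewrite ?nnegrE ?inf_dist_ge0 ?expR_ge0 //.
  rewrite -inf_dist_expp_char // uE -expRM_natr (R0 _ _ IF Fs).
  by congr expR; rewrite NegzE -exprnN expr1; field.
have [w wE] := exists_nth_root u p0; exists w => F s IF Fs.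
apply: (pexpIrn p0); rewrite ?nnegrE ?inf_dist_ge0 ?expR_ge0 //.
rewrite -inf_dist_expp_char // wE -expRM_natr (Ru _ _ IF Fs).
congr expR; rewrite !NegzE -!exprnN [in RHS]exprS invfM.
by field; rewrite expf_neq0 Pn0.
Qed.

End TrivialBase.

Hypothesis gt : ta_generator v iota t.
Hypothesis nt : value_group v <> [set 1].

(* A nontrivially valued [k] supplies the constants of the moves
   [w |-> w^p - b w]; a trivially valued [k] has characteristic [p], and the
   Frobenius changes the slope everywhere at once. *)
Lemma exists_start u0 c0 (n : int) (del : R) : realizes v iota t u0 (fun s => s + c0) ->
  log_value v c0 -> 0 < del ->
  exists j s1 u, [/\ s0 < s1, s1 < s0 + del, log_value v s1 &
    realizes v iota t u (straighten p j s1 (fun s => P ^ n * (s + c0)))].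
Proof.
move=> R0 Gc0 del0.
have [[c [cn0 c1]]|triv] := pselect (exists c : k, c != 0 /\ vk c != 1); last first.
  (* A trivially valued [k] has no nonzero element of absolute value below 1, so [p] vanishes. *)
  have p_eq0 : v p%:R = 0.
    have [p_eq0|pn0] := eqVneq (p%:R : k) 0;
      first by rewrite -(rmorph_nat iota) p_eq0 rmorph0 absval0.
    case: triv; exists p%:R; split => //.
    by rewrite -iso rmorph_nat lt_eqF.
  have [s1 Gs1 /andP[s01 s1d]] := exists_log_value_between gt nt r0
    (ltac:(by rewrite ltrDl) : s0 < s0 + del).
  have [u Ru] := realizes_frobenius p_eq0 n R0.
  (* The slope stays [P ^ n] beyond [s1], so [j = n]; for a nontrivially valued [k] it returns to 1
     there, and [j = 0]. *)
  exists n, s1, u; split => //; apply: realizes_ext Ru => s _; rewrite /straighten.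
  have [ss1|s1s] := leP s s1; first by rewrite max_r ?subr_le0 // mulr0 addr0.
  by rewrite max_l ?subr_ge0 ?(ltW s1s) //; ring.
have [L L0 pL] := exists_expR_bound (absval_ge0 v _) vp.
pose B := (P - 1) * Num.max 1 (P ^ n).
have B0 : 0 < B by rewrite mulr_gt0 ?lt_max ?ltr01 //; have := P2; lra.
pose e := Num.min del (L / B).
have e0 : 0 < e by rewrite lt_min del0 divr_gt0.
have [x /andP[x1 x2]] := exists_absval_between cn0 c1 (expR_gt0 (s0 + c0))
  (ltac:(by rewrite ltr_expR ltrDl) : expR (s0 + c0) < expR (s0 + c0 + e)).
have vx0 : 0 < vk x by apply: lt_trans x1; exact: expR_gt0.
pose s1 := ln (vk x) - c0.
have Gs1 : log_value vk (s1 + c0) by exists x; rewrite subrK lnK.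
have s01 : s0 < s1 by rewrite ltrBrDr -ltr_expR lnK.
have s1e : s1 < s0 + e by rewrite ltrBlDr -ltr_expR lnK // addrAC.
have [|u Ru] := @start_exists _ _ s01 Gs1 L pL u0 n R0.
  rewrite mulrA -/B mulrC -ltr_pdivlMr //.
  have : e <= L / B by rewrite ge_min lexx orbT.
  lra.
exists 0, s1, u; split => //.
- by apply: lt_le_trans s1e _; rewrite lerD2l ge_min lexx.
- have [z _ zE] := log_value_iota Gs1.
  by rewrite -[s1](addrK c0); apply: log_valueB => //; exists z.
- by apply: realizes_ext Ru => s _; rewrite /start /straighten expr0z mul1r.
Qed.

End Initial.

(** * Distances of inverses and of powers with exponent a unit *)

Section Powers.
Variables (R : realType) (K : closedFieldType) (v : absval R K).
Variables (F : set K) (hF : subfield F) (aF : alg_closed_in F).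
Local Notation dist := (inf_dist v).

Let F0 : F !=set0. Proof. by exists 0; exact: subfield0. Qed.

(** If [|c| = |y|], then [|1/y - 1/c| = |y - c| / |y|^2]. This gives one inequality; the other is
    the same one for [x^-1]. *)
Lemma inf_distV x : x != 0 -> dist F x^-1 = dist F x / v x ^+ 2.
Proof.
have le y : y != 0 -> dist F y^-1 * v y ^+ 2 <= dist F y.
  move=> y0; have vy0 : 0 < v y by rewrite absval_gt0.
  apply: le_inf_dist => // c Fc; have [yc|yc] := ltP (v (y - c)) (v y); last first.
    apply: le_trans yc; rewrite expr2 mulrA ler_piMl ?absval_ge0 //.
    rewrite -ler_pdivlMr // mul1r -absvalV.
    by have := inf_dist_le v (y^-1) (subfield0 hF); rewrite subr0.
  have cy : v c = v y by apply: absval_eq_near; rewrite absvalBC.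
  have c0 : c != 0 by rewrite -(absval_gt0 v) cy.
  have -> : v (y - c) = v (y^-1 - c^-1) * v y ^+ 2.
    have -> : y^-1 - c^-1 = (c - y) / (y * c) by field; rewrite y0 c0.
    rewrite absvalM absvalV absvalM cy absvalBC; field; exact: lt0r_neq0.
  by rewrite ler_wpM2r ?exprn_ge0 ?absval_ge0 // inf_dist_le //; exact: subfieldV.
move=> x0; have vx0 : 0 < v x by rewrite absval_gt0.
have vx2 : 0 < v x ^+ 2 by rewrite exprn_gt0.
apply/eqP; rewrite eq_le ler_pdivlMr // le //=.
by have := le x^-1; rewrite invr_eq0 invrK absvalV exprVn; exact.
Qed.

(** The derivative of [X^n] at [x] has absolute value [|x|^(n-1)], so a Newton step finds an [n]-th
    root of [d], which lies in [F], within [|x^n - d| / |x|^(n-1)] of [x]. On the logarithmic scale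
    such a power is a mere translation. *)
Lemma inf_dist_expn x n : v n%:R = 1 -> x != 0 -> dist F (x ^+ n) = v x ^+ n.-1 * dist F x.
Proof.
move=> vn x0; have vx0 : 0 < v x by rewrite absval_gt0.
have n0 : (0 < n)%N by case: (n) vn => // /eqP; rewrite absval0 eq_sym oner_eq0.
have vxn : 0 < v x ^+ n.-1 by rewrite exprn_gt0.
have nE : v x ^+ n = v x ^+ n.-1 * v x by rewrite -exprSr prednK.
apply/eqP; rewrite eq_le; apply/andP; split.
  rewrite mulrC -ler_pdivrMr //; apply: le_inf_dist => // c Fc; rewrite ler_pdivrMr //.
  have [xc|cx] := leP (v (x - c)) (v x); last first.
    apply: (@le_trans _ _ (v x ^+ n)); last by rewrite nE mulrC ler_wpM2r ?ltW.
    by rewrite -absvalX; exact: inf_dist_le_absval.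
  have vc : v c <= v x.
    by rewrite -[c](subKr x); apply: absvalB_le.
  apply: le_trans (inf_dist_le _ _ (subfieldX hF n Fc)) _.
  rewrite subrXX absvalM ler_wpM2l ?absval_ge0 //; apply: absval_sum_le => [|i _].
    by rewrite ltW.
  have -> : v x ^+ n.-1 = v x ^+ (n.-1 - i) * v x ^+ i.
    by rewrite -exprD subnK // -ltnS prednK.
  rewrite absvalM !absvalX.
  by rewrite ler_wpM2l ?exprn_ge0 ?absval_ge0 // lerXn2r ?nnegrE ?absval_ge0.
apply: le_inf_dist => // d Fd; rewrite mulrC -ler_pdivlMr //.
apply/ler_addgt0Pr => e e0; have [|y qy yx] := @small_root_at _ _ v ('X^n - d%:P) x
    (v (x ^+ n - d) / v x ^+ n.-1 + e).
  rewrite derivB derivXn derivC subr0 !hornerE hornerMn hornerXn -mulr_natl.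
  by rewrite absvalM absvalX vn mul1r mulrDr mulrC divfK ?gt_eqF // ltrDl mulr_gt0.
apply: le_trans (ltW yx); rewrite absvalBC; apply: inf_dist_le.
have q0 : 'X^n - d%:P != 0 :> {poly K} by rewrite -size_poly_eq0 size_XnsubC.
apply: (alg_closed_roots hF aF _ q0 qy) => i.
rewrite coefB coefXn coefC; apply: subfieldB => //; first exact: subfield_nat.
by case: eqP => _ //; exact: subfield0.
Qed.

Lemma inf_dist_exprz x (b : int) : v b%:~R = 1 -> x != 0 ->
  dist F (x ^ b) = v x ^ (b - 1) * dist F x.
Proof.
move=> vb x0; have vx0 : v x != 0 by rewrite gt_eqF ?absval_gt0.
case: b vb => n vn.
  rewrite -exprnP inf_dist_expn //; case: n vn => [/eqP|n _];
    first by rewrite absval0 eq_sym oner_eq0.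
  by rewrite -addn1 PoszD addrK exprnP addn1.
rewrite NegzE -exprnN inf_distV ?expf_neq0 // inf_dist_expn //=; last first.
  by rewrite -absvalN -vn NegzE mulrNz.
rewrite -opprD -[X in - (X + 1)]/(n.+1%:Z) -PoszD addn1 -exprnN absvalX.
by rewrite !exprS; field; rewrite vx0 expf_neq0.
Qed.

End Powers.

(** * Recognition of generators, and the powers of [t - c] *)

Section Shape.
Variables (R : realType) (k K : closedFieldType) (vk : absval R k) (v : absval R K).
Variables (iota : {rmorphism k -> K}) (t : K) (p : nat).
Hypothesis cK : complete_in v [set: K].
Hypothesis iso : forall c, v (iota c) = vk c.
Hypothesis gt : ta_generator v iota t.
Hypothesis pr_p : prime p.
Hypothesis vp : v p%:R < 1.
Hypothesis r0 : 0 < inf_dist v (range iota) t.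
Local Notation I := (intermediate v iota).
Local Notation dist := (inf_dist v).
Let s0 : R := - ln (dist (range iota) t).

(** The closed field generated by [t'] is at distance 0 from [t']. Were its distance to [t]
    positive, [realizes] would make the distance to [t'] an exponential. Hence it contains [t] and
    is [K]. *)
Lemma realizes_generator t' (g : R -> R) : realizes v iota t t' g -> ta_generator v iota t'.
Proof.
move=> Rt'; have IF := ta_closure_intermediate iota cK t'.
have t'0 := inf_dist_mem v (ta_closure_self v iota t').
apply: ta_generator_of_full => y; apply: (generator_full gt) => //.
apply: (complete_inf_dist0 (v := v)).
- exact: intermediate_nonempty IF.
- exact: intermediate_complete IF.
apply/eqP; rewrite eq_le inf_dist_ge0 andbT leNgt; apply/negP => Ft.
have := Rt' _ _ IF (expR_opp_ln Ft); rewrite t'0 => /eqP.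
by rewrite lt_eqF ?expR_gt0.
Qed.

Lemma absval_coprime n : coprime n p -> v n%:R = 1.
Proof.
move=> np; apply/eqP; rewrite eq_le absval_nat_le1 leNgt; apply/negP => vn.
have n0 : (0 < n)%N.
  by case: (n) np => //; rewrite /coprime gcd0n gtn_eqF // prime_gt1.
have [a b abE _] := egcdnP p n0.
have : v (a * n)%:R < 1.
  by rewrite natrM absvalM (le_lt_trans _ vn) // ler_piMl ?absval_ge0 ?absval_nat_le1.
rewrite abE (eqP np) natrD absvalDr absval1 ?ltxx //.
by rewrite natrM absvalM (le_lt_trans _ vp) // ler_piMl ?absval_ge0 ?absval_nat_le1.
Qed.

Lemma absval_intr (b : int) : ~~ (p%:Z %| b)%Z -> v b%:~R = 1.
Proof.
move=> pb; have cb : coprime `|b|%N p.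
  by rewrite coprime_sym prime_coprime // -(dvdzE p%:Z).
case: b pb cb => n _ cb; first exact: absval_coprime.
by rewrite NegzE mulrNz absvalN; exact: absval_coprime.
Qed.

(* When the infimum is not attained, every [v (t - c)] is [v (c - d)] for some
   [d], so that no new absolute value appears. *)
Lemma exists_nearest_point : value_group v <> value_group vk ->
  exists c, v (t - iota c) = dist (range iota) t.
Proof.
move=> neq; apply: contrapT => none; apply: neq.
have sub (a : R) : value_group vk a -> value_group v a.
  by move=> [c c0 <-]; exists (iota c); rewrite /= ?fmorph_eq0.
apply/seteqP; split=> // _ [x x0 <-].
have M a b : value_group vk a -> value_group vk b -> value_group vk (a * b).
  by move=> [c c0 <-] [d d0 <-]; exists (c * d); rewrite /= ?mulf_neq0 ?absvalM.
have V a b : value_group vk a -> value_group vk b -> value_group vk (a / b).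
  by move=> ? [d d0 <-]; apply: M => //; exists d^-1; rewrite /= ?invr_eq0 ?absvalV.
have [||n [n0 [a a0 aE]]] := @generator_values _ _ _ v iota t gt _ M V _ _ x x0.
- by move=> c c0; exists c => //; rewrite iso.
- move=> c; have ct : dist (range iota) t < v (t - iota c).
    rewrite lt_neqAle inf_dist_le ?andbT; last by exists c.
    by apply/eqP => E; apply: none; exists c.
  have [|_ [d _ <-] dt] := inf_dist_lt _ ct; first by exists (iota 0), 0.
  have cd : v (t - iota c) = v (iota (d - c)).
    apply/esym; apply: absval_eq_near; rewrite rmorphB.
    by rewrite opprB addrA subrK absvalBC.
  exists (d - c); last by rewrite cd iso.
  by rewrite /= -(fmorph_eq0 iota) -(absval_gt0 v) -cd (lt_trans r0).
have [b bn] := exists_nth_root a n0.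
have b0 : b != 0 by apply: contraNneq a0 => b0; rewrite -bn b0 expr0n gtn_eqF.
exists b => //; apply: (pexpIrn n0); rewrite ?nnegrE ?absval_ge0 //.
by rewrite -absvalX bn aE.
Qed.

(** With [x = t - c] and [|x| = r], the [b]-th power multiplies every distance by [r^(b-1)]. The
    translated profile takes the value [b s0] at [s0], as the endpoint condition prescribes. *)
Lemma realizes_power (b : int) : value_group v <> value_group vk -> ~~ (p%:Z %| b)%Z ->
  exists2 u, realizes v iota t u (fun s => s + (b%:~R - 1) * s0) &
    log_value v ((b%:~R - 1) * s0).
Proof.
move=> neq pb; have [c cE] := exists_nearest_point neq.
have rE : dist (range iota) t = expR (- s0) := expR_opp_ln r0.
set x := t - iota c in cE.
have x0 : x != 0 by rewrite -(absval_gt0 v) cE.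
have vxE : v x ^ (b - 1) = expR (- ((b%:~R - 1) * s0)).
  rewrite cE rE.
  have expz (a : R) (n : int) : expR a ^ n = expR (n%:~R * a).
    case: n => n; first by rewrite -exprnP -expRM_natl.
    by rewrite NegzE -exprnN -expRM_natl -expRN mulrNz mulNr.
  by rewrite expz rmorphB /= mulrN.
exists (x ^ b); last by exists (x ^ (1 - b)); rewrite -opprB absvalXz -invr_expz vxE -expRN opprK.
move=> F s IF Fs.
rewrite inf_dist_exprz ?absval_intr //; first last.
- exact: intermediate_alg_closed IF.
- exact: intermediate_subfield IF.
rewrite vxE (inf_dist_shift _ _ (intermediate_subfield IF) (intermediate_iota c IF)) Fs.
by rewrite -expRD; congr expR; ring.
Qed.

End Shape.

(** * Piecewise linear functions *)

Section PL.
Variables (R : realType) (p : nat) (G : set R) (s0 : R) (g : R -> R).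
Hypothesis p2 : (1 < p)%N.
Hypothesis gPL : PL_fun p G `[s0, +oo[ g.
Local Notation P := (p%:R : R).

Let P0 : 0 < P. Proof. by rewrite ltr0n ltnW. Qed.
Let Pz (m : int) : 0 < P ^ m. Proof. by rewrite exprz_gt0. Qed.

Let inI x : `[s0, +oo[%classic x <-> s0 <= x.
Proof. by rewrite /= in_itv /= andbT. Qed.

Lemma PL_continuous x e : s0 <= x -> 0 < e -> exists2 d, 0 < d &
  forall y, s0 <= y -> `|y - x| < d -> `|g y - g x| < e.
Proof.
move=> s0x e0; have [gc _] := gPL.
have /cvgrPdist_lt/(_ _ e0) := iffLR (subspace_continuousP _ _) gc x (iffRL (inI x) s0x).
rewrite near_withinE => /nbhs_ballP[d /= d0 dP]; exists d => // y s0y yx.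
by rewrite distrC; apply: (dP y) => //; [rewrite /ball /= distrC | exact/inI].
Qed.

Lemma affine_inj (m m' : int) (c c' y w : R) : y < w ->
  P ^ m' * y + c' = P ^ m * y + c -> P ^ m' * w + c' = P ^ m * w + c ->
  P ^ m' = P ^ m /\ c' = c.
Proof.
move=> yw h1 h2; have PE : P ^ m' = P ^ m.
  have wy : w - y != 0 by rewrite subr_eq0 gt_eqF.
  by apply: (mulIf wy); rewrite !mulrBr; lra.
by move: h1; rewrite PE => /addrI.
Qed.

Definition affine_near (h : R -> R) (x : R) (m : int) (c : R) : Prop :=
  exists2 d, 0 < d & forall y, `|y - x| < d -> h y = P ^ m * y + c.

(** Affine functions agreeing at two points coincide, so a germ propagates along an interval without
    corners. *)
Lemma affine_extend (h : R -> R) (a b : R) (m : int) (c : R) : a <= b ->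
  (forall x, a <= x -> x <= b -> exists m c, affine_near h x m c) ->
  affine_near h a m c -> affine_near h b m c.
Proof.
move=> ab loc; apply: (@interval_induction _ (fun x => affine_near h x m c)) => // x ax xb.
have [m' [c' [d d0 lin]]] := loc x ax xb; exists d => // y z _ yz _ xy zx [e e0 eP].
have yx : `|y - x| < d by rewrite ltr_distl; lra.
have mn0 : 0 < Num.min e (d + x - y) by rewrite lt_min e0; lra.
pose w := y + Num.min e (d + x - y) / 2.
have mne : Num.min e (d + x - y) <= e by rewrite ge_min lexx.
have mnd : Num.min e (d + x - y) <= d + x - y by rewrite ge_min lexx orbT.
have [|||PE cE] := @affine_inj m m' c c' y w.
- by rewrite /w ltrDl divr_gt0.
- by rewrite -lin // -eP // subrr normr0.
- by rewrite -lin ?eP // ltr_distl /w; lra.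
exists (Num.min (z - (x - d)) (x + d - z)); first by rewrite lt_min; lra.
move=> u; rewrite lt_min !ltr_distl => /andP[/andP[u1 u2] /andP[u3 u4]].
by rewrite lin ?PE ?cE // ltr_distl; lra.
Qed.

Lemma affine_interval (h : R -> R) (a b : R) : a < b ->
  (forall x, a < x -> x < b -> exists m c, G c /\ affine_near h x m c) ->
  exists (m : int) c, G c /\ forall z, a < z -> z < b -> h z = P ^ m * z + c.
Proof.
move=> ab loc; pose y0 := (a + b) / 2.
have ay0 : a < y0 by rewrite /y0; lra.
have y0b : y0 < b by rewrite /y0; lra.
have loc' x : a < x -> x < b -> exists m c, affine_near h x m c.
  by move=> ax xb; have [m [c [_ mcP]]] := loc x ax xb; exists m, c.
have [m [c [Gc y0P]]] := loc _ ay0 y0b; exists m, c; split => // z az zb.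
have [y0z|/ltW zy0] := leP y0 z.
  have [w w1 w2|//|d d0 dP] := @affine_extend h y0 z m c y0z.
    by apply: loc'; [exact: lt_le_trans w1 | exact: le_lt_trans zb].
  by apply: dP; rewrite subrr normr0.
have [m' [c' zP]] := loc' z az zb.
have [w w1 w2|//|d d0 dP] := @affine_extend h z y0 m' c' zy0.
  by apply: loc'; [exact: lt_le_trans w1 | exact: le_lt_trans y0b].
have [e e0 eP] := y0P; have mn0 : 0 < Num.min d e by rewrite lt_min d0.
have mnd : Num.min d e <= d by rewrite ge_min lexx.
have mne : Num.min d e <= e by rewrite ge_min lexx orbT.
have [|||PE cE] := @affine_inj m m' c c' y0 (y0 + Num.min d e / 2).
- by rewrite ltrDl divr_gt0.
- by rewrite -dP ?eP // subrr normr0.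
- by rewrite -dP ?eP // ltr_distl; lra.
by have [f f0 fP] := zP; rewrite fP ?PE ?cE // subrr normr0.
Qed.

Lemma PL_regular x : s0 <= x -> exists2 eta, 0 < eta & forall z, s0 < z -> z != x ->
  `|z - x| < eta -> exists m c, G c /\ affine_near g z m c.
Proof.
move=> s0x; have [_ [C [CI Cdisc Creg]]] := gPL.
have [|eta /= eta0 etaP] := (iffLR (nbhs_ballP _ _) (Cdisc x _)); first exact/inI.
exists eta => // z s0z zx0 zx.
have nC : ~ C z.
  by move=> Cz; move/eqP: zx0; apply; apply: etaP => //; rewrite /ball /= distrC.
have [|m [c [Gc near]]] := Creg z _ nC; first exact/inI/ltW.
have /nbhs_ballP[d /= d0 dP] := near.
exists m, c; split => //; exists (Num.min d (z - s0)); first by rewrite lt_min d0 subr_gt0.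
move=> y; rewrite lt_min => /andP[yz]; rewrite ltr_distl => /andP[y1 y2].
by apply: dP; [rewrite /ball /= distrC | apply/inI; lra].
Qed.

Lemma PL_limit (x : R) (m : int) (c : R) : s0 <= x ->
  (forall d, 0 < d -> exists y, [/\ s0 <= y, `|y - x| < d & g y = P ^ m * y + c]) ->
  g x = P ^ m * x + c.
Proof.
move=> s0x close; apply/eqP; rewrite -subr_eq0 -normr_le0; apply/ler_addgt0Pr => e e0.
have [d d0 dP] := PL_continuous s0x (divr_gt0 e0 (ltr0n R 2)).
have [|y [s0y yx gy]] := close (Num.min d (e / 2 / P ^ m)); first by rewrite lt_min d0 !divr_gt0.
move: yx; rewrite lt_min => /andP[/(dP _ s0y) h1].
rewrite ltr_pdivlMr // -[P ^ m as X in _ * X](gtr0_norm (Pz m)) -normrM mulrC => h2.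
have -> : g x - (P ^ m * x + c) = P ^ m * (y - x) - (g y - g x) by rewrite gy; ring.
by rewrite add0r (le_trans (ler_normB _ _)) //; lra.
Qed.

Lemma PL_right x : s0 <= x -> exists eta (m : int) c, [/\ 0 < eta, G c &
  forall y, x <= y -> y < x + eta -> g y = P ^ m * y + c].
Proof.
move=> s0x; have [eta eta0 reg] := PL_regular s0x.
have [||m [c [Gc lin]]] := @affine_interval g x (x + eta); first by rewrite ltrDl.
  move=> z xz zx; apply: reg; rewrite ?gt_eqF ?ltr_distl //; lra.
exists eta, m, c; split => // y; rewrite le_eqVlt => /predU1P[<-|xy] yx; last exact: lin.
apply: PL_limit => // d d0.
have mn0 : 0 < Num.min d eta by rewrite lt_min d0.
have mnd : Num.min d eta <= d by rewrite ge_min lexx.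
have mne : Num.min d eta <= eta by rewrite ge_min lexx orbT.
exists (x + Num.min d eta / 2); split; [lra|rewrite ltr_distl; lra|].
by apply: lin; lra.
Qed.

Lemma PL_left x : s0 < x -> exists eta (m : int) c, [/\ 0 < eta, G c &
  forall y, x - eta < y -> y <= x -> g y = P ^ m * y + c].
Proof.
move=> s0x; have [eta' eta'0 reg] := PL_regular (ltW s0x).
pose eta := Num.min eta' (x - s0).
have eta0 : 0 < eta by rewrite lt_min eta'0 subr_gt0.
have etaE : eta <= eta' by rewrite ge_min lexx.
have etas : eta <= x - s0 by rewrite ge_min lexx orbT.
have [||m [c [Gc lin]]] := @affine_interval g (x - eta) x; first by rewrite gtrBl.
  move=> z xz zx; apply: reg; rewrite ?lt_eqF ?ltr_distl //; lra.
exists eta, m, c; split => // y xy; rewrite le_eqVlt => /predU1P[->|yx]; last exact: lin.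
apply: PL_limit => [|d d0]; first exact: ltW.
have mn0 : 0 < Num.min d eta by rewrite lt_min d0.
have mnd : Num.min d eta <= d by rewrite ge_min lexx.
have mne : Num.min d eta <= eta by rewrite ge_min lexx orbT.
exists (x - Num.min d eta / 2); split; [lra|rewrite ltr_distl; lra|].
by apply: lin; lra.
Qed.

(** Slopes are powers of [p], hence positive, and interval induction carries the inequality across
    corners. *)
Lemma PL_increasing x y : s0 <= x -> x < y -> g x < g y.
Proof.
move=> s0x xy; suff [yx|//] : y = x \/ g x < g y by rewrite yx ltxx in xy.
have incr m c u w : u < w -> P ^ m * u + c < P ^ m * w + c.
  by move=> uw; rewrite ltrD2r ltr_pM2l.
apply: (@interval_induction _ (fun z => z = x \/ g x < g z) x y (ltW xy)); last by left.
move=> z xz zy; have s0z := le_trans s0x xz.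
have [er [mr [cr [er0 _ right]]]] := PL_right s0z.
have step eta : 0 < eta -> (forall u w, x <= u -> u < w -> z - eta < u -> w < z + eta -> g u < g
  w) ->
  exists2 eta : R, 0 < eta & forall u w, x <= u -> u <= w -> w <= y -> z - eta < u ->
    w < z + eta -> u = x \/ g x < g u -> w = x \/ g x < g w.
  move=> eta0 inc; exists eta => // u w xu; rewrite le_eqVlt => /predU1P[->//|uw] _ zu wz.
  by have uw' := inc u w xu uw zu wz; case=> [ux|/lt_trans/(_ uw')]; right; rewrite // -ux.
have := s0z; rewrite le_eqVlt => /predU1P[s0E|s0lt].
  apply: (step er) => // u w xu uw _ wz; have zu : z <= u by rewrite -s0E (le_trans s0x).
  by rewrite !right ?incr //; lra.
have [el [ml [cl [el0 _ left]]]] := PL_left s0lt.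
apply: (step (Num.min er el)); first by rewrite lt_min er0.
have mnr : Num.min er el <= er by rewrite ge_min lexx.
have mnl : Num.min er el <= el by rewrite ge_min lexx orbT.
move=> u w xu uw zu wz.
have [wz'|zw] := leP w z; first by rewrite !left ?incr //; lra.
have [zu'|uz] := leP z u; first by rewrite !right ?incr //; lra.
apply: (@lt_trans _ _ (g z)).
  by rewrite !left ?incr ?lexx //; lra.
by rewrite !right ?incr ?lexx //; lra.
Qed.

Lemma PL_unbounded : ~ [bounded g s | s in `[s0, +oo[] ->
  forall A, exists2 x, s0 < x & A < g x.
Proof.
move=> unb A; apply: contrapT => none; apply: unb.
exists (Num.max `|g s0| `|A|); split; first exact: num_real.
move=> B /ltW AB x /inI s0x; apply: le_trans AB.
have xA : x = s0 \/ g x <= A.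
  move: s0x; rewrite le_eqVlt => /predU1P[->|s0x]; [by left|right].
  by rewrite leNgt; apply/negP => Ax; apply: none; exists x.
case: xA => [->|xA]; first by rewrite le_max lexx.
have s0g : g s0 <= g x.
  by move: s0x; rewrite le_eqVlt => /predU1P[->//|/(PL_increasing (lexx s0))/ltW].
rewrite le_max; have [g0|g0] := leP 0 (g x).
  by rewrite (ger0_norm g0) (le_trans xA (ler_norm _)) orbT.
by rewrite (ltr0_norm g0) (ltr0_norm (le_lt_trans s0g g0)) lerN2 s0g.
Qed.

End PL.

(** * Transition functions and automorphisms *)

Section Transition.
Variables (R : realType) (k K : closedFieldType) (vk : absval R k) (v : absval R K).
Variables (iota : {rmorphism k -> K}) (t : K) (p : nat).
Hypothesis cK : complete_in v [set: K].
Hypothesis gt : ta_generator v iota t.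
Hypothesis pr_p : prime p.
Hypothesis vp : v p%:R < 1.
Hypothesis nt : value_group v <> [set 1].
Hypothesis Ik : intermediate v iota (range iota).
Hypothesis r0 : 0 < inf_dist v (range iota) t.
Local Notation I := (intermediate v iota).
Local Notation dist := (inf_dist v).
Local Notation P := (p%:R : R).
Let s0 : R := - ln (dist (range iota) t).

Let P0 : 0 < P. Proof. by rewrite ltr0n prime_gt0. Qed.
Let Pz (m : int) : 0 < P ^ m. Proof. by rewrite exprz_gt0. Qed.

Lemma log_value_groupP (a : R) : log_value_group v a <-> log_value v a.
Proof.
split=> [[_ [z z0 <-] <-]|[z zE]]; first by exists z; rewrite lnK // posrE absval_gt0.
exists (v z); last by rewrite zE expRK.
by exists z => //; rewrite /= -(absval_gt0 v) zE expR_gt0.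
Qed.

(** The difference of two powers of [p] is a power of [p] times a nonzero integer, and [ln|K^*|] is
    divisible. Hence a point where two pieces of different slopes meet lies in [ln|K^*|]. *)
Lemma log_value_slope (m m' : int) (x : R) : m != m' ->
  log_value v (x * (P ^ m - P ^ m')) -> log_value v x.
Proof.
wlog lt : m m' / m' < m => [H mm'|_ Gx].
  have [h|h] : m' < m \/ m < m' by move: mm'; case: ltgtP; auto.
    exact: H.
  move=> /log_valueN; rewrite -mulrN opprB; apply: (H m' m) => //.
  by rewrite eq_sym.
have [n mE] : exists n : nat, m = m' + n.+1%:Z.
  by exists (`|m - m'|%N.-1); lia.
have Pn0 : P != 0 by rewrite gt_eqF.
have Pn1 : (0 < p ^ n.+1 - 1)%N by rewrite subn_gt0 -[X in (X < _)%N](expn0 p) ltn_exp2l //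
  prime_gt1.
have -> : x = x * (P ^ m - P ^ m') * P ^ (- m') / (p ^ n.+1 - 1)%:R.
  rewrite natrB ?natrX; last by rewrite expn_gt0 prime_gt0.
  rewrite mE expfzDr // -exprnP -invr_expz; field.
  rewrite expfz_neq0 // andbT -natrX -(natrB _ (n := 1)) ?pnatr_eq0 -?lt0n //.
  by rewrite expn_gt0 prime_gt0.
by apply: log_value_divn => //; apply: log_valueMz.
Qed.

Lemma PL_realized (g : R -> R) j s1 M u : PL_fun p (log_value_group v) `[s0, +oo[ g ->
  ~ [bounded g s | s in `[s0, +oo[] -> s0 < s1 -> log_value v s1 -> M < g s1 ->
  realizes v iota t u (straighten p j s1 g) ->
  exists2 t', v (t' - u) <= expR (- M) & realizes v iota t t' g.
Proof.
move=> gPL unb; have p1 := prime_gt1 pr_p.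
have [L L0 pL] := exists_expR_bound (absval_ge0 v _) vp.
apply: (straighten_limit cK gt pr_p vp nt Ik r0 pL) => //.
- by move=> x y; exact: PL_increasing p1 gPL _ _.
- move=> x s0x; have [el [ml [cl [el0 /log_value_groupP Gl left]]]] := PL_left p1 gPL s0x.
  have [er [mr [cr [er0 /log_value_groupP Gr right]]]] := PL_right p1 gPL (ltW s0x).
  have mnl : Num.min el er <= el by rewrite ge_min lexx.
  have mnr : Num.min el er <= er by rewrite ge_min lexx orbT.
  exists (Num.min el er), ml, mr; split.
  + by rewrite lt_min el0.
  + by move=> y xy yx; rewrite !left; [ring|lra..].
  + by move=> y xy yx; rewrite !right; [ring|lra..].
  have [->|neq] := eqVneq ml mr; [by left|right].
  apply: (log_value_slope neq).
  have -> : x * (P ^ ml - P ^ mr) = cr - cl.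
    by have := left x; rewrite right ?lexx; [move=> h; have := h; lra|lra..].
  exact: log_valueB.
- move=> x s0x Gx; have [e [m [c [e0 /log_value_groupP Gc right]]]] := PL_right p1 gPL (ltW s0x).
  rewrite right ?lexx ?ltrDl //; apply: log_valueD => //.
  by rewrite mulrC; exact: log_valueMz.
- exact: PL_unbounded p1 gPL unb.
Qed.

Lemma rho_logE F (x : K) (s : R) : dist F x = expR (- s) -> rho_log v x F = s%:E.
Proof.
by move=> xE; rewrite /rho_log xE lne_EFin ?expR_gt0 // expRK /= opprK.
Qed.

Lemma rho_log_dist0 F (x : K) : dist F x = 0 -> rho_log v x F = +oo%E.
Proof. by move=> xE; rewrite /rho_log xE le0_lneNy. Qed.

Lemma rho_log_fin F (x : K) (s : R) : rho_log v x F = s%:E -> dist F x = expR (- s).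
Proof.
have := inf_dist_ge0 v F x; rewrite le_eqVlt => /predU1P[/esym/rho_log_dist0 -> //|x0].
by rewrite (rho_logE (expR_opp_ln x0)) => -[<-]; exact: expR_opp_ln.
Qed.

Lemma rho_log_infty F (x : K) : rho_log v x F = +oo%E -> dist F x = 0.
Proof.
have := inf_dist_ge0 v F x; rewrite le_eqVlt => /predU1P[//|x0].
by rewrite (rho_logE (expR_opp_ln x0)).
Qed.

Lemma intermediate_setT : I [set: K].
Proof. by split => //; [exact: subfield_setT | exact: alg_closed_setT]. Qed.

(** The partial inverse picks some field at the given distance; [realizes] speaks of all of them, so
    the choice is immaterial. At infinity the field contains [t], hence also [t']. *)
Lemma transition_realizes t' (g : R -> R) : realizes v iota t t' g ->
  (forall s, s0 <= s -> transition v iota t t' s%:E = (g s)%:E) /\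
  transition v iota t t' +oo%E = +oo%E.
Proof.
move=> Rt'; pose inv := 'pinv_(fun=> [set: K]) I (rho_log v t).
have invP s : (rho_log v t @` I) s -> I (inv s) /\ rho_log v t (inv s) = s.
  by move=> fs; split;
    [exact: (@funS _ _ _ _ ('pinv_(fun=> [set: K]) I (rho_log v t)) s fs) | apply: pinvK;
      exact/mem_set].
split=> [s s0s|].
  have [|IF Fs] := invP s%:E.
    by have [F IF Fs] := intermediate_exists cK gt pr_p vp nt Ik r0 s0s; exists F => //;
      exact: rho_logE.
  rewrite /transition /= -/inv; apply: rho_logE; apply: Rt' => //.
  exact: rho_log_fin.
have [|IF FT] := invP +oo%E.
  by exists [set: K]; [exact: intermediate_setT | apply/rho_log_dist0/inf_dist_mem].
rewrite /transition /= -/inv; apply: rho_log_dist0; apply: inf_dist_mem.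
apply: (generator_full gt) => //; apply: (complete_inf_dist0 (v := v)).
- exact: intermediate_nonempty IF.
- exact: intermediate_complete IF.
- exact: rho_log_infty.
Qed.

Lemma isometry_image (L : closedFieldType) (vL : absval R L) (psi : {rmorphism L -> K}) :
  complete_in vL [set: L] -> (forall x, v (psi x) = vL x) -> range iota `<=` range psi ->
  I (range psi).
Proof.
move=> cL vpsi sub; split => //.
- split=> [|a b|a b]; rewrite !in_setE.
  + by exists 1; rewrite ?rmorph1.
  + by move=> [x _ <-] [y _ <-]; exists (x - y); rewrite ?rmorphB.
  + by move=> [x _ <-] [y _ <-]; exists (x / y); rewrite ?fmorph_div.
- move=> q qF sq; have qF' (i : nat) : range psi q`_i.
    move: qF; rewrite qualifE /= => /allP qF; have [h|h] := leqP (size q) i.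
      by rewrite nth_default //; exists 0; rewrite ?rmorph0.
    by have := qF _ (mem_nth 0 h); rewrite in_setE.
  have /choice [f fP] : forall i : nat, exists x, psi x = q`_i.
    by move=> i; have [x _ xE] := qF' i; exists x.
  have qE : q = map_poly psi (\poly_(i < size q) f i).
    apply/polyP => i; rewrite coef_map coef_poly; case: ltnP => [_|h]; first exact/esym/fP.
    by rewrite nth_default //; exact/esym/(rmorph0 psi).
  have [|x qx] := @closed_root _ (\poly_(i < size q) f i); first by have := sq;
    rewrite {1}qE size_map_poly.
  by exists (psi x); [exists x | rewrite qE fmorph_root].
- apply/complete_inP => u uF uc.
  have /choice [w wE] : forall n, exists x, psi x = u n.
    by move=> n; have [x _ xE] := uF n; exists x.
  have [//||l _ lP] := iffLR (complete_inP vL _) cL w.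
    move=> e e0; have [N NP] := uc e e0; exists N => m n Nm Nn.
    by rewrite -vpsi rmorphB !wE NP.
  exists (psi l); first by exists l.
  move=> e e0; have [N NP] := lP e e0; exists N => n Nn.
  by rewrite -wE -rmorphB vpsi NP.
Qed.

(** The image of [psi] is an intermediate field containing the generator [psi t], hence all of
    [K]. *)
Lemma isometric_aut_of_generator (psi : {rmorphism K -> K}) : (forall x, v (psi x) = v x) ->
  (forall c, psi (iota c) = iota c) -> ta_generator v iota (psi t) ->
  isometric_aut v iota psi.
Proof.
move=> vpsi psic gt'; split => //.
have Ip : I (range psi).
  by apply: (isometry_image cK vpsi) => _ [c _ <-]; exists (iota c).
have surj y : exists x, psi x = y.
  have [x _ xE] : range psi y by apply: (generator_full gt') => //; exists t.
  by exists x.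
have /choice [phi phiP] := surj; exists phi => // x.
by apply: (fmorph_inj psi); rewrite phiP.
Qed.

End Transition.

Lemma residue_char_absval (R : realType) (k : fieldType) (vk : absval R k) p :
  p \in [pchar (residue_field vk)] -> prime p /\ vk p%:R < 1.
Proof.
rewrite inE => /andP[pr_p /eqP p0]; split => //.
have : (p%:R - 0 : valuation_ring vk) \in maximal_ideal vk.
  rewrite Quotient.idealrBE; apply/eqP.
  have := rmorph_nat (\pi_({ideal_quot (maximal_ideal vk)}))%qT p.
  by rewrite [RHS]p0 -(rmorph0 (\pi_({ideal_quot (maximal_ideal vk)}))%qT).
by rewrite subr0 inE rmorph_nat.
Qed.

Theorem theorem3p2p16 (R : realType) (k K : closedFieldType)
    (vk : absval R k) (vK : absval R K) (iota : {rmorphism k -> K})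
    (t : K) (p : nat)
    (vk_complete : complete_in vk [set: k])
    (vK_complete : complete_in vK [set: K])
    (iota_isometric : forall c : k, vK (iota c) = vk c)
    (t_generator : ta_generator vK iota t)
    (r_gt0 : 0 < inf_dist vK (range iota) t)
    (vK_nontrivial : value_group vK <> [set 1])
    (residue_char : p \in [pchar (residue_field vk)]) :
  let s0 : R := - ln (inf_dist vK (range iota) t) in
  (forall rho : \bar R -> \bar R,
     PL_fun_ext p (log_value_group vK) s0 rho ->
     (value_group vK <> value_group vk ->
        exists (n b : int) (a : k),
          [/\ endpoint_slope s0 rho ((p%:R : R) ^ n),
              ~~ (p%:Z %| b)%Z, a != 0 &
              rho s0%:E =
                (- ((p%:R : R) ^ n * b%:~R * ln (inf_dist vK (range iota) t))
                   - ln (vk a))%:E]) ->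
     exists2 t' : K, ta_generator vK iota t' &
       forall s : \bar R, (s0%:E <= s)%E -> rho s = transition vK iota t t' s)
  /\
  (forall rho : \bar R -> \bar R,
     PL_fun_ext p (log_value_group vk) s0 rho ->
     (\forall s \near s0, s0 <= s -> rho s%:E = s%:E) ->
     exists2 psi : {rmorphism K -> K}, isometric_aut vK iota psi &
       forall s : \bar R, (s0%:E <= s)%E -> Lambda vK iota t psi s = rho s).
Proof.
move=> s0; have [pr_p vkp] := residue_char_absval residue_char.
have vp : vK p%:R < 1 by rewrite -(rmorph_nat iota) iota_isometric.
have p1 := prime_gt1 pr_p.
have Ik : intermediate vK iota (range iota).
  exact: isometry_image vk_complete iota_isometric _.
have transition_rho t' (g : R -> R) (rho : \bar R -> \bar R) : rho +oo%E = +oo%E ->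
    (forall s, s0 <= s -> rho s%:E = (g s)%:E) -> realizes vK iota t t' g ->
    forall s, (s0%:E <= s)%E -> rho s = transition vK iota t t' s.
  move=> rhoT rhog Rt'.
  have [fin inf] := transition_realizes vK_complete t_generator pr_p vp vK_nontrivial Ik r_gt0 Rt'.
  case=> [s| |//]; last by rewrite rhoT inf.
  by rewrite lee_fin => s0s; rewrite rhog // fin.
split=> rho [rhoT [g [gPL gunb rhog]]]; last first.
  move=> near_id; have /nbhs_ballP[d /= d0 dP] := near_id.
  have {}dP s : s0 <= s -> s < s0 + d -> g s = s.
    move=> s0s sd; apply/EFin_inj; rewrite -rhog // dP // /ball /= distrC ltr_distl; lra.
  have gPL' : PL_fun p (log_value_group vK) `[s0, +oo[ g.
    have [gc [C [CI Cd Cr]]] := gPL; split => //; exists C; split => // s Is nC.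
    have [n [c [/log_value_groupP [z zE] near]]] := Cr s Is nC; exists n, c; split => //.
    by apply/log_value_groupP; exists (iota z); rewrite iota_isometric.
  have [s1 G1 /andP[s01 s1d]] := exists_log_value_between t_generator vK_nontrivial r_gt0
    (ltac:(by rewrite ltrDl) : s0 < s0 + d).
  (* [M > s0] gives [|t' - t| < r], as [extend_isometry] requires, and [M < s1 = g s1] is the
     condition of [PL_realized]. For [j = 0] the straightened profile is the identity, so [t] itself
     is the starting element. *)
  pose M := (s0 + s1) / 2.
  have [||t' t't Rt'] := PL_realized vK_complete t_generator pr_p vp vK_nontrivial Ik r_gt0
    (u := t) (j := 0) (M := M) gPL' gunb s01 G1.
  - by rewrite dP ?(ltW s01) // /M; lra.
  - move=> F s IF Fs; have s0s := intermediate_ge_s0 r_gt0 IF Fs.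
    rewrite Fs /straighten expr0z mul1r; congr (expR (- _)).
    have [ss1|s1s] := leP s s1.
      by rewrite dP ?(le_lt_trans ss1) // max_r ?subr_le0 // addr0.
    by rewrite dP ?(ltW s01) // max_l ?subr_ge0 ?(ltW s1s) // subrKC.
  have [|psi [vpsi psik psit]] := @extend_isometry _ _ _ _ iota t vK_complete t_generator _ t' Ik.
    apply: le_lt_trans t't _; rewrite (expR_opp_ln r_gt0) -/s0 ltr_expR /M; lra.
  have psic c : psi (iota c) = iota c by apply: psik; exists c.
  exists psi.
    apply: (isometric_aut_of_generator vK_complete (t := t)) => //; rewrite psit.
    exact (realizes_generator vK_complete t_generator Rt').
  by move=> s s0s; rewrite /Lambda psit -(transition_rho t' g rho).
move=> endpoint.
(* The germ of [g] at [s0] is normalized: scaling by [a] accounts for the term in [vk a], while [c0]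
   is 0 if the value groups agree and otherwise comes from a power of [t - c]. *)
have [u0 [c0 [n [a [e [a0 R0 G0 e0 lin]]]]]] : exists u0 c0 (n : int) a e, [/\ a != 0,
    realizes vK iota t u0 (fun s => s + c0), log_value vK c0, 0 < e &
    forall s, s0 <= s -> s < s0 + e -> g s = (p%:R : R) ^ n * (s + c0) - ln (vk a)].
  have [vKk|vKk] := pselect (value_group vK = value_group vk).
    have [e [n [c [e0 [_ [z z0 <-] cE] lin]]]] := PL_right p1 gPL (lexx s0).
    have : value_group vk (vK z) by rewrite -vKk; exists z.
    move=> [a a0 aE]; exists t, 0, n, a^-1, e; split => //.
    - by rewrite invr_eq0.
    - by move=> F s IF Fs; rewrite addr0.
    - by exists 1; rewrite absval1 expR0.
    - by move=> s s0s se; rewrite lin // addr0 absvalV lnV ?posrE ?absval_gt0 // opprK aE cE.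
  have [n [b [a [[c near] pb a0 rho0]]]] := endpoint vKk.
  have [u Ru Gu] := realizes_power iota_isometric t_generator pr_p vp r_gt0 vKk pb.
  have /nbhs_ballP[d /= d0 dP] := near.
  have gE s : s0 <= s -> s < s0 + d -> g s = (p%:R : R) ^ n * s + c.
    move=> s0s sd; apply/EFin_inj; rewrite -rhog // dP // /ball /= distrC ltr_distl; lra.
  exists u, ((b%:~R - 1) * s0), n, a, d; split => // s s0s sd.
  rewrite gE //; have := gE s0 (lexx _) (ltac:(by rewrite ltrDl)).
  have : g s0 = - ((p%:R : R) ^ n * b%:~R * - s0) - ln (vk a).
    by apply/EFin_inj; rewrite -rhog // rho0 opprK.
  by move=> ->; lra.
have [j [s1 [u [s01 s1e G1 Ru]]]] := exists_start iota_isometric pr_p vp Ik r_gt0 t_generator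
  vK_nontrivial n R0 G0 e0.
have [||t' _ Rt'] := PL_realized vK_complete t_generator pr_p vp vK_nontrivial Ik r_gt0
    (u := iota a * u) (j := j) (M := g s1 - 1) gPL gunb s01 G1.
- by rewrite gtrBl.
- refine (realizes_ext r_gt0 _ (realizes_scale iota_isometric a0 Ru)) => s s0s; rewrite /straighten.
  have h1 : s0 <= Num.min s s1 by rewrite le_min s0s ltW.
  have h2 : Num.min s s1 < s0 + e by rewrite (le_lt_trans _ s1e) // ge_min lexx orbT.
  by rewrite lin // addrAC.
exists t'; first exact (realizes_generator vK_complete t_generator Rt').
exact: transition_rho rhog Rt'.
Qed.
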